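(* Let $\kappa>0$, $\alpha>|\beta|>0$, $\mu\in\mathbb{R}$, $\gamma>0$ with $\gamma^2=\alpha^2-\beta^2$, $\lambda>0$, and let $q^*\ge2$ be a fixed integer with $q^*<|\alpha|-|\beta|$. Let $X(t)$ be a stationary $VG(\kappa,\alpha,\beta,\mu)$ Ornstein-Uhlenbeck (OU) type process with parameter $\lambda$ (see context), let $$\Lambda(t)=\exp\{X(t)-c_X\},\qquad c_X=\mu+2\kappa\log\Bigl(\gamma/\sqrt{\alpha^2-(\beta+1)^2}\Bigr),$$ and let $\Lambda^{(j)}$, $j=0,1,2,\dots$, be independent copies of $\Lambda$. Put $Q=\{q:0<q<q^*\}$. Then, for any $$b>\exp\left\{2\kappa\left[\frac1{q^*-1}\log\frac{\gamma}{\sqrt{\alpha^2-(\beta+q^* )^2}}+\frac{q^*}{1-q^*}\log\frac{\gamma}{\sqrt{\alpha^2-(\beta+1)^2}}\right]\right\},$$ the stochastic processes $$A_n(t)=\int_0^t\prod_{j=0}^n\Lambda^{(j)}(sb^j)\,ds,\qquad t\in[0,1],$$ converge in $\mathcal{L}_q$ to a stochastic process $A(t)$ as $n\to\infty$ such that, if $A(1)\in\mathcal{L}_q$ for $q\in Q$, $$\mathrm{E}A(t)^q\sim t^{\varsigma(q)},$$ where the scaling function is given by $$\varsigma(q)=q\left(1+\frac{2\kappa}{\log b}\log\frac{\gamma}{\sqrt{\alpha^2-(\beta+1)^2}}\right)+\frac{2\kappa}{\log b}\log\sqrt{\alpha^2-(\beta+q)^2}-\frac{2\kappa}{\log b}\log\gamma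 .$$ Moreover, $$\mathrm{Var}\,A(t)\ge\int_0^t\!\!\int_0^t\bigl(M(1,1;u-w)-1\bigr)\,du\,dw,$$ where $M(\zeta_1,\zeta_2;t_1-t_2)=e^{-c_X(\zeta_1+\zeta_2)}\,\mathrm{E}\exp\{\zeta_1X(t_1)+\zeta_2X(t_2)\}$.
   Context: Variance gamma law $VG(\kappa,\alpha,\beta,\mu)$: the distribution with $\log\mathrm{E}e^{\zeta X}=\mu\zeta+2\kappa\log\bigl(\gamma/\sqrt{\alpha^2-(\beta+\zeta)^2}\bigr)$ for $|\beta+\zeta|<\alpha$, where $\gamma^2=\alpha^2-\beta^2$, $\kappa>0$, $\alpha>|\beta|>0$, $\mu\in\mathbb{R}$. It is self-decomposable. Stationary OU type process with a given self-decomposable marginal law $D$ and parameter $\lambda>0$: a strictly stationary process with $X(0)\sim D$ and $X(t)=e^{-\lambda t}X(0)+\int_{(0,t]}e^{-\lambda(t-s)}\,dZ(\lambda s)$, $t\ge0$, where $Z$ is a L\'evy process independent of $X(0)$ (the background driving L\'evy process, determined by $D$). The mother process $\Lambda$ is measurable and separable. Convergence in $\mathcal{L}_q$ (for $q\in Q$) means $\mathrm{E}|A_n(t)-A(t)|^q\to0$ for each fixed $t\in[0,1]$. Notation: $\mathrm{E}A(t)^q\sim t^{p}$ means that there are constants $0<\underline{C}\le\overline{C}<\infty$ (possibly depending on $q$ but not on $t$) with $\underline{C}\,t^{p}\le\mathrm{E}A(t)^q\le\overline{C}\,t^{p}$ for all $t\in[0,1]$. *)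

(* Defs.v *)
From HB Require Import structures.
From mathcomp Require Export all_boot all_order all_algebra finmap.
From mathcomp Require Export all_classical all_reals all_analysis.

Set Implicit Arguments.
Unset Strict Implicit.
Unset Printing Implicit Defensive.

Export Order.TTheory GRing.Theory Num.Theory.
Export numFieldNormedType.Exports.

Local Open Scope classical_set_scope.
Local Open Scope ring_scope.

(* The time set of a process [X : R -> T -> R] is [0, +oo[; its values at
   negative times are junk and no definition below looks at them. *)
Definition times (R : realType) : set R := `[0, +oo[%classic.
Arguments times R : clear implicits.

Section independence.
Context d (T : measurableType d) (R : realType) (P : probability T R).

Definition mutually_independent (I : choiceType) (F : I -> set (set T)) : Prop :=
  forall (J : {fset I}) (E : I -> set T),
    (forall i, i \in J -> F i (E i)) ->
    P (\bigcap_(i in [set` J]) E i) = (\prod_(i <- J) P (E i))%E.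

Definition independent_pair (F G : set (set T)) : Prop :=
  forall A B, F A -> G B -> P (A `&` B) = (P A * P B)%E.

Definition sigma_rv (Y : T -> R) : set (set T) :=
  preimage_set_system setT Y measurable.

Definition sigma_process (X : R -> T -> R) : set (set T) :=
  <<s \bigcup_(t in times R) sigma_rv (X t) >>.

End independence.

Section finite_dimensional_laws.
Context (R : realType).

(* A finite-dimensional law is determined by its values on the measurable
   rectangles B_0 x ... x B_(n-1). *)
Definition same_fdd d (T : measurableType d) (P : probability T R)
    d' (T' : measurableType d') (P' : probability T' R)
    (X : R -> T -> R) (X' : R -> T' -> R) : Prop :=
  forall (n : nat) (t : 'I_n -> R) (B : 'I_n -> set R),
    (forall i, times R (t i)) -> (forall i, measurable (B i)) ->
    P (\bigcap_i (X (t i) @^-1` B i)) = P' (\bigcap_i (X' (t i) @^-1` B i)).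

Definition strictly_stationary d (T : measurableType d) (P : probability T R)
    (X : R -> T -> R) : Prop :=
  forall h, 0 <= h -> same_fdd P P X (fun t => X (t + h)).

End finite_dimensional_laws.

Section sample_paths.
Context d (T : measurableType d) (R : realType) (P : probability T R).
Implicit Type X : R -> T -> R.

Definition measurable_process X : Prop :=
  measurable_fun (times R `*` [set: T]) (fun z : R * T => X z.1 z.2).

(* Separability in the sense of Doob, relative to the class of closed sets. *)
Definition separable_process X : Prop :=
  exists S : set R, [/\ countable S, S `<=` times R &
    exists N : set T, P.-negligible N /\
      forall (a b : R) (F : set R), closed F ->
        [set w | forall t, S t -> t \in `]a, b[ -> F (X t w)] `\`
        [set w | forall t, times R t -> t \in `]a, b[ -> F (X t w)] `<=` N].

Definition cadlag (f : R -> R) : Prop :=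
  forall t, 0 <= t ->
    f s @[s --> t^'+] --> f t /\ (0 < t -> cvg (f s @[s --> t^'-])).

End sample_paths.

Section levy.
Context d (T : measurableType d) (R : realType) (P : probability T R).
Implicit Type Z : R -> {RV P >-> R}.

Definition independent_increments Z : Prop :=
  forall (n : nat) (t : nat -> R), 0 <= t 0%N ->
    (forall i, (i < n)%N -> t i < t i.+1) ->
    mutually_independent P (fun i : 'I_n.+1 =>
      sigma_rv (fun w => if i == 0%N :> nat then Z (t 0%N) w
                         else Z (t i) w - Z (t i.-1) w)).

Definition stationary_increments Z : Prop :=
  forall (s h : R) (B : set R), 0 <= s -> 0 <= h -> measurable B ->
    P [set w | B (Z (s + h) w - Z s w)] = P [set w | B (Z h w - Z 0 w)].

Definition stochastically_continuous Z : Prop :=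
  forall t eps : R, 0 <= t -> 0 < eps ->
    P [set w | eps < `|Z s w - Z t w|] @[s --> within (times R) (nbhs t)]
      --> 0%E.

Definition levy_process Z : Prop :=
  [/\ {ae P, forall w, Z 0 w = 0},
      independent_increments Z,
      stationary_increments Z,
      stochastically_continuous Z &
      {ae P, forall w, cadlag (Z ^~ w)}].

(* \sum_k f(s_k) (Y(s_(k+1)) - Y(s_k)) along the partition
   a = s_0 < s_1 < ... < s_m = b, where [s] lists s_1, ..., s_m. *)
Definition stieltjes_sum (f : R -> R) (Y : R -> T -> R) (a : R) (s : seq R)
    (w : T) : R :=
  \sum_(k < size s)
    f (nth a (a :: s) k) * (Y (nth a s k) w - Y (nth a (a :: s) k) w).

(* [I] is (a version of) the integral of the deterministic continuous
   function [f] with respect to [Y] over ]a, b]: the limit in probability of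
   the Stieltjes sums as the mesh of the partition tends to 0. *)
Definition stochastic_integral (f : R -> R) (Y : R -> T -> R) (a b : R)
    (I : T -> R) : Prop :=
  forall eps eta : R, 0 < eps -> 0 < eta ->
    exists2 delta : R, 0 < delta &
      forall s : seq R, itv_partition a b s ->
        (forall k, (k < size s)%N -> nth a s k - nth a (a :: s) k < delta) ->
        (P [set w | (eps < `|stieltjes_sum f Y a s w - I w|)%R] <= eta%:E)%E.

End levy.

Section ornstein_uhlenbeck.
Context d (T : measurableType d) (R : realType) (P : probability T R).

Definition stationary_OU (lambda : R) (X : R -> {RV P >-> R}) : Prop :=
  strictly_stationary P X /\
  exists Z : R -> {RV P >-> R},
    [/\ levy_process Z,
        independent_pair P (sigma_rv (X 0)) (sigma_process Z) &
        forall t, 0 <= t ->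
          exists I : {RV P >-> R},
            stochastic_integral P (fun s => expR (- lambda * (t - s)))
              (fun s => Z (lambda * s)) 0 t I /\
            {ae P, forall w, X t w = expR (- lambda * t) * X 0 w + I w}].

(* X follows the variance gamma law VG(kappa, alpha, beta, mu), which is
   defined through its log-moment generating function. *)
Definition VG_law (kappa alpha beta mu : R) (X : {RV P >-> R}) : Prop :=
  let gamma := Num.sqrt (alpha ^+ 2 - beta ^+ 2) in
  forall zeta : R, `|beta + zeta| < alpha ->
    lne ('M_P X zeta) =
    (mu * zeta + 2 * kappa *
       ln (gamma / Num.sqrt (alpha ^+ 2 - (beta + zeta) ^+ 2)))%:E.

Definition VG_OU (kappa alpha beta mu lambda : R) (X : R -> {RV P >-> R}) :
    Prop :=
  VG_law kappa alpha beta mu (X 0) /\ stationary_OU lambda X.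

(* M(zeta1, zeta2; t1 - t2), as a function of both times: for a stationary X
   it depends on them through t1 - t2 only. *)
Definition bivariate_mgf (X : R -> T -> R) (c zeta1 zeta2 t1 t2 : R) : \bar R :=
  ((expR (- c * (zeta1 + zeta2)))%:E *
   'E_P[fun w => expR (zeta1 * X t1 w + zeta2 * X t2 w)%R])%E.

End ornstein_uhlenbeck.

Section multifractal_products.
Context d (T : measurableType d) (R : realType) (P : probability T R).

(* L j, for j = 0, 1, 2, ..., are independent copies of the measurable and
   separable process L0 (which may live on another probability space); each
   copy is itself measurable and separable. *)
Definition independent_copies d0 (T0 : measurableType d0)
    (P0 : probability T0 R) (L0 : R -> T0 -> R)
    (L : nat -> R -> {RV P >-> R}) : Prop :=
  [/\ forall j, same_fdd P P0 (L j) L0,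
      forall j, measurable_process (L j),
      forall j, separable_process P (L j) &
      mutually_independent P (fun j => sigma_process (L j))].

Definition product_integral (L : nat -> R -> T -> R) (b : R) (n : nat) (t : R)
    (w : T) : R :=
  Rintegral lebesgue_measure `[0, t]%classic
    (fun s => \prod_(j < n.+1) L j (s * b ^+ j) w).

Definition cvg_Lq (q : R) (An : nat -> R -> T -> R) (A : R -> T -> R) : Prop :=
  forall t, 0 <= t <= 1 ->
    ('E_P[fun w => (`|An n t w - A t w| `^ q)%R])%E @[n --> \oo] --> 0%E.

(* E A(t)^q ~ t^p on [0, 1] *)
Definition moment_scaling (q p : R) (A : R -> T -> R) : Prop :=
  exists Clow Cup : R, [/\ 0 < Clow, Clow <= Cup &
    forall t, 0 <= t <= 1 ->
      ((Clow * t `^ p)%:E <= 'E_P[fun w => (A t w `^ q)%R])%E /\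
      ('E_P[fun w => (A t w `^ q)%R] <= (Cup * t `^ p)%:E)%E].

End multifractal_products.

Definition VG_scaling (R : realType) (kappa alpha beta gamma b q : R) : R :=
  q * (1 + 2 * kappa / ln b *
         ln (gamma / Num.sqrt (alpha ^+ 2 - (beta + 1) ^+ 2)))
  + 2 * kappa / ln b * ln (Num.sqrt (alpha ^+ 2 - (beta + q) ^+ 2))
  - 2 * kappa / ln b * ln gamma.

(* Main.v *)
(** Write Y for X - c_X and psi(z) for its log-moment generating function, so that
    psi(0) = psi(1) = 0 and psi is convex. The OU recursion gives the
    log-moments of all linear combinations of values of Y in closed form.

    The condition on b says that theta = psi(p) / (p - 1) < log b for p = q*. By
    convexity of psi, the p-th moment of the product density at ordered points is
    at most a product, over the gaps x between consecutive points and the levels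
    j, of factors which are about e^theta as long as b^j x <= 1 and tend to 1
    quickly afterwards. Each gap thus contributes about x^(- theta / log b), which
    is integrable at 0, and the masses A_n(t) are bounded in L^p. They form a
    martingale, hence converge in L^2, and in L^q for all q < p by interpolation.

    For the scaling, choose n with t b^n <= 1 < t b^(n+1). On [0, t] the first n
    factors are nearly constant, so that A_N(t) / t is about W = prod_(j < n)
    Lambda_j(0) times a variable whose moments do not depend on t; making this
    precise under the measure W^q dP yields E A(t)^q ~ t^q e^(n psi(q)), which is
    t^(q - psi(q) / log b) up to constants.

    For the variance, E A(t)^2 is at least E A_0(t)^2, which is the double
    integral of M(1, 1; u - w), while E A(t) <= t. *)

Require Import Defs.
From mathcomp Require Import measurable_realfun ring lra.

Set Implicit Arguments.
Unset Strict Implicit.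
Unset Printing Implicit Defensive.

Local Open Scope classical_set_scope.
Local Open Scope ring_scope.

Import HBNNSimple.

(** * Integrals determined by laws *)

(** Moments of A_n have a usable form only for integer exponents, as integrals over finitely many
    points; hence the integer [qstar], and every fractional moment is reached by interpolation
    ([powR_interpolation]). The lower bounds are the hard direction. They come from v <= delta (1 +
    v^p) + K v^q: a first moment bounded below and a p-th moment bounded above force the q-th moment
    up. Under W^q dP the ratio v / W has first moment E W^(q-1) v and p-th moment E W^(q-p) v^p, so
    a negative power of the values at time 0 must be put in front of the chain of points, and psi is
    needed on all of [-p, p]; p + |beta| < alpha makes the variance gamma exponent finite there.
    From then on psi enters only through its convexity, a Lipschitz constant on [-p, p] and psi(0) =
    psi(1) = 0.

    As for theta = psi(p) / (p - 1): p coinciding points have exponent psi(p), which is shared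
    equally among their p - 1 gaps. *)

Section lift.
Local Open Scope ereal_scope.
Context (R : realType) d (T : measurableType d) dU (U : measurableType dU).
Variables (P : {measure set T -> \bar R}) (Y : T -> U) (H : T -> \bar R).
Hypotheses (mY : measurable_fun setT Y) (mH : measurable_fun setT H)
  (H0 : forall w, 0 <= H w).

Lemma measurable_indic_comp (B : set U) : measurable B ->
  measurable_fun setT (fun w : T => (\1_B (Y w) : R)%:E).
Proof.
move=> mB; apply/measurable_EFinP.
by apply: measurableT_comp mY; exact: measurable_indic.
Qed.

Lemma integral_mul_nnsfun (h : {nnsfun U >-> R}) :
  \int[P]_w (H w * (h (Y w))%:E) =
  \sum_(y \in range h)
    y%:E * \int[P]_w (H w * (\1_(h @^-1` [set y]) (Y w))%:E).
Proof.
under eq_integral => w _.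
  rewrite fimfunE -fsumEFin// ge0_mule_fsumr; last first.
    by move=> y; rewrite EFinM; exact: nnfun_muleindic_ge0.
  over.
rewrite ge0_integral_fsum//; last 2 first.
- move=> y; apply: emeasurable_funM => //.
  under eq_fun do rewrite EFinM.
  by apply: measurable_funeM; exact: measurable_indic_comp.
- by move=> y w _; rewrite mule_ge0// EFinM nnfun_muleindic_ge0.
apply: eq_fsbigr => y; rewrite inE => -[u _ <-].
under eq_integral do rewrite EFinM muleCA.
rewrite ge0_integralZl//.
- by apply: emeasurable_funM => //; exact: measurable_indic_comp.
- by move=> w _; rewrite mule_ge0// lee_fin.
- by rewrite lee_fin.
Qed.

Lemma integral_mul_nnsfun_cvg (g : U -> \bar R) (mg : measurable_fun setT g) :
  (forall u, 0 <= g u) ->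
  \int[P]_w (H w * (nnsfun_approx measurableT mg n (Y w))%:E)
    @[n --> \oo] --> \int[P]_w (H w * g (Y w)).
Proof.
move=> g0; pose G n w := H w * (nnsfun_approx measurableT mg n (Y w))%:E.
have cG w : G ^~ w n @[n --> \oo] --> H w * g (Y w).
  have cg : (nnsfun_approx measurableT mg n (Y w))%:E @[n --> \oo] --> g (Y w).
    by apply: cvg_nnsfun_approx.
  have nd : {homo (fun n => (nnsfun_approx measurableT mg n (Y w))%:E) :
      n m / (n <= m)%N >-> n <= m}.
    by move=> a b ab; rewrite lee_fin; exact/lefP/nd_nnsfun_approx.
  (* [cvgeM] excludes limits of the form 0 * oo; where g (Y w) or H w vanishes, the whole sequence
     is 0. *)
  have [gY0|gYN0] := eqVneq (g (Y w)) 0.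
    rewrite gY0 mule0 (_ : G ^~ w = cst 0); first exact: cvg_cst.
    apply/funext => n; rewrite /G.
    suff -> : (nnsfun_approx measurableT mg n (Y w))%:E = 0 by rewrite mule0.
    apply/eqP; rewrite eq_le; apply/andP; split; last by rewrite lee_fin.
    rewrite -gY0 (cvg_unique _ cg (ereal_nondecreasing_cvgn nd))//.
    by apply: ereal_sup_ubound; exists n.
  have [Hw0|HwN0] := eqVneq (H w) 0.
    rewrite /G Hw0 mul0e; under eq_fun do rewrite mul0e.
    exact: cvg_cst.
  apply: cvgeM => //; last exact: cvg_cst.
  by rewrite mule_defE (negbTE gYN0) (negbTE HwN0).
rewrite (_ : \int[P]_w (H w * g (Y w)) = \int[P]_w limn (G ^~ w)); last first.
  by apply: eq_integral => w _; apply/esym/cvg_lim.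
apply: cvg_monotone_convergence => //.
- move=> n; apply: emeasurable_funM => //; apply/measurable_EFinP.
  exact: measurableT_comp.
- by move=> n w _; rewrite mule_ge0// lee_fin.
- move=> w _ a b ab; apply: lee_wpmul2l => //.
  by rewrite lee_fin; exact/lefP/nd_nnsfun_approx.
Qed.

End lift.

(** Both sides are monotone limits of integrals of simple functions of Y and Y', hence of
    combinations of weighted indicators. Comparing laws needs two spaces; independence is obtained
    with a constant as one of the two weights. *)
Lemma eq_integral_indic (R : realType) d (T : measurableType d)
    d' (T' : measurableType d') dU (U : measurableType dU)
    (P : {measure set T -> \bar R}) (P' : {measure set T' -> \bar R})
    (Y : T -> U) (Y' : T' -> U) (H : T -> \bar R) (H' : T' -> \bar R)
    (g : U -> \bar R) :
  measurable_fun setT Y -> measurable_fun setT Y' ->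
  measurable_fun setT H -> measurable_fun setT H' ->
  (forall w, 0 <= H w)%E -> (forall w, 0 <= H' w)%E ->
  (forall B, measurable B -> (\int[P]_w (H w * (\1_B (Y w))%:E) =
                             \int[P']_w (H' w * (\1_B (Y' w))%:E)))%E ->
  measurable_fun setT g -> (forall u, 0 <= g u)%E ->
  (\int[P]_w (H w * g (Y w)) = \int[P']_w (H' w * g (Y' w)))%E.
Proof.
move=> mY mY' mH mH' H0 H'0 HB mg g0.
have := integral_mul_nnsfun_cvg (P := P) mY mH H0 mg g0.
under eq_fun => n.
  rewrite integral_mul_nnsfun//.
  under eq_fsbigr => y _ do rewrite HB//.
  rewrite -integral_mul_nnsfun//.
  over.
move=> /cvg_lim <- //.
by apply/cvg_lim => //; exact: integral_mul_nnsfun_cvg.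
Qed.

Section products.
Local Open Scope ereal_scope.
Context (R : realType).

Lemma prode_EFin (I : Type) (r : seq I) (p : pred I) (f : I -> R) :
  \prod_(i <- r | p i) (f i)%:E = (\prod_(i <- r | p i) f i)%R%:E.
Proof. by elim/big_rec2 : _ => // i x y _ ->; rewrite EFinM. Qed.

Lemma prode_nonneg (I : Type) (r : seq I) (p : pred I) (f : I -> \bar R) :
  (forall i, 0 <= f i) -> 0 <= \prod_(i <- r | p i) f i.
Proof. by move=> f0; elim/big_rec : _ => // i x _; exact: mule_ge0. Qed.

Lemma emeasurable_prod d (T : measurableType d) (I : Type) (r : seq I)
    (p : pred I) (f : I -> T -> \bar R) :
  (forall i, measurable_fun setT (f i)) ->
  measurable_fun setT (fun w => \prod_(i <- r | p i) f i w).
Proof.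
move=> mf; elim: r => [|i r ih].
  by under eq_fun do rewrite big_nil; exact: measurable_cst.
under eq_fun do rewrite big_cons.
by case: (p i) => //; exact: emeasurable_funM.
Qed.

Lemma prod_indic_bigcap T (n : nat) (E : 'I_n -> set T) (w : T) :
  \prod_(i < n) (\1_(E i) w : R)%:E = (\1_(\bigcap_i E i) w)%:E.
Proof.
rewrite prode_EFin; congr EFin; rewrite indicE.
case: (boolP (w \in \bigcap_i E i)) => [|]; rewrite ?inE ?notin_setE => Ew.
  by rewrite big1// => i _; rewrite indicE mem_set//; exact: Ew.
have [i nEi] : exists i, ~ E i w.
  by apply: contrapT => /forallNP h; apply: Ew => i _; apply: contrapT; exact: h.
by rewrite (bigD1 i)//= indicE memNset// mul0r.
Qed.

(* The indicators of the definition of [same_fdd] are replaced one coordinate at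
   a time by the functions [g i], by [eq_integral_indic]. *)
Lemma fdd_integral d (T : measurableType d) (P : probability T R)
    d' (T' : measurableType d') (P' : probability T' R)
    (X : R -> T -> R) (X' : R -> T' -> R) (n : nat) (t : 'I_n -> R)
    (g : 'I_n -> R -> \bar R) :
  same_fdd P P' X X' -> (forall i, times R (t i)) ->
  (forall i, measurable_fun setT (X (t i))) ->
  (forall i, measurable_fun setT (X' (t i))) ->
  (forall i, measurable_fun setT (g i)) -> (forall i x, 0 <= g i x) ->
  \int[P]_w (\prod_(i < n) g i (X (t i) w)) =
  \int[P']_w (\prod_(i < n) g i (X' (t i) w)).
Proof.
move=> XX' t0 mX mX' mg g0.
have H (m : nat) (B : 'I_n -> set R) : (forall i, measurable (B i)) ->
    let k (i : 'I_n) x := if (i < m)%N then g i x else (\1_(B i) x)%:E in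
    \int[P]_w (\prod_(i < n) k i (X (t i) w)) =
    \int[P']_w (\prod_(i < n) k i (X' (t i) w)).
  elim: m B => [|m ih] B mB /=.
    have mS d1 (T1 : measurableType d1) (X1 : R -> T1 -> R) :
        (forall i, measurable_fun setT (X1 (t i))) ->
        measurable (\bigcap_i (X1 (t i) @^-1` B i)).
      move=> mX1; apply: fin_bigcap_measurable => // i _.
      by rewrite -[X in measurable X]setTI; exact: mX1.
    under eq_integral do rewrite (prod_indic_bigcap (fun i => X (t i) @^-1` B i)).
    under [in RHS]eq_integral do rewrite (prod_indic_bigcap (fun i => X' (t i) @^-1` B i)).
    by rewrite !integral_indic ?setIT//; [exact: XX'|exact: mS|exact: mS].
  have [mn|nm] := ltnP m n; last first.
    have kE (i : 'I_n) x : (if (i < m.+1)%N then g i x else (\1_(B i) x)%:E) =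
                  (if (i < m)%N then g i x else (\1_(B i) x)%:E).
      by rewrite !(leq_trans (ltn_ord i))// ltnW.
    under eq_integral do under eq_bigr do rewrite kE.
    by under [in RHS]eq_integral do under eq_bigr do rewrite kE; exact: ih.
  pose i0 := Ordinal mn.
  pose K (C : 'I_n -> set R) (m' : nat) (i : 'I_n) x :=
    if (i < m')%N then g i x else (\1_(C i) x)%:E.
  have K0 C m' i x : 0 <= K C m' i x by rewrite /K; case: ifP => // _; rewrite lee_fin.
  have mK C m' i : measurable (C i) -> measurable_fun setT (K C m' i).
    move=> mC; rewrite /K; case: (i < m')%N => //; apply/measurable_EFinP.
    exact: measurable_indic.
  pose H C (y : 'I_n -> R) := \prod_(i < n | i != i0) K C m.+1 i (y i).
  have HS (y : 'I_n -> R) : \prod_(i < n) K B m.+1 i (y i) = H B y * g i0 (y i0).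
    by rewrite (bigD1 i0)//= {1}/K ltnS leqnn muleC.
  under eq_integral => w _ do rewrite (HS (fun i => X (t i) w)).
  under [RHS]eq_integral => w _ do rewrite (HS (fun i => X' (t i) w)).
  apply: (@eq_integral_indic _ _ _ _ _ _ _ P P' _ _ _ _ _ (mX i0) (mX' i0)) => //.
  - apply: emeasurable_prod => i.
    by apply: measurableT_comp (mX i); apply: mK.
  - apply: emeasurable_prod => i.
    by apply: measurableT_comp (mX' i); apply: mK.
  - by move=> w; apply: prode_nonneg => i; exact: K0.
  - by move=> w; apply: prode_nonneg => i; exact: K0.
  (* The indicator of an arbitrary C at coordinate m is the preceding stage, with C in place of
     [B i0]. *)
  - move=> C mC.
    pose B' i := if i == i0 then C else B i.
    have HB' (y : 'I_n -> R) :
        H B y * (\1_C (y i0))%:E = \prod_(i < n) K B' m i (y i).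
      rewrite [RHS](bigD1 i0)//= {1}/K ltnn /B' eqxx muleC; congr (_ * _).
      apply: eq_bigr => i ii0; rewrite /K (negbTE ii0) ltnS leq_eqVlt.
      by move: ii0; rewrite -val_eqE/= => /negbTE ->.
    under eq_integral => w _ do rewrite (HB' (fun i => X (t i) w)).
    under [RHS]eq_integral => w _ do rewrite (HB' (fun i => X' (t i) w)).
    by apply: ih => i; rewrite /B'; case: ifP.
have kE (y : 'I_n -> R) : \prod_(i < n) g i (y i) =
    \prod_(i < n) (if (i < n)%N then g i (y i) else (\1_[set: R] (y i))%:E).
  by apply: eq_bigr => i _; rewrite ltn_ord.
under eq_integral => w _ do rewrite (kE (fun i => X (t i) w)).
under [RHS]eq_integral => w _ do rewrite (kE (fun i => X' (t i) w)).
exact: (H n (fun=> setT)).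
Qed.

End products.

Section independence.
Local Open Scope ereal_scope.
Context (R : realType) d (T : measurableType d) (P : probability T R).

Lemma measurable_sub (F : set (set T)) (G : T -> \bar R) :
  <<s F >> `<=` measurable ->
  measurable_fun [set: g_sigma_algebraType F] (G : g_sigma_algebraType F -> \bar R) ->
  measurable_fun setT G.
Proof. by move=> FT mG _ B mB; apply: FT; exact: mG. Qed.

Lemma measurable_id_sub (F : set (set T)) : <<s F >> `<=` measurable ->
  measurable_fun setT (id : T -> g_sigma_algebraType F).
Proof. by move=> FT _ B mB; rewrite setTI; exact: FT. Qed.

(** Indicators are replaced by the G j one factor at a time, as for finite-dimensional laws. The
    variable handed to [eq_integral_indic] is the identity of T whose target carries the
    sigma-algebra <<s F m>>, so that only sets covered by the independence are tested. *)
Lemma integral_mutually_independent (F : nat -> set (set T)) (n : nat)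
    (G : nat -> T -> \bar R) :
  (forall j, <<s F j >> `<=` measurable) ->
  mutually_independent P (fun j => <<s F j >>) ->
  (forall j, measurable_fun [set: g_sigma_algebraType (F j)]
    (G j : g_sigma_algebraType (F j) -> \bar R)) ->
  (forall j w, 0 <= G j w) ->
  \int[P]_w (\prod_(j < n) G j w) = \prod_(j < n) \int[P]_w G j w.
Proof.
move=> FT indF mG G0.
have H (m : nat) (E : nat -> set T) : (forall j, <<s F j >> (E j)) ->
    let k j w := if (j < m)%N then G j w else (\1_(E j) w : R)%:E in
    \int[P]_w (\prod_(j < n) k j w) = \prod_(j < n) \int[P]_w (k j w).
  elim: m E => [|m ih] E mE /=.
    under eq_integral do rewrite (prod_indic_bigcap R (fun i : 'I_n => E i)).
    rewrite [RHS](eq_bigr (fun i : 'I_n => P (E i))); last first.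
      by move=> i _; rewrite integral_indic ?setIT//; exact: FT.
    rewrite integral_indic ?setIT//; last first.
      by apply: fin_bigcap_measurable => // i _; exact: FT.
    have /= := indF [fset j in iota 0 n]%fset E (fun j _ => mE j).
    rewrite (perm_big (iota 0 n)); last first.
      by apply: uniq_perm; rewrite ?fset_uniq ?iota_uniq// => j; rewrite !inE.
    have -> : \prod_(i <- iota 0 n) P (E i) = \prod_(i < n) P (E i).
      by rewrite -(big_mkord xpredT (P \o E)) /index_iota subn0.
    move=> <-.
    congr (P _); apply/seteqP; split => w Ew.
      by move=> j; rewrite /= !inE mem_iota/= add0n => jn; exact: (Ew (Ordinal jn)).
    by move=> j _; apply: Ew; rewrite /= !inE mem_iota/= add0n.
  have [mn|nm] := ltnP m n; last first.
    have kE (i : 'I_n) w : (if (i < m.+1)%N then G i w else (\1_(E i) w : R)%:E) =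
                  (if (i < m)%N then G i w else (\1_(E i) w)%:E).
      by rewrite !(leq_trans (ltn_ord i))// ltnW.
    under eq_integral do under eq_bigr do rewrite kE.
    under [RHS]eq_bigr do under eq_integral do rewrite kE.
    exact: ih.
  pose i0 := Ordinal mn.
  pose K (E : nat -> set T) (m' : nat) (i : nat) w :=
    if (i < m')%N then G i w else (\1_(E i) w : R)%:E.
  have K0 C m' i x : 0 <= K C m' i x by rewrite /K; case: ifP => // _; rewrite lee_fin.
  have mK C m' i : measurable (C i) -> measurable_fun setT (K C m' i).
    move=> mC; rewrite /K; case: (i < m')%N; first exact: measurable_sub (mG i).
    exact/measurable_EFinP/measurable_indic.
  pose H w := \prod_(i < n | i != i0) K E m.+1 i w.
  have mH : measurable_fun setT H.
    by apply: emeasurable_prod => i; apply: mK; exact: FT.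
  have H0 w : 0 <= H w by exact: prode_nonneg.
  pose c := \prod_(i < n | i != i0) \int[P]_w K E m.+1 i w.
  have c0 : 0 <= c by apply: prode_nonneg => i; exact: integral_ge0.
  have HS w : \prod_(i < n) K E m.+1 i w = H w * G m w.
    by rewrite (bigD1 i0)//= {1}/K ltnS leqnn muleC.
  under eq_integral => w _ do rewrite HS.
  rewrite (bigD1 i0)//= ltnS leqnn muleC -/c -ge0_integralZl//; last first.
    exact: measurable_sub (mG m).
  apply: (@eq_integral_indic _ _ _ _ _ _ (g_sigma_algebraType (F m)) P P id id) => //.
  - exact: measurable_id_sub.
  - exact: measurable_id_sub.
  - move=> C mC.
    pose E' i := if i == m then C else E i.
    have K' i : i != m -> K E m.+1 i = K E' m i.
      by move=> im; rewrite /K /E' (negbTE im) ltnS leq_eqVlt (negbTE im).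
    have HE' w : H w * (\1_C w)%:E = \prod_(i < n) K E' m i w.
      rewrite [RHS](bigD1 i0)//= {1}/K ltnn /E' eqxx muleC; congr (_ * _).
      by apply: eq_bigr => i; rewrite -val_eqE/= => ii0; rewrite K'.
    under eq_integral => w _ do rewrite HE'.
    rewrite ih; last by move=> j; rewrite /E'; case: eqP => [->|].
    rewrite (bigD1 i0)//= ltnn /E' eqxx muleC ge0_integralZl//; last first.
      by apply/measurable_EFinP/measurable_indic; exact: (FT m C).
    congr (_ * _); apply: eq_bigr => i; rewrite -val_eqE/= => ii0.
    by rewrite K'.
have kE w : \prod_(i < n) G i w =
    \prod_(i < n) (if (i < n)%N then G i w else (\1_[set: T] w : R)%:E).
  by apply: eq_bigr => i _; rewrite ltn_ord.
under eq_integral => w _ do rewrite kE.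
rewrite (H n (fun=> setT)).
  by apply: eq_bigr => i _; rewrite ltn_ord.
by move=> j; exact: (@measurableT _ (g_sigma_algebraType (F j))).
Qed.

(** Two passes of [eq_integral_indic]: with an indicator of Y fixed, from sets of <<s F>> to G;
    then, with G as weight, from Borel sets to f. *)
Lemma integral_independent_pair (Y : T -> R) (F : set (set T))
    (f : R -> \bar R) (G : T -> \bar R) :
  measurable_fun setT Y -> <<s F >> `<=` measurable ->
  independent_pair P (sigma_rv Y) <<s F >> ->
  measurable_fun setT f -> (forall x, 0 <= f x) ->
  measurable_fun [set: g_sigma_algebraType F] (G : g_sigma_algebraType F -> \bar R) ->
  (forall w, 0 <= G w) ->
  \int[P]_w (f (Y w) * G w) = \int[P]_w f (Y w) * \int[P]_w G w.
Proof.
move=> mY FT indF mf f0 mG G0.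
have mG' : measurable_fun setT G by exact: measurable_sub mG.
have H1 B : measurable B ->
    \int[P]_w ((\1_B (Y w) : R)%:E * G w) = P (Y @^-1` B) * \int[P]_w G w.
  move=> mB; rewrite -ge0_integralZl//.
  have mYB : measurable (Y @^-1` B) by rewrite -[X in measurable X]setTI; exact: mY.
  apply: (@eq_integral_indic _ _ _ _ _ _ (g_sigma_algebraType F) P P id id) => //.
  - exact: measurable_id_sub.
  - exact: measurable_id_sub.
  - exact: measurable_indic_comp.
  - move=> E mE.
    rewrite ge0_integralZl//; last first.
      by apply/measurable_EFinP/measurable_indic; exact: (FT E).
    rewrite integral_indic ?setIT//; last exact: FT.
    rewrite -indF//; last by exists B => //; rewrite setTI.
    transitivity (\int[P]_w (\1_((Y @^-1` B) `&` E) w : R)%:E).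
      by apply: eq_integral => w _; rewrite indicI EFinM.
    by rewrite integral_indic ?setIT//; apply: measurableI => //; exact: (FT E).
rewrite [RHS]muleC -ge0_integralZl//; last 2 first.
- exact: measurableT_comp.
- exact: integral_ge0.
rewrite [LHS](eq_integral (fun w => G w * f (Y w))); last first.
  by move=> w _; rewrite [LHS]muleC.
apply: (@eq_integral_indic _ _ _ _ _ _ _ P P Y Y G (fun=> \int[P]_w G w) f mY mY) => //.
- by move=> w; exact: integral_ge0.
- move=> B mB.
  under eq_integral do rewrite muleC.
  rewrite H1//.
  rewrite ge0_integralZl//; try exact: integral_ge0; try exact: measurable_indic_comp.
  rewrite muleC; congr (_ * _).
  rewrite (eq_integral (fun w => (\1_(Y @^-1` B) w : R)%:E))// integral_indic ?setIT//.
  by rewrite -[X in measurable X]setTI; exact: mY.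
Qed.

End independence.

(** * Versions of stochastic integrals measurable for the driving process *)

Section limit_version.
Context (R : realType) d (T : measurableType d) (P : probability T R).

(* P need not be complete: a limit in probability of F-measurable variables is
   only almost surely equal to an F-measurable one. *)
Lemma ae_limit_version (F : set (set T)) (V : nat -> T -> R) (I : T -> R) :
  <<s F >> `<=` measurable ->
  (forall n, measurable_fun [set: g_sigma_algebraType F]
     (V n : g_sigma_algebraType F -> R)) ->
  measurable_fun setT I ->
  (forall n, P [set w | (2^-1 ^+ n < `|V n w - I w|)%R] <= (2^-1 ^+ n)%:E)%E ->
  exists2 J : T -> R,
    measurable_fun [set: g_sigma_algebraType F] (J : g_sigma_algebraType F -> R) &
    {ae P, forall w, I w = J w}.
Proof.
move=> FT mV mI VI.
have mV' n : measurable_fun setT (V n).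
  by move=> _ B mB; apply: FT; exact: mV.
pose E n := [set w | 2^-1 ^+ n < `|V n w - I w|].
have mE n : measurable (E n).
  rewrite -[E n]setTI; apply: measurable_fun_ltr => //.
  by apply: measurableT_comp => //; exact: measurable_funB.
(* Borel-Cantelli: the probabilities 2^-n are summable. *)
have PE0 : P (lim_sup_set E) = 0%E.
  apply: lim_sup_set_cvg0 => //.
  apply: (@le_lt_trans _ _ (\sum_(n <oo) (2^-1 ^+ n : R)%:E)%E).
    by apply: lee_nneseries => // n _; exact: VI.
  have := @cvg_geometric_eseries_half R 2 0.
  rewrite (_ : (fun k => _) = (fun k => (2^-1 ^+ k : R)%:E)); last first.
    by apply/funext => k; rewrite addn1 natrX exprS invfM mulrA divff// mul1r exprVn.
  by move=> /cvg_lim ->//; rewrite ltry.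
(* An upper limit is F-measurable everywhere, with no null set to remove, and outside
   [lim_sup_set E] it equals I. *)
exists (fun w => fine (limn_esup (fun n => (V n w)%:E))).
  apply: measurableT_comp => //.
  apply: measurable_fun_limn_esup => n.
  by apply/measurable_EFinP; exact: mV.
exists (lim_sup_set E); split => //.
  by apply: bigcap_measurable => // k _; exact: bigcup_measurable.
move=> w /= wE n _; apply: contrapT => nEw; apply: wE.
have cV : (fun n => (V n w)%:E) @ \oo --> (I w)%:E.
  apply/fine_cvgP; split; first by near=> m.
  apply/cvgrPdist_le => e e0; near=> m.
  rewrite /= distrC.
  have nEm : ~ E m w.
    move=> Em; apply: nEw; exists m => //=; near: m; exact: nbhs_infty_ge.
  move: nEm; rewrite /E /= => /negP; rewrite -leNgt => /le_trans; apply.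
  near: m.
  have h : `|2^-1 : R| < 1 by rewrite ger0_norm// invf_lt1// ltr1n.
  have /cvgrPdist_le/(_ e e0) := cvg_expr h.
  by apply: filterS => k; rewrite sub0r normrN ger0_norm// exprn_ge0.
by rewrite is_cvg_limn_esupE ?(cvg_lim _ cV)//; apply/cvg_ex; exists (I w)%:E.
Unshelve. all: by end_near. Qed.

Lemma measurable_sigma_process (Z : R -> {RV P >-> R}) (t : R) : 0 <= t ->
  measurable_fun [set: g_sigma_algebraType (\bigcup_(t in times R) sigma_rv (Z t))]
    (Z t : g_sigma_algebraType _ -> R).
Proof.
move=> t0 _ B mB; apply: sub_sigma_algebra; exists t => /=.
  by rewrite /times/= in_itv/= andbT.
by exists B.
Qed.

Lemma sigma_process_sub (Z : R -> {RV P >-> R}) :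
  sigma_process Z `<=` measurable.
Proof.
apply: (smallest_sub (@sigma_algebra_measurable _ T)).
move=> _ [t _] [B mB <-]; by apply: (measurable_funPT (Z t)).
Qed.

Definition uniform_partition (t : R) (m : nat) : seq R :=
  mkseq (fun k => t * k.+1%:R / m%:R) m.

Lemma nth_uniform_partition t m k : (k <= m)%N ->
  nth 0 (0 :: uniform_partition t m) k = t * k%:R / m%:R.
Proof.
by case: k => [|k km] /=; [rewrite mulr0 mul0r|rewrite nth_mkseq].
Qed.

Lemma uniform_partitionP t m : 0 < t -> (0 < m)%N ->
  itv_partition 0 t (uniform_partition t m).
Proof.
move=> t0 m0; split.
  apply/(pathP 0) => k; rewrite size_mkseq => km.
  rewrite nth_uniform_partition 1?ltnW// nth_mkseq//.
  by rewrite ltr_pM2r ?invr_gt0 ?ltr0n// ltr_pM2l// ltr_nat.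
rewrite (last_nth 0) size_mkseq nth_uniform_partition//.
by rewrite mulfK// pnatr_eq0 -lt0n.
Qed.

(** With eps = eta = 2^-n the definition yields partitions whose Stieltjes sums fit
    [ae_limit_version]; each sum involves finitely many values of Z at nonnegative times. *)
Lemma stochastic_integral_version (Z : R -> {RV P >-> R}) (lambda : R)
    (f : R -> R) (t : R) (I : {RV P >-> R}) :
  0 <= lambda -> 0 <= t ->
  stochastic_integral P f (fun s => Z (lambda * s)) 0 t I ->
  exists2 J : T -> R,
    measurable_fun [set: g_sigma_algebraType (\bigcup_(t in times R) sigma_rv (Z t))]
      (J : g_sigma_algebraType _ -> R) &
    {ae P, forall w, I w = J w}.
Proof.
move=> l0 t0 hI.
have hs n : exists s : seq R, itv_partition 0 t s /\
    (P [set w | (2^-1 ^+ n < `|stieltjes_sum f (fun s => Z (lambda * s)) 0 s w - I w|)%R]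
       <= (2^-1 ^+ n)%:E)%E.
  have e0 : (0 : R) < 2^-1 ^+ n by rewrite exprn_gt0.
  have [dl dl0 hdl] := hI _ _ e0 e0.
  move: t0; rewrite le_eqVlt => /predU1P[t0|t0].
    exists [::]; split; first by split => //=; rewrite -t0.
    by apply: hdl => //; split => //=; rewrite -t0.
  pose m := (Num.truncn (t / dl)).+1.
  have mt : t / m%:R < dl.
    by rewrite ltr_pdivrMr ?ltr0n// mulrC -ltr_pdivrMr// truncnS_gt.
  exists (uniform_partition t m); split; first exact: uniform_partitionP.
  apply: hdl; first exact: uniform_partitionP.
  move=> k; rewrite size_mkseq => km.
  rewrite nth_uniform_partition 1?ltnW// nth_mkseq//.
  by rewrite -mulrBl -mulrBr -natr1 [k%:R + 1]addrC addrK mulr1.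
have {hs}[s hs] := choice hs.
apply: (ae_limit_version (V := fun n => stieltjes_sum f (fun s => Z (lambda * s)) 0 (s n))).
- exact: sigma_process_sub.
- move=> n; have [sP _] := hs n.
  rewrite /stieltjes_sum.
  apply: measurable_sum => k; apply: measurable_funM => //.
  apply: measurable_funB; apply: measurable_sigma_process; rewrite mulr_ge0//.
  + rewrite (set_nth_default t)//.
    have kS : (k.+1 < (size (s n)).+1)%N by rewrite ltnS.
    exact: (itv_partition_nth_ge kS sP).
  + rewrite (set_nth_default t) ?ltnS 1?ltnW//=.
    have kS : (k < (size (s n)).+1)%N by rewrite ltnS ltnW.
    exact: (itv_partition_nth_ge kS sP).
- exact: measurable_funPT.
- by move=> n; have [] := hs n.
Qed.
End limit_version.

(** * Exponential moments of the OU process *)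

Section ou_chain.
Context (R : realType) d (T : measurableType d) (P : probability T R).
Variables (lambda c p : R) (psi : R -> R) (X : R -> {RV P >-> R}).
Hypotheses (lambda_gt0 : 0 < lambda) (hX : stationary_OU lambda X).
Hypothesis hpsi : forall z, - p <= z <= p ->
  (\int[P]_w (expR (z * (X 0 w - c)))%:E = (expR (psi z))%:E)%E.

(* [F] generates the sigma-algebra of the driving process. Its independence of
   [X 0], combined with the stationarity of [X], determines all the
   finite-dimensional exponential moments. *)
Lemma stationary_OU_decomposition : exists (F : set (set T)) (J : R -> T -> R),
  [/\ <<s F >> `<=` measurable, independent_pair P (sigma_rv (X 0)) <<s F >> &
    forall t, 0 <= t ->
      measurable_fun [set: g_sigma_algebraType F]
        (J t : g_sigma_algebraType F -> R) /\
      {ae P, forall w,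
        X t w - c = expR (- lambda * t) * (X 0 w - c) + J t w}].
Proof.
have [_ [Z [_ indZ hI]]] := hX.
pose F := \bigcup_(t in times R) sigma_rv (Z t).
have /choice[J hJ] : forall t, exists J : T -> R, 0 <= t ->
    measurable_fun [set: g_sigma_algebraType F]
      (J : g_sigma_algebraType F -> R) /\
    {ae P, forall w, X t w - c = expR (- lambda * t) * (X 0 w - c) + J w}.
  move=> t; have [t0|] := leP 0 t; last by exists (fun=> 0).
  have [I [hsI aeI]] := hI _ t0.
  have [J mJ aeJ] := stochastic_integral_version (ltW lambda_gt0) t0 hsI.
  (* Centring by c leaves the deterministic term (e^(- lambda t) - 1) c, which is counted as
     noise. *)
  exists (fun w => J w + (expR (- lambda * t) - 1) * c) => _; split.
    by apply: measurable_funD => //; exact: measurable_cst.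
  apply: filterS2 aeI aeJ => w -> ->.
  by rewrite mulrBr mulrBl mul1r; ring.
exists F, J; split => //; exact: sigma_process_sub.
Qed.

(* A list [l] of pairs (t_i, c_i) with nondecreasing t_i stands for the linear
   combination \sum_i c_i (X (t_i) - c), whose log-moment is [chain_exponent l].
   Since X (t_i) - c = e^(- lambda (t_i - t)) (X t - c) + (independent noise),
   the coefficient of X t - c in it is [discounted t l]; splitting off the first
   time gives the recursion, the factor E exp of the noise being the quotient of
   the moments of the remaining combination and of its projection on X t. *)
Definition discounted (t : R) (l : seq (R * R)) : R :=
  \sum_(x <- l) x.2 * expR (- lambda * (x.1 - t)).

Fixpoint chain_exponent (l : seq (R * R)) : R :=
  if l is x :: l' then
    psi (x.2 + discounted x.1 l') - psi (discounted x.1 l') + chain_exponent l'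
  else 0.

(** The two bounds keep both arguments of [psi] in [chain_exponent] inside [-p, p], where [hpsi]
    gives the moment. *)
Fixpoint chain_ok (l : seq (R * R)) : Prop :=
  if l is x :: l' then
    [/\ 0 <= x.1, all (fun y => x.1 <= y.1) l', - p <= discounted x.1 l' <= p,
        - p <= x.2 + discounted x.1 l' <= p & chain_ok l']
  else True.

(** Serves to move the first time of a combination to 0, where the splitting into X 0 and
    independent noise is available. *)
Lemma stationary_expR (h : R) (l : seq (R * R)) : 0 <= h ->
  (forall x, x \in l -> 0 <= x.1) ->
  (\int[P]_w (expR (\sum_(x <- l) x.2 * (X (x.1 + h) w - c)))%:E =
   \int[P]_w (expR (\sum_(x <- l) x.2 * (X x.1 w - c)))%:E)%E.
Proof.
move=> h0 l0; have [st _] := hX.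
pose t (i : 'I_(size l)) := (tnth (in_tuple l) i).1.
pose g (i : 'I_(size l)) (y : R) := (expR ((tnth (in_tuple l) i).2 * (y - c)))%:E.
have E (Y : R -> T -> R) w : (expR (\sum_(x <- l) x.2 * (Y x.1 w - c)))%:E =
    (\prod_(i < size l) g i (Y (t i) w))%E.
  by rewrite expR_sum big_tnth prode_EFin.
rewrite (eq_integral _ _ (fun w _ => E (fun t => X (t + h)) w)).
rewrite [RHS](eq_integral _ _ (fun w _ => E X w)).
apply/esym; apply: (fdd_integral (st h h0)) => //.
- by move=> i; rewrite /times/= in_itv/= andbT; apply: l0; exact: mem_tnth.
- move=> i; apply/measurable_EFinP; apply: measurableT_comp => //.
  by apply: measurable_funM => //; exact: measurable_funB.
- by move=> i x; rewrite lee_fin expR_ge0.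
Qed.

Lemma measurable_sum_in d1 (U : measurableType d1) (I : eqType) (l : seq I)
    (f : I -> U -> R) :
  (forall x, x \in l -> measurable_fun setT (f x)) ->
  measurable_fun setT (fun w => \sum_(x <- l) f x w).
Proof.
elim: l => [|x l ih] h.
  by under eq_fun do rewrite big_nil; exact: measurable_cst.
under eq_fun do rewrite big_cons.
apply: measurable_funD; first by apply: h; exact: mem_head.
by apply: ih => y yl; apply: h; rewrite inE yl orbT.
Qed.

Lemma integral_expR_chain (l : seq (R * R)) : chain_ok l ->
  (\int[P]_w (expR (\sum_(x <- l) x.2 * (X x.1 w - c)))%:E =
   (expR (chain_exponent l))%:E)%E.
Proof.
have [F [J [FT indF hJ]]] := stationary_OU_decomposition.
elim: l => [|[t a] l ih] /=.
  move=> _; under eq_integral do rewrite big_nil.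
  by rewrite expR0 integral_cst//= probability_setT mule1.
move=> [t0 tl hd had okl].
pose a0 := discounted t l.
pose SJ w := \sum_(x <- l) x.2 * J (x.1 - t) w.
have l0 x : x \in l -> 0 <= x.1 - t by move/(allP tl); rewrite subr_ge0.
have mSJ : measurable_fun [set: g_sigma_algebraType F] (SJ : g_sigma_algebraType F -> R).
  apply: measurable_sum_in => x /l0 x0; apply: measurable_funM => //.
  by have [] := hJ _ x0.
have mSJe : measurable_fun [set: g_sigma_algebraType F]
    ((fun w => (expR (SJ w))%:E) : g_sigma_algebraType F -> \bar R).
  by apply/measurable_EFinP; apply: measurableT_comp mSJ.
have aeS : {ae P, forall w, \sum_(x <- l) x.2 * (X (x.1 - t) w - c) =
                            a0 * (X 0 w - c) + SJ w}.
  rewrite /a0 /SJ; elim: l l0 {ih tl hd had okl a0 SJ mSJ mSJe} => [|x l ihl] l0.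
    by apply: nearW => w; rewrite /discounted !big_nil mul0r addr0.
  have [_ aeJ] := hJ _ (l0 x (mem_head _ _)).
  have l0' y : y \in l -> 0 <= y.1 - t by move=> yl; apply: l0; rewrite inE yl orbT.
  apply: filterS2 aeJ (ihl l0') => w e1 e2.
  by rewrite /discounted !big_cons -/(discounted t l) e1 e2; ring.
(* For b = a this is the moment wanted; for b = 0 it is the moment of the tail l, known by
   induction, from which the noise factor is read off. *)
have key b : - p <= b + a0 <= p ->
    (\int[P]_w (expR (b * (X t w - c) + \sum_(x <- l) x.2 * (X x.1 w - c)))%:E =
     (expR (psi (b + a0)))%:E * \int[P]_w (expR (SJ w))%:E)%E.
  move=> hb.
  pose l1 := (0, b) :: [seq (x.1 - t, x.2) | x <- l].
  have l10 x : x \in l1 -> 0 <= x.1.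
    by rewrite inE => /predU1P[->//|/mapP[y /l0 y0 ->]].
  have := stationary_expR t0 l10.
  under eq_integral do rewrite big_cons big_map/= add0r.
  under eq_integral do under eq_bigr do rewrite subrK.
  move=> ->.
  under eq_integral do rewrite big_cons big_map/=.
  rewrite -hpsi// -(integral_independent_pair _ FT indF
    (f := fun x => (expR ((b + a0) * (x - c)))%:E)
    (G := fun w => (expR (SJ w))%:E)).
  - apply: ae_eq_integral => //.
    + apply/measurable_EFinP; apply: measurableT_comp => //.
      apply: measurable_funD; last apply: measurable_sum => x.
        by apply: measurable_funM => //; exact: measurable_funB.
      by apply: measurable_funM => //; exact: measurable_funB.
    + apply: emeasurable_funM; last exact: measurable_sub mSJe.
      apply/measurable_EFinP; apply: measurableT_comp => //.
      by apply: measurable_funM => //; exact: measurable_funB.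
    + apply: filterS aeS => w e _; rewrite e -EFinM -expRD; congr (expR _)%:E; ring.
  - by [].
  - apply/measurable_EFinP; apply: measurableT_comp => //.
    by apply: measurable_funM => //; exact: measurable_funB.
  - by move=> x; rewrite lee_fin expR_ge0.
  - exact: mSJe.
  - by move=> w; rewrite lee_fin expR_ge0.
under eq_integral do rewrite big_cons.
rewrite key// -/a0.
have := key 0 _; rewrite add0r => /(_ hd).
under eq_integral do rewrite mul0r add0r.
rewrite ih// => e0.
have -> : (\int[P]_w (expR (SJ w))%:E = (expR (chain_exponent l - psi a0))%:E)%E.
  rewrite expRD EFinM e0 muleAC -EFinM -expRD subrr expR0 mul1e//.
by rewrite -EFinM -expRD; congr (expR _)%:E; ring.
Qed.

End ou_chain.

(** * Bounds on the exponents *)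

Ltac lra2 := by apply/andP; split; lra.

Section chain_bounds.
Context (R : realType).
Variables (lambda p C : R) (psi : R -> R).
Hypotheses (lambda_gt0 : 0 < lambda) (p1 : 1 < p) (C0 : 0 <= C).
Hypotheses (psi0 : psi 0 = 0) (psi1 : psi 1 = 0).
Hypothesis psi_convex : forall x y t, - p <= x <= p -> - p <= y <= p ->
  0 <= t <= 1 -> psi (t * x + (1 - t) * y) <= t * psi x + (1 - t) * psi y.
Hypothesis psi_lip : forall x y, - p <= x <= p -> - p <= y <= p ->
  `|psi x - psi y| <= C * `|x - y|.

(** The slope of the chord of [psi] from 1 to p, as psi 1 = 0; the theta of the overview. *)
Definition slope := psi p / (p - 1).

Lemma psi_le_slope y : 1 <= y <= p -> psi y <= slope * (y - 1).
Proof.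
have [p1' C0' lam0'] : [/\ 1 < p, 0 <= C & 0 < lambda] by [].
move=> /andP[y1 yp]; have p10 : 0 < p - 1 by rewrite subr_gt0.
pose t := (p - y) / (p - 1).
have t01 : 0 <= t <= 1.
  rewrite /t; apply/andP; split; first by apply: divr_ge0; [rewrite subr_ge0|exact: ltW].
  by rewrite ler_pdivrMr// mul1r lerD2l lerN2.
have -> : y = t * 1 + (1 - t) * p by rewrite /t; field; rewrite gt_eqF.
apply: (le_trans (psi_convex _ _ t01)); [lra2|lra2|].
rewrite psi1 mulr0 add0r /slope /t le_eqVlt; apply/orP; left; apply/eqP.
by field; rewrite gt_eqF.
Qed.

Lemma psi_le0 r : 0 <= r <= 1 -> psi r <= 0.
Proof.
have [p1' C0' lam0'] : [/\ 1 < p, 0 <= C & 0 < lambda] by [].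
move=> r01; rewrite [r in psi r](_ : _ = r * 1 + (1 - r) * 0); last by ring.
apply: (le_trans (psi_convex _ _ r01)); [lra2|lra2|].
by rewrite psi1 psi0 !mulr0 addr0.
Qed.

(** The point 1 is the convex combination of y and 0 with weight 1 / y on y, and psi vanishes at 0
    and 1. *)
Lemma psi_ge0 y : 1 <= y <= p -> 0 <= psi y.
Proof.
have [p1' C0' lam0'] : [/\ 1 < p, 0 <= C & 0 < lambda] by [].
move=> /andP[y1 yp]; have y0 : 0 < y by lra.
have t01 : 0 <= y^-1 <= 1 by rewrite invr_ge0 ltW//= invf_le1.
have := fun h1 h2 => psi_convex (x := y) (y := 0) h1 h2 t01.
rewrite mulVf ?gt_eqF// mulr0 addr0 psi1 psi0 mulr0 addr0 => h.
have : 0 <= y^-1 * psi y by apply: h; lra2.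
by rewrite pmulr_rge0// invr_gt0.
Qed.

Lemma slope_ge0 : 0 <= slope.
Proof.
have p1' := p1; have h : 0 <= psi p by apply: psi_ge0; lra2.
by rewrite divr_ge0// subr_ge0 ltW.
Qed.

Definition gaps (s : seq R) : seq R :=
  if s is x :: s' then pairmap (fun a b => b - a) x s' else [::].

Definition unit_masses (s : seq R) : seq (R * R) := [seq (x, 1) | x <- s].

(* With r = e^(- lambda g), a bound on the contribution to [chain_exponent] of
   a gap g between two consecutive unit masses: close to [slope] for small gaps and
   to 0 for large ones. *)
Definition hbound (r : R) : R :=
  Num.min (slope + (C + slope) * p * (1 - r)) ((C + slope) * p * r).

Lemma discounted_unit t s :
  discounted lambda t (unit_masses s) = \sum_(x <- s) expR (- lambda * (x - t)).
Proof. by rewrite /discounted big_map; apply: eq_bigr => x _; rewrite mul1r. Qed.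

Lemma discounted_unit_bounds t s : all (fun x => t <= x) s ->
  0 <= discounted lambda t (unit_masses s) <= (size s)%:R.
Proof.
have [p1' C0' lam0'] : [/\ 1 < p, 0 <= C & 0 < lambda] by [].
rewrite discounted_unit; elim: s => [|x s ih] /=; first by rewrite big_nil lexx.
move=> /andP[tx /ih /andP[i1 i2]]; rewrite big_cons.
have e0 := expR_ge0 (- lambda * (x - t)).
have e1 : expR (- lambda * (x - t)) <= 1.
  by rewrite -expR0 ler_expR mulNr oppr_le0 mulr_ge0 ?subr_ge0// ltW.
by rewrite -natr1; lra.
Qed.

Lemma discounted_shift t u l :
  discounted lambda t l = expR (- lambda * (u - t)) * discounted lambda u l.
Proof.
have [p1' C0' lam0'] : [/\ 1 < p, 0 <= C & 0 < lambda] by [].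
rewrite /discounted mulr_sumr; apply: eq_bigr => x _.
rewrite mulrCA -expRD; congr (_ * expR _); ring.
Qed.

Lemma chain_ok_unit s : sorted <=%R s -> all (fun x => 0 <= x) s ->
  (size s)%:R <= p -> chain_ok lambda p (unit_masses s).
Proof.
have [p1' C0' lam0'] : [/\ 1 < p, 0 <= C & 0 < lambda] by [].
elim: s => [//|x s ih] ss /= /andP[x0 s0] sp.
have xs : all (fun y => x <= y) s by apply: order_path_min ss => ? ? ?; exact: le_trans.
have := discounted_unit_bounds xs.
move: sp; rewrite -natr1 => sp /andP[h1 h2]; split => //.
- by rewrite all_map.
- lra2.
- lra2.
- by apply: ih => //; [exact: path_sorted ss|lra].
Qed.

(* The telescoping potential is chi y = psi y - slope (y - 1), which is
   nonpositive on [1, p] and vanishes at 1. *)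
Lemma chain_exponent_unit_le s : sorted <=%R s -> (size s)%:R <= p ->
  chain_exponent lambda psi (unit_masses s) <=
  \sum_(g <- gaps s) hbound (expR (- lambda * g)).
Proof.
have [p1' C0' lam0'] : [/\ 1 < p, 0 <= C & 0 < lambda] by [].
pose chi y := psi y - slope * (y - 1).
have chi_le0 y : 1 <= y <= p -> chi y <= 0.
  by move=> /psi_le_slope; rewrite /chi; lra.
have sl0 := slope_ge0.
have chi_lip x y : 0 <= x -> x <= y -> y <= p ->
    `|chi y - chi x| <= (C + slope) * (y - x).
  move=> x0 xy yp; have := psi_lip (x := y) (y := x).
  have -> : chi y - chi x = (psi y - psi x) - slope * (y - x) by rewrite /chi; ring.
  move=> h; rewrite mulrDl; apply: (le_trans (ler_normB _ _)); apply: lerD.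
    by rewrite -[X in _ <= C * X]ger0_norm ?subr_ge0//; apply: h; lra2.
  by rewrite ger0_norm// mulr_ge0// subr_ge0.
(* The total mass seen from the first point; for the empty list 1 is the value at which chi
   vanishes. *)
pose a1 (s : seq R) := if s is x :: s' then 1 + discounted lambda x (unit_masses s') else 1.
have a1P s' : sorted <=%R s' -> (size s')%:R <= p -> 1 <= a1 s' <= p.
  case: s' => [_ _|x s' ss' sp] /=; first lra2.
  have xs : all (fun y => x <= y) s' by apply: order_path_min ss' => ? ? ?; exact: le_trans.
  have /andP[] := discounted_unit_bounds xs.
  by move: sp; rewrite /= -natr1 => *; lra2.
suff H : sorted <=%R s -> (size s)%:R <= p ->
    chain_exponent lambda psi (unit_masses s) <=
    chi (a1 s) + \sum_(g <- gaps s) hbound (expR (- lambda * g)).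
  move=> ss sp; apply: (le_trans (H ss sp)); rewrite gerDr.
  by apply: chi_le0; exact: a1P.
elim: s => [_ _|x [|y s] ih] /=.
- by rewrite /chi big_nil psi1 subrr mulr0 subrr addr0.
- by rewrite /chi /discounted !big_nil !addr0 psi1 psi0; lra.
move=> /andP[xy ss] sp.
have /ih : (size (y :: s))%:R <= p by move: sp => /=; rewrite -natr1; lra.
move=> /(_ ss) /= ih'.
rewrite big_cons.
set r := expR (- lambda * (y - x)).
set a := 1 + discounted lambda y (unit_masses s) in ih' *.
have -> : discounted lambda x ((y, 1) :: unit_masses s) = r * a.
  rewrite (discounted_shift x y) /discounted big_cons subrr mulr0 expR0 mulr1.
  by rewrite -/(discounted lambda y (unit_masses s)).
set K := (_ + chain_exponent _ _ (unit_masses s)) in ih' *.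
(* Since psi (1 + r a) - psi (r a) = slope + chi (1 + r a) - chi (r a), the left side is what the
   new gap costs. For r near 1, chi a and chi (r a) nearly cancel; for r near 0, chi a <= 0 while
   chi (r a) is close to chi 0 = slope. *)
have hr : slope + chi a - chi (r * a) <= hbound r.
  have /(a1P (y :: s))/(_ _)/andP[|a1' ap] := ss.
    by move: sp; rewrite /= -!natr1; lra.
  have {}a1' : 1 <= a := a1'; have {}ap : a <= p := ap.
  have r0 : 0 <= r := expR_ge0 _.
  have r1 : r <= 1.
    by rewrite -expR0 ler_expR mulNr oppr_le0 mulr_ge0 ?subr_ge0// ltW.
  have ca : chi a <= 0 by apply: chi_le0; rewrite a1'.
  have ra0 : 0 <= r * a by rewrite mulr_ge0//; lra.
  have raa : r * a <= a by rewrite ler_piMl//; lra.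
  have rap : r * a <= p by exact: le_trans ap.
  have := chi_lip _ _ ra0 raa ap; have := chi_lip _ _ (lexx 0) ra0 rap.
  have chi0 : chi 0 = slope by rewrite /chi psi0; ring.
  rewrite chi0 !ler_norml => /andP[h1 _] /andP[_ h2].
  have B0 : 0 <= C + slope by lra.
  have h3 : (C + slope) * (a - r * a) <= (C + slope) * p * (1 - r).
    rewrite -mulrA ler_wpM2l// (_ : a - r * a = a * (1 - r)); last by ring.
    by rewrite ler_wpM2r//; lra.
  have h4 : (C + slope) * (r * a - 0) <= (C + slope) * p * r.
    by rewrite -mulrA ler_wpM2l// subr0 mulrC ler_wpM2r.
  by rewrite /hbound le_min; lra2.
rewrite /chi in ih' hr *; lra.
Qed.

Lemma decay_bounds x : 0 <= x ->
  [/\ 0 < expR (- lambda * x), expR (- lambda * x) <= 1 &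
      1 - expR (- lambda * x) <= lambda * x].
Proof.
move=> x0; split; first exact: expR_gt0.
  by rewrite -expR0 ler_expR mulNr oppr_le0 mulr_ge0// ltW.
by have := expR_ge1Dx (- lambda * x); rewrite mulNr; lra.
Qed.

(** If all points coincided, the terms would telescope to the leading psi. A gap y - x replaces psi
    a by psi (r a), an error of at most C p lambda (y - x), and the gaps add up to at most S - x. *)
Lemma chain_exponent_unit_near x s S : sorted <=%R (x :: s) ->
  all (fun y => y <= S) (x :: s) -> (size (x :: s))%:R <= p ->
  `|chain_exponent lambda psi (unit_masses (x :: s)) -
    psi (1 + discounted lambda x (unit_masses s))| <= C * p * lambda * (S - x).
Proof.
have [p1' C0' lam0'] : [/\ 1 < p, 0 <= C & 0 < lambda] by [].
elim: s x => [|y s ih] x.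
  move=> _ /=; rewrite andbT => xS _.
  rewrite /discounted big_nil !addr0 psi1 psi0 subrr subr0 normr0.
  by rewrite !mulr_ge0// ?subr_ge0//; lra.
move=> /= /andP[xy ss] /andP[xS /andP[yS sS]]; rewrite -!natr1 => sp.
have := ih y ss; rewrite /= yS sS -natr1 => /(_ isT) ih'.
have {ih'} : `|psi (1 + discounted lambda y (unit_masses s)) -
    psi (discounted lambda y (unit_masses s)) +
    chain_exponent lambda psi (unit_masses s) -
    psi (1 + discounted lambda y (unit_masses s))| <= C * p * lambda * (S - y).
  by apply: ih'; lra.
have ys : all (fun z => y <= z) s by apply: order_path_min ss => ? ? ?; exact: le_trans.
have /andP[d0 d1] := discounted_unit_bounds ys.
have := discounted_shift x y ((y, 1) :: unit_masses s).
rewrite {2}/discounted big_cons subrr mulr0 expR0 mulr1.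
rewrite -/(discounted lambda y (unit_masses s)).
set r := expR (- lambda * (y - x)); set a := 1 + discounted lambda y (unit_masses s).
move=> ->.
set K := (_ + chain_exponent _ _ (unit_masses s)) => ih'.
have xy0 : 0 <= y - x by rewrite subr_ge0.
have [r0 r1 r2] := decay_bounds xy0; rewrite -/r in r0 r1 r2.
have a0 : 0 <= a by rewrite /a; lra.
have ap : a <= p by rewrite /a; lra.
have ra0 : 0 <= r * a by rewrite mulr_ge0// ltW.
have raa : r * a <= a by rewrite ler_piMl.
have : `|psi a - psi (r * a)| <= C * `|a - r * a| by apply: psi_lip; lra2.
have -> : `|a - r * a| = a - r * a by apply: ger0_norm; rewrite subr_ge0.
move=> h.
have h2 : C * (a - r * a) <= C * p * (lambda * (y - x)).
  rewrite -mulrA ler_wpM2l// (_ : a - r * a = a * (1 - r)); last by ring.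
  by apply: ler_pM => //; rewrite subr_ge0.
have -> : psi (1 + r * a) - psi (r * a) + K - psi (1 + r * a) =
  (K - psi a) + (psi a - psi (r * a)) by ring.
apply: (le_trans (ler_normD _ _)).
have -> : C * p * lambda * (S - x) =
  C * p * lambda * (S - y) + C * p * (lambda * (y - x)) by ring.
by apply: lerD => //; exact: le_trans h2.
Qed.

(** Three errors of the same size, hence the factor 3: collapsing the chain s to its first point,
    moving its mass from there to time 0, and replacing the discounted mass at 0 by the number of
    points in the term that contains c0. *)
Lemma chain_exponent_near c0 s S : sorted <=%R s ->
  all (fun y => 0 <= y <= S) s -> (size s)%:R <= p ->
  - p <= c0 -> c0 + (size s)%:R <= p ->  0 <= S ->
  `|chain_exponent lambda psi ((0, c0) :: unit_masses s) - psi (c0 + (size s)%:R)|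
    <= 3 * (C * p * lambda * S).
Proof.
have [p1' C0' lam0'] : [/\ 1 < p, 0 <= C & 0 < lambda] by [].
move=> ss s0S sp c0p c0sp S0.
have D0 : 0 <= C * p * lambda * S by rewrite !mulr_ge0//; lra.
case: s => [|x s] in ss s0S sp c0sp *.
  rewrite /= /discounted big_nil addr0 psi0 subr0 addr0 subrr normr0.
  by rewrite mulr_ge0.
have s0 : all (fun y => 0 <= y) (x :: s) by apply: sub_all s0S => y /andP[].
have sS : all (fun y => y <= S) (x :: s) by apply: sub_all s0S => y /andP[].
have h1 := chain_exponent_unit_near ss sS sp.
have [x0 xS] : 0 <= x /\ x <= S by move: s0S => /= /andP[/andP[]].
have [r0 r1 r2] := decay_bounds x0.
have xs : all (fun y => x <= y) s by apply: order_path_min ss => ? ? ?; exact: le_trans.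
have /andP[dx0 dx1] := discounted_unit_bounds xs.
have /andP[d0 d1] := discounted_unit_bounds s0.
have dm : (size (x :: s))%:R - discounted lambda 0 (unit_masses (x :: s)) <= p * (lambda * S).
  rewrite discounted_unit -sum1_size natr_sum -sumrB.
  apply: (@le_trans _ _ (\sum_(y <- x :: s) lambda * S)).
    rewrite big_seq [leRHS]big_seq; apply: ler_sum => y ys.
    have /andP[y0 yS] := allP s0S y ys.
    have [_ _ ] := decay_bounds y0; rewrite subr0 => /le_trans; apply.
    by rewrite ler_wpM2l// ltW.
  rewrite big_const_seq count_predT iter_addr_0 -mulr_natl ler_wpM2r//.
  by rewrite mulr_ge0// ltW.
have E : discounted lambda 0 (unit_masses (x :: s)) =
    expR (- lambda * x) * (1 + discounted lambda x (unit_masses s)).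
  rewrite (discounted_shift 0 x) {1}/discounted big_cons subrr mulr0 expR0 mulr1 subr0.
  by rewrite -/(discounted lambda x (unit_masses s)).
set K := chain_exponent _ _ (unit_masses (x :: s)) in h1.
set a := 1 + discounted lambda x (unit_masses s) in h1 E.
rewrite [chain_exponent _ _ _]/= -/(unit_masses (x :: s)) -/K.
set e := discounted lambda 0 _ in E d0 d1 dm *.
set m := (size (x :: s))%:R in sp c0sp d1 dm *.
have ap : a <= p by move: sp; rewrite /a /m /= -natr1; lra.
have a1 : 1 <= a by rewrite /a; lra.
have ea : e <= a by rewrite E ler_piMl//; lra.
have pS : 0 <= p * (lambda * S) by rewrite !mulr_ge0//; lra.
have aep : a - e <= p * (lambda * S).
  rewrite E (_ : a - _ = a * (1 - expR (- lambda * x))); last by ring.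
  apply: ler_pM => //; [lra|by rewrite subr_ge0|].
  by apply: (le_trans r2); rewrite ler_wpM2l// ltW.
have h2 : `|psi a - psi e| <= C * p * lambda * S.
  apply: (@le_trans _ _ (C * `|a - e|)); first by apply: psi_lip; lra2.
  by rewrite ger0_norm ?subr_ge0// -!mulrA ler_wpM2l.
have h3 : `|psi (c0 + e) - psi (c0 + m)| <= C * p * lambda * S.
  apply: (@le_trans _ _ (C * `|(c0 + e) - (c0 + m)|)); first by apply: psi_lip; lra2.
  rewrite (_ : (c0 + e) - (c0 + m) = - (m - e)); last by ring.
  by rewrite normrN ger0_norm ?subr_ge0// -!mulrA ler_wpM2l.
have h4 : C * p * lambda * (S - x) <= C * p * lambda * S.
  by rewrite ler_wpM2l ?lerBlDr ?lerDl// !mulr_ge0//; lra.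
have -> : psi (c0 + e) - psi e + K - psi (c0 + m) =
  (K - psi a) + (psi a - psi e) + (psi (c0 + e) - psi (c0 + m)) by ring.
apply: (le_trans (ler_normD _ _)).
have := ler_normD (K - psi a) (psi a - psi e); lra.
Qed.

(** One geometric sum b / (b - 1) for the levels before the crossover and one for those after it;
    lambda + 1 / lambda dominates the constants of [hbound_near] and [hbound_far]. *)
Definition level_const (b : R) := (C + slope) * p * (lambda + lambda^-1) * (2 * (b / (b - 1))).

Lemma geometric_sum_le (b : R) n : 1 < b -> \sum_(i < n) b^-1 ^+ i <= b / (b - 1).
Proof.
move=> b1; have b0 : 0 < b by exact: lt_trans b1.
have h : (1 - b^-1) * \sum_(i < n) b^-1 ^+ i = 1 - b^-1 ^+ n.
  by rewrite -opprB mulNr -subrX1 opprB.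
have hb : 0 < 1 - b^-1 by rewrite subr_gt0 invf_lt1.
rewrite -(ler_pM2l hb) h (_ : (1 - b^-1) * _ = 1); last first.
  by field; rewrite !gt_eqF// subr_gt0.
by rewrite gerBl exprn_ge0// invr_ge0 ltW.
Qed.

Lemma hbound_near b y : 0 <= b -> 0 <= y -> y <= b ->
  hbound (expR (- lambda * y)) <= slope + (C + slope) * p * lambda * b.
Proof.
have [p1' C0' sl0] : [/\ 1 < p, 0 <= C & 0 <= slope] by split=> //; exact: slope_ge0.
move=> b0 y0 yb; rewrite /hbound ge_min; apply/orP; left.
have B0 : 0 <= (C + slope) * p by rewrite mulr_ge0; lra.
rewrite lerD2l -[leRHS]mulrA ler_wpM2l//.
have [_ _ /le_trans] := decay_bounds y0; apply.
by rewrite ler_wpM2l// ltW.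
Qed.

(** The crude estimate exp (- x) <= 1 / x suffices, because it is applied to arguments that grow
    geometrically with the level. *)
Lemma hbound_far b y : 0 < b -> b <= y ->
  hbound (expR (- lambda * y)) <= (C + slope) * p * lambda^-1 * b^-1.
Proof.
have [p1' C0' sl0] : [/\ 1 < p, 0 <= C & 0 <= slope] by split=> //; exact: slope_ge0.
move=> b0 yb; rewrite /hbound ge_min; apply/orP; right.
have B0 : 0 <= (C + slope) * p by rewrite mulr_ge0; lra.
rewrite -[leRHS]mulrA ler_wpM2l//.
have lb : 0 < lambda * b by rewrite mulr_gt0.
rewrite -invfM mulNr expRN lef_pV2 ?posrE ?expR_gt0//.
apply: (@le_trans _ _ (lambda * y)); first by rewrite ler_wpM2l// ltW.
by have := expR_ge1Dx (lambda * y); lra.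
Qed.

(* The crossover level k is the last one at which b ^+ k * x <= 1: the gap still
   costs [slope] at each level up to k, up to geometric corrections. *)
Lemma level_sum_le b x M : 1 < b -> 0 <= x <= 1 ->
  exists k, [/\ (k <= M)%N, b ^+ k * x <= 1 &
    \sum_(j < M.+1) hbound (expR (- lambda * (b ^+ j * x))) <=
      slope * k.+1%:R + level_const b].
Proof.
have [p1' C0' sl0] : [/\ 1 < p, 0 <= C & 0 <= slope] by split=> //; exact: slope_ge0.
have lam0' := lambda_gt0.
move=> b1 /andP[x0 x1]; have b0 : 0 < b by lra.
pose Q k := (k <= M)%N && (b ^+ k * x <= 1).
have Q0 : exists k, Q k by exists 0%N; rewrite /Q expr0 mul1r.
have QM k : Q k -> (k <= M)%N by case/andP.
case: (ex_maxnP Q0 QM) => k /andP[kM bk] kmax.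
exists k; split => //.
pose B := (C + slope) * p; have B0 : 0 <= B by rewrite mulr_ge0; lra.
have li0 : 0 < lambda^-1 by rewrite invr_gt0.
pose W := B * (lambda + lambda^-1).
have W0 : 0 <= W by rewrite mulr_ge0//; lra.
rewrite -(big_mkord xpredT (fun j => hbound (expR (- lambda * (b ^+ j * x))))).
(* The levels up to k are counted downwards from k: the i-th of them has b^(k - i) x <= b^-i. *)
rewrite (big_cat_nat (n := k.+1))//= {1}big_nat_rev/= add0n.
have near : \sum_(0 <= i < k.+1)
      hbound (expR (- lambda * (b ^+ (k.+1 - i.+1) * x))) <=
    slope * k.+1%:R + W * (b / (b - 1)).
  apply: (@le_trans _ _ (\sum_(0 <= i < k.+1) (slope + W * b^-1 ^+ i))).
    rewrite big_nat [leRHS]big_nat; apply: ler_sum => i /= ik; rewrite subSS.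
    have bi0 : 0 <= b^-1 ^+ i by rewrite exprn_ge0// invr_ge0 ltW.
    apply: (le_trans (hbound_near (b := b^-1 ^+ i) _ _ _)) => //.
    - by rewrite mulr_ge0// exprn_ge0// ltW.
    - rewrite exprVn -[leRHS]mul1r ler_pdivlMr ?exprn_gt0// mulrAC -exprD.
      by rewrite subnK.
    - rewrite lerD2l ler_wpM2r// /W -/B ler_wpM2l//; lra.
  rewrite big_split/= sumr_const_nat subn0 -[slope *+ _]mulr_natr lerD2l -mulr_sumr.
  by rewrite ler_wpM2l// big_mkord geometric_sum_le.
have far : \sum_(k.+1 <= i < M.+1) hbound (expR (- lambda * (b ^+ i * x))) <=
    W * (b / (b - 1)).
  apply: (@le_trans _ _ (\sum_(k.+1 <= i < M.+1) (W * b^-1 ^+ (i - k.+1)))).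
    rewrite big_nat [leRHS]big_nat; apply: ler_sum => i /= /andP[ki iM].
    have kM' : (k < M)%N by apply: leq_trans ki _; rewrite -ltnS.
    (* By maximality of k the scaled gap exceeds 1 one level further, so level i sees at least b^(i
       - k - 1). *)
    have bk1 : 1 < b ^+ k.+1 * x.
      rewrite ltNge; apply/negP => h.
      by have := kmax k.+1; rewrite /Q kM' h => /(_ isT); rewrite ltnn.
    apply: (le_trans (hbound_far (b := b ^+ (i - k.+1)) _ _)).
    - by rewrite exprn_gt0.
    - rewrite -{2}(subnK ki) exprD -mulrA ler_peMr ?exprn_ge0 ?ltW//.
    - have bi0 : 0 <= b^-1 ^+ (i - k.+1) by rewrite exprn_ge0// invr_ge0 ltW.
      rewrite -exprVn; apply: ler_wpM2r => //; rewrite /W -/B ler_wpM2l//; lra.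
  rewrite -mulr_sumr ler_wpM2l// -{1}(add0n k.+1) big_addn.
  under eq_bigr do rewrite addnK.
  by rewrite big_mkord geometric_sum_le.
have -> : level_const b = W * (b / (b - 1)) + W * (b / (b - 1)).
  by rewrite /level_const -/B -/W; ring.
by rewrite addrA; apply: lerD.
Qed.

(** The crossover level depends on x; adding up all candidates k gives a step function whose terms
    live on x <= b^-k and are integrated at once. It stands for x^(- theta / log b). *)
Definition level_step b M (x : R) : R :=
  \sum_(k < M.+1) expR (slope * k.+1%:R + level_const b) *
                   (b ^+ k * x <= 1)%R%:R.

Lemma level_step_ge b x M : 1 < b -> 0 <= x <= 1 ->
  expR (\sum_(j < M.+1) hbound (expR (- lambda * (b ^+ j * x)))) <=
  level_step b M x.
Proof.
move=> b1 x01; have [k [kM bk h]] := level_sum_le M b1 x01.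
rewrite /level_step [leRHS](bigD1 (Ordinal (kM : (k < M.+1)%N)))//= bk mulr1.
apply: (@le_trans _ _ (expR (slope * k.+1%:R + level_const b))).
  by rewrite ler_expR.
by rewrite lerDl sumr_ge0// => i _; rewrite mulr_ge0// expR_ge0.
Qed.

End chain_bounds.

(** * The variance gamma exponent *)

Section ln_facts.
Context (R : realType).

Lemma ln_tangent (x m : R) : 0 < x -> 0 < m -> ln x <= ln m + (x - m) / m.
Proof.
move=> x0 m0; have xm : 0 < x / m by rewrite divr_gt0.
have -> : ln x = ln m + ln (x / m).
  by rewrite -lnM// mulrC divfK// gt_eqF.
rewrite lerD2l (_ : x / m = 1 + (x - m) / m); last by field; rewrite gt_eqF.
apply: le_ln1Dx; rewrite mulrBl divff ?gt_eqF//; lra.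
Qed.

(** The tangent at the mean m lies above ln, and its linear terms cancel in the average. *)
Lemma ln_concave (x y t : R) : 0 < x -> 0 < y -> 0 <= t <= 1 ->
  t * ln x + (1 - t) * ln y <= ln (t * x + (1 - t) * y).
Proof.
move=> x0 y0 /andP[t0 t1]; set m := t * x + _.
have m0 : 0 < m.
  rewrite /m; have [t00|tN0] := eqVneq t 0; first by rewrite t00; lra.
  rewrite ltr_pwDl//; last by rewrite mulr_ge0 ?subr_ge0// ltW.
  by rewrite mulr_gt0// lt_neqAle eq_sym tN0.
have hx := ln_tangent x0 m0; have hy := ln_tangent y0 m0.
have : t * ln x + (1 - t) * ln y <=
    t * (ln m + (x - m) / m) + (1 - t) * (ln m + (y - m) / m).
  by apply: lerD; apply: ler_wpM2l => //; lra.
move=> /le_trans; apply; rewrite le_eqVlt; apply/orP; left; apply/eqP.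
by rewrite /m; field; rewrite -/m gt_eqF.
Qed.

Lemma ln_lipschitz (delta x y : R) : 0 < delta -> delta <= x -> delta <= y ->
  `|ln x - ln y| <= delta^-1 * `|x - y|.
Proof.
move=> d0.
wlog xy : x y / y <= x.
  move=> H dx dy; have [/H|/ltW/H] := leP y x; first exact.
  by rewrite distrC (distrC x y); exact.
move=> dx dy; have [x0 y0] : 0 < x /\ 0 < y by split; lra.
rewrite ger0_norm; last by rewrite subr_ge0 ler_ln ?posrE.
have -> : `|x - y| = x - y by rewrite ger0_norm// subr_ge0.
have := ln_tangent x0 y0; rewrite -lerBlDl => /le_trans; apply.
by rewrite mulrC ler_wpM2r ?subr_ge0// lef_pV2.
Qed.

Lemma ln_sqrt (x : R) : 0 < x -> ln (Num.sqrt x) = ln x / 2.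
Proof.
by move=> x0; rewrite -{2}(sqr_sqrtr (ltW x0)) lnXn ?sqrtr_gt0// mulr2n; lra.
Qed.
End ln_facts.

Section vg_exponent.
Context (R : realType).
Variables (kappa alpha beta gamma p : R).
Hypotheses (kappa_gt0 : 0 < kappa) (gamma_gt0 : 0 < gamma)
  (gamma2 : gamma ^+ 2 = alpha ^+ 2 - beta ^+ 2) (p_gt1 : 1 < p)
  (p_lt : p + `|beta| < alpha).

Definition vg_log (z : R) : R :=
  ln (gamma / Num.sqrt (alpha ^+ 2 - (beta + z) ^+ 2)).

(** The psi of the overview: [mu] is absent because the centring c_X contains it too. *)
Definition vg_exponent (z : R) : R := 2 * kappa * (vg_log z - z * vg_log 1).

(** These are the two factors of alpha^2 - (beta + z)^2. A lower bound uniform in z is what makes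
    the exponent Lipschitz on [-p, p]. *)
Lemma vg_dom z : - p <= z <= p ->
  alpha - `|beta| - p <= alpha - beta - z /\ alpha - `|beta| - p <= alpha + beta + z.
Proof.
move=> /andP[z1 z2]; have := ler_norm beta; have := ler_norm (- beta).
by rewrite normrN; split; lra.
Qed.

Lemma vg_logE z : - p <= z <= p ->
  vg_log z = ln gamma - (ln (alpha - beta - z) + ln (alpha + beta + z)) / 2.
Proof.
move=> hz; have [h1 h2] := vg_dom hz; have p_lt' := p_lt.
have [d1 d2] : 0 < alpha - beta - z /\ 0 < alpha + beta + z by split; lra.
rewrite /vg_log (_ : alpha ^+ 2 - _ = (alpha - beta - z) * (alpha + beta + z)); last by ring.
by rewrite ln_div ?posrE ?sqrtr_gt0 ?mulr_gt0// ln_sqrt ?mulr_gt0// lnM ?posrE.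
Qed.

Lemma vg_exponent0 : vg_exponent 0 = 0.
Proof.
rewrite /vg_exponent mul0r subr0 /vg_log addr0 -gamma2 sqrtr_sqr ger0_norm ?ltW//.
by rewrite divff ?gt_eqF// ln1 mulr0.
Qed.

Lemma vg_exponent1 : vg_exponent 1 = 0.
Proof. by rewrite /vg_exponent mul1r subrr mulr0. Qed.

(** On [-p, p] the exponent is an affine function of z minus kappa times the logarithms of the two
    affine factors. *)
Lemma vg_exponent_convex x y t : - p <= x <= p -> - p <= y <= p ->
  0 <= t <= 1 ->
  vg_exponent (t * x + (1 - t) * y) <= t * vg_exponent x + (1 - t) * vg_exponent y.
Proof.
move=> hx hy ht; have [hx1 hx2] := vg_dom hx; have [hy1 hy2] := vg_dom hy.
have p_lt' := p_lt.
have hz : - p <= t * x + (1 - t) * y <= p.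
  by case/andP: hx hy ht => ? ? /andP[? ?] /andP[? ?]; apply/andP; split; nra.
have c1 := @ln_concave _ (alpha - beta - x) (alpha - beta - y) t _ _ ht.
have c2 := @ln_concave _ (alpha + beta + x) (alpha + beta + y) t _ _ ht.
have {}c1 : t * ln (alpha - beta - x) + (1 - t) * ln (alpha - beta - y) <=
    ln (alpha - beta - (t * x + (1 - t) * y)).
  have -> : alpha - beta - (t * x + (1 - t) * y) =
    t * (alpha - beta - x) + (1 - t) * (alpha - beta - y) by ring.
  by apply: c1; lra.
have {}c2 : t * ln (alpha + beta + x) + (1 - t) * ln (alpha + beta + y) <=
    ln (alpha + beta + (t * x + (1 - t) * y)).
  have -> : alpha + beta + (t * x + (1 - t) * y) =
    t * (alpha + beta + x) + (1 - t) * (alpha + beta + y) by ring.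
  by apply: c2; lra.
rewrite /vg_exponent; set k1 := vg_log 1.
rewrite [leRHS](_ : _ = 2 * kappa * (t * (vg_log x - x * k1) +
  (1 - t) * (vg_log y - y * k1))); last by ring.
apply: ler_wpM2l; first by rewrite mulr_ge0// ltW.
by rewrite !vg_logE//; lra.
Qed.

Lemma vg_exponent_lipschitz : exists2 C, 0 <= C &
  forall x y, - p <= x <= p -> - p <= y <= p ->
  `|vg_exponent x - vg_exponent y| <= C * `|x - y|.
Proof.
pose dl := alpha - `|beta| - p.
have d0 : 0 < dl by have := p_lt; rewrite /dl; lra.
(* Each logarithm is Lipschitz with constant 1 / dl and carries a factor 1/2; the last term comes
   from the linear part. *)
exists (2 * kappa * (dl^-1 + `|vg_log 1|)).
  by rewrite !mulr_ge0// ?addr_ge0 ?invr_ge0// ltW.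
move=> x y hx hy; have [hx1 hx2] := vg_dom hx; have [hy1 hy2] := vg_dom hy.
have c1 := ln_lipschitz d0 hx1 hy1; have c2 := ln_lipschitz d0 hx2 hy2.
rewrite /vg_exponent -mulrBr normrM ger0_norm; last by rewrite mulr_ge0// ltW.
rewrite -[leRHS]mulrA; apply: ler_wpM2l; first by rewrite mulr_ge0// ltW.
rewrite (vg_logE hx) (vg_logE hy).
set u := ln (alpha - beta - x) in c1 *; set v := ln (alpha - beta - y) in c1 *.
set u' := ln (alpha + beta + x) in c2 *; set v' := ln (alpha + beta + y) in c2 *.
have e1 : `|(alpha - beta - x) - (alpha - beta - y)| = `|x - y|.
  by rewrite distrC; congr `|_|; ring.
have e2 : `|(alpha + beta + x) - (alpha + beta + y)| = `|x - y|.
  by congr `|_|; ring.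
rewrite e1 in c1; rewrite e2 in c2.
rewrite (_ : _ - _ = - ((u - v) / 2 + (u' - v') / 2) - (x - y) * vg_log 1); last by field.
apply: (le_trans (ler_normB _ _)); rewrite normrN [leRHS]mulrDl.
apply: lerD; last by rewrite normrM mulrC.
apply: (le_trans (ler_normD _ _)).
have -> : `|(u - v) / 2| = `|u - v| / 2 by rewrite normrM (ger0_norm (_ : 0 <= 2^-1))// invr_ge0.
have -> : `|(u' - v') / 2| = `|u' - v'| / 2 by rewrite normrM (ger0_norm (_ : 0 <= 2^-1))// invr_ge0.
by lra.
Qed.

End vg_exponent.

(** * Iterated integrals *)

Section iterated_integrals.
Local Open Scope ereal_scope.
Context (R : realType) d (T : measurableType d).
Local Notation mu := (@lebesgue_measure R).

(* The indicator of 0 <= s <= t, so that Tonelli's theorem applies to integrals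
   over [`[0, t]] with a variable t. *)
Definition before (t s : R) : \bar R := (((0 <= s) && (s <= t))%R%:R)%:E.

Lemma before_ge0 t s : 0 <= before t s.
Proof. by rewrite lee_fin. Qed.

Lemma measurable_before d1 (U : measurableType d1) (x y : U -> R) :
  measurable_fun setT x -> measurable_fun setT y ->
  measurable_fun setT (fun u => before (x u) (y u)).
Proof.
move=> mx my; apply/measurable_EFinP.
apply: (@measurableT_comp _ _ _ _ _ _ (fun b : bool => b%:R : R)) => //.
by apply: measurable_and; apply: measurable_fun_ler => //; exact: measurable_cst.
Qed.

Lemma integral_before (g : R -> \bar R) t :
  \int[mu]_(s in `[0%R, t]) g s = \int[mu]_s (g s * before t s).
Proof.
rewrite integral_mkcond; apply: eq_integral => s _.
rewrite /before patchE mem_setE in_itv/=.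
by case: ifPn => _; rewrite ?mule1 ?mule0.
Qed.

(** Of two points of [0, t] one precedes the other; at s = u both terms count, hence only an
    inequality. *)
Lemma before_split t s u :
  before t u * before t s <= before t s * before s u + before t u * before u s.
Proof.
rewrite /before -!EFinM -EFinD lee_fin -!natrM -natrD ler_nat !mulnb addnC.
have := le_total s u.
case: (leP 0%R s) => //= _; case: (leP 0%R u) => //= _; rewrite ?andbF//=.
by case: (leP u t); case: (leP s t) => //=; case: (leP s u); case: (leP u s).
Qed.

Lemma measurable_comp_pair d1 (U : measurableType d1) (h : R -> T -> \bar R)
    (x : U -> R) (y : U -> T) :
  measurable_fun setT (fun z : R * T => h z.1 z.2) ->
  measurable_fun setT x -> measurable_fun setT y ->
  measurable_fun setT (fun u => h (x u) (y u)).
Proof.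
by move=> mh mx my; apply: (measurableT_comp mh (measurable_fun_pair mx my)).
Qed.

Variable f : R -> T -> \bar R.
Hypothesis mf : measurable_fun setT (fun z : R * T => f z.1 z.2).
Hypothesis f0 : forall s w, 0 <= f s w.

(** The integral of f(s_1) ... f(s_k) over the simplex t >= s_1 >= ... >= s_k >= 0. *)
Fixpoint iter_int (k : nat) (t : R) (w : T) : \bar R :=
  if k is k'.+1 then \int[mu]_s (f s w * iter_int k' s w * before t s) else 1.

Lemma iter_int_ge0 k t w : 0 <= iter_int k t w.
Proof.
elim: k t => [//|k ih] t /=; apply: integral_ge0 => s _.
by rewrite !mule_ge0// before_ge0.
Qed.

Lemma measurable_iter_int k : measurable_fun setT (fun z : R * T => iter_int k z.1 z.2).
Proof.
elim: k => [|k ih] /=; first exact: measurable_cst.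
pose h (z : (R * T) * R) := f z.2 z.1.2 * iter_int k z.2 z.1.2 * before z.1.1 z.2.
have -> : (fun z : R * T => \int[mu]_s (f s z.2 * iter_int k s z.2 * before z.1 s)) =
    fubini_F mu h by [].
apply: measurable_fun_fubini_tonelli_F.
- apply: emeasurable_funM; first apply: emeasurable_funM.
  + apply: (measurable_comp_pair mf); first exact: measurable_snd.
    exact: (measurableT_comp measurable_snd measurable_fst).
  + apply: (measurable_comp_pair ih); first exact: measurable_snd.
    exact: (measurableT_comp measurable_snd measurable_fst).
  + apply: measurable_before; [exact: measurableT_comp|exact: measurable_snd].
- by move=> z; rewrite /h !mule_ge0// ?before_ge0// iter_int_ge0.
Qed.

Lemma measurable_f w : measurable_fun setT (f ^~ w).
Proof. by apply: (measurable_comp_pair mf (y := fun=> w)) => //; exact: measurable_cst. Qed.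

Lemma measurable_iter_intl k w : measurable_fun setT (iter_int k ^~ w).
Proof.
by apply: (measurable_comp_pair (measurable_iter_int k) (y := fun=> w)) => //; exact: measurable_cst.
Qed.

(** A further point inserted among k ordered ones has k + 1 possible ranks. Recursively: either it
    lies below the largest point u, which is the same problem on [0, u] with one point fewer, or it
    becomes the largest point. *)
Lemma iter_int_mul k t w :
  iter_int k t w * iter_int 1 t w <= k.+1%:R%:E * iter_int k.+1 t w.
Proof.
elim: k t => [|k ih] t; first by rewrite -[1%:R%:E]/(1 : \bar R) [iter_int 0 t w]/= !mul1e.
have mb (x : R) : measurable_fun setT (before x) by apply: measurable_before => //; exact: measurable_cst.
pose g u := f u w * iter_int k u w.
have mg : measurable_fun setT g.
  by apply: emeasurable_funM; [exact: measurable_f|exact: measurable_iter_intl].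
have g0 u : 0 <= g u by rewrite mule_ge0// iter_int_ge0.
have mgb (x : R) : measurable_fun setT (fun u => g u * before x u) by exact: emeasurable_funM.
apply: (@le_trans _ _ (\int[mu]_u (g u * (before t u * iter_int 1 t w)))).
  rewrite -/(iter_int k.+1 t w) [X in X * _ <= _]/= -ge0_integralZr//; first last.
  - exact: iter_int_ge0.
  - by move=> u _; rewrite !mule_ge0// ?before_ge0 ?iter_int_ge0.
  - exact: mgb.
  by under eq_integral do rewrite -muleA.
have mJ j : measurable_fun setT (iter_int j ^~ w) by exact: measurable_iter_intl.
have mfw := measurable_f w.
(* The case where the new point s = z.2 lies above the old largest point u = z.1. *)
pose H1 (z : R * R) := f z.2 w * before t z.2 * (g z.1 * before z.2 z.1).
have mH1 : measurable_fun setT H1.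
  apply: emeasurable_funM; apply: emeasurable_funM.
  - exact: (measurableT_comp mfw).
  - by apply: measurable_before => //; exact: measurable_cst.
  - exact: (measurableT_comp mg).
  - exact: measurable_before.
have H10 z : 0 <= H1 z by rewrite /H1 !mule_ge0// ?before_ge0 ?iter_int_ge0.
pose F1 := fubini_F mu H1.
have mF1 : measurable_fun setT F1 by exact: measurable_fun_fubini_tonelli_F.
have F10 u : 0 <= F1 u by apply: integral_ge0.
(* The case where the new point lies below u: the induction hypothesis applies at u. *)
pose F2 u := f u w * (iter_int k u w * iter_int 1 u w) * before t u.
have mF2 : measurable_fun setT F2.
  by apply: emeasurable_funM => //; do 2 (apply: emeasurable_funM => //).
have F20 u : 0 <= F2 u by rewrite /F2 !mule_ge0// ?before_ge0 ?iter_int_ge0.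
apply: (@le_trans _ _ (\int[mu]_u (F1 u + F2 u))).
  apply: ge0_le_integral => //.
  - by move=> u _; rewrite !mule_ge0// ?before_ge0 ?iter_int_ge0.
  - apply: emeasurable_funM; first exact: mg.
    by apply: emeasurable_funM; [exact: mb|exact: measurable_cst].
  - exact: emeasurable_funD.
  - move=> u _.
    pose h2 s := f s w * 1 * before u s.
    have mh x : measurable_fun setT (fun s => f s w * 1 * before x s).
      by apply: emeasurable_funM => //; apply: emeasurable_funM => //; exact: measurable_cst.
    have h0 x s : 0 <= f s w * 1 * before x s by rewrite !mule_ge0// before_ge0.
    have mh2 : measurable_fun setT h2 by exact: mh.
    have mht := mh t.
    have h20 s : 0 <= h2 s by exact: h0.
    have -> : F2 u = \int[mu]_s (g u * before t u * h2 s).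
      rewrite ge0_integralZl//; last by rewrite mule_ge0// before_ge0.
      by rewrite /F2 /g muleA [LHS]muleAC.
    rewrite muleA -ge0_integralZl//; last by rewrite mule_ge0// before_ge0.
    have mHu : measurable_fun setT (fun s => H1 (u, s)).
      exact: (measurableT_comp mH1 (pair1_measurable u)).
    have gb0 : 0 <= g u * before t u by rewrite mule_ge0// before_ge0.
    have mgh : measurable_fun setT (fun s => g u * before t u * h2 s).
      exact: measurable_funeM.
    have gh0 s : 0 <= g u * before t u * h2 s by rewrite mule_ge0.
    have Hu0 s : 0 <= H1 (u, s) by exact: H10.
    rewrite -ge0_integralD//.
    apply: ge0_le_integral => //.
    - by move=> s _; rewrite mule_ge0// mule_ge0// before_ge0.
    - apply: measurable_funeM; exact: mh.
    - exact: emeasurable_funD.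
    - move=> s _; rewrite /H1 /h2 /= !mule1.
      rewrite (_ : g u * before t u * (f s w * before t s) =
        g u * f s w * (before t u * before t s)); last by rewrite muleACA.
      rewrite (_ : g u * before t u * (f s w * before u s) =
        g u * f s w * (before t u * before u s)); last by rewrite muleACA.
      rewrite (_ : f s w * before t s * (g u * before s u) =
        g u * f s w * (before t s * before s u)); last first.
        by rewrite muleACA (muleC (f s w)).
      rewrite -ge0_muleDr ?mule_ge0 ?before_ge0//; apply: lee_wpmul2l.
        by rewrite mule_ge0.
      exact: before_split.
rewrite ge0_integralD//.
rewrite -natr1 EFinD ge0_muleDl// ?lee_fin// mul1e addeC; apply: leeD.
  have -> : iter_int k.+2 t w = \int[mu]_s (f s w * iter_int k.+1 s w * before t s) by [].
  have mJS : measurable_fun setT (fun s => f s w * iter_int k.+1 s w * before t s).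
    by apply: emeasurable_funM => //; exact: emeasurable_funM.
  have JS0 s : 0 <= f s w * iter_int k.+1 s w * before t s.
    by rewrite !mule_ge0// ?before_ge0 ?iter_int_ge0.
  rewrite -ge0_integralZl//.
  apply: ge0_le_integral => //.
  - exact: measurable_funeM.
  - move=> u _; rewrite /F2 muleAC [leRHS](_ : _ = f u w * before t u *
      (k.+1%:R%:E * iter_int k.+1 u w)); last by rewrite (muleAC (f u w)) muleCA.
    by apply: lee_wpmul2l; [rewrite mule_ge0// before_ge0|exact: ih].
(* Exchanging the integrals makes the new point s the outermost variable, which gives exactly
   [iter_int k.+2]. *)
rewrite /F1 /fubini_F fubini_tonelli//= le_eqVlt; apply/orP; left; apply/eqP.
apply: eq_integral => s _.
rewrite /H1/= ge0_integralZl//; last 3 first.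
- exact: mgb.
- by move=> x _; rewrite mule_ge0// before_ge0.
- by rewrite mule_ge0// before_ge0.
rewrite [RHS]muleAC; congr (_ * _); exact: eq_integral.
Qed.

Lemma iter_int_exp k t w : iter_int 1 t w ^+ k <= k`!%:R%:E * iter_int k t w.
Proof.
elim: k => [|k ih]; first by rewrite expe0 fact0 mule1.
rewrite expeS muleC; apply: (@le_trans _ _ (k`!%:R%:E * iter_int k t w * iter_int 1 t w)).
  by apply: lee_wpmul2r => //; exact: iter_int_ge0.
rewrite -muleA; apply: (@le_trans _ _ (k`!%:R%:E * (k.+1%:R%:E * iter_int k.+1 t w))).
  by apply: lee_wpmul2l; [rewrite lee_fin|exact: iter_int_mul].
by rewrite muleA -EFinM -natrM mulnC.
Qed.

End iterated_integrals.

(** * Expectations of iterated integrals *)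

Section expectation_iterated.
Local Open Scope ereal_scope.
Context (R : realType) d (T : measurableType d) (P : probability T R).
Local Notation mu := (@lebesgue_measure R).
Variables (f : R -> T -> \bar R) (xi : T -> \bar R).
Hypothesis mf : measurable_fun setT (fun z : R * T => f z.1 z.2).
Hypothesis f0 : forall s w, 0 <= f s w.
Hypothesis mxi : measurable_fun setT xi.
Hypothesis xi0 : forall w, 0 <= xi w.

Lemma measurable_fl s : measurable_fun setT (f s).
Proof. by apply: (measurable_comp_pair mf (x := fun=> s)) => //; exact: measurable_cst. Qed.

(** Tonelli takes the outermost point out of the expectation. The factor G accumulates the densities
    at the points already taken out, so that the step can be repeated. *)
Lemma expectation_iter_intS (k : nat) (x : R) (G : T -> \bar R) :
  measurable_fun setT G -> (forall w, 0 <= G w) ->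
  \int[P]_w (xi w * iter_int f k.+1 x w * G w) =
  \int[mu]_u ((\int[P]_w (xi w * iter_int f k u w * (f u w * G w))) * before x u).
Proof.
move=> mG G0.
have mJ := measurable_iter_int mf f0 k.
have J0 u w := iter_int_ge0 f0 k u w.
pose h (z : T * R) := xi z.1 * iter_int f k z.2 z.1 * (f z.2 z.1 * G z.1) * before x z.2.
have mfs : measurable_fun setT (fun z : T * R => f z.2 z.1).
  by apply: (measurable_comp_pair mf); [exact: measurable_snd|exact: measurable_fst].
have mJs : measurable_fun setT (fun z : T * R => iter_int f k z.2 z.1).
  by apply: (measurable_comp_pair mJ); [exact: measurable_snd|exact: measurable_fst].
have mh : measurable_fun setT h.
  apply: emeasurable_funM; last first.
    by apply: measurable_before; [exact: measurable_cst|exact: measurable_snd].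
  apply: emeasurable_funM.
    apply: emeasurable_funM => //.
    exact: (measurableT_comp mxi measurable_fst).
  apply: emeasurable_funM => //.
  exact: (measurableT_comp mG measurable_fst).
have h0 z : 0 <= h z by rewrite /h !mule_ge0 ?before_ge0.
transitivity (\int[P]_w \int[mu]_u h (w, u)).
  apply: eq_integral => w _; rewrite [iter_int _ _ _ _]/=.
  have mI : measurable_fun setT (fun u => f u w * iter_int f k u w * before x u).
    apply: emeasurable_funM; last by apply: measurable_before => //; exact: measurable_cst.
    apply: emeasurable_funM; first exact: measurable_f.
    exact: measurable_iter_intl.
  have I0 u : 0 <= f u w * iter_int f k u w * before x u.
    by rewrite !mule_ge0 ?before_ge0.
  rewrite muleAC -ge0_integralZl//; last by rewrite mule_ge0.
  apply: eq_integral => u _; rewrite /h /=.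
  rewrite !muleA; congr (_ * _).
  by rewrite (muleAC (xi w) (G w)) (muleAC _ (G w)) (muleAC (xi w) (f u w)).
rewrite fubini_tonelli//; apply: eq_integral => u _; rewrite /h /=.
rewrite ge0_integralZr ?before_ge0//.
- apply: emeasurable_funM.
    by apply: emeasurable_funM => //; apply: (measurable_comp_pair mJ) => //; exact: measurable_cst.
  by apply: emeasurable_funM => //; exact: measurable_fl.
- by move=> w _; rewrite !mule_ge0.
Qed.

Lemma measurable_expectation_iter_int (k : nat) (G : T -> \bar R) :
  measurable_fun setT G -> (forall w, 0 <= G w) ->
  measurable_fun setT (fun u => \int[P]_w (xi w * iter_int f k u w * (f u w * G w))).
Proof.
move=> mG G0.
have mJ := measurable_iter_int mf f0 k.
have J0 u w := iter_int_ge0 f0 k u w.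
apply: (measurable_fun_fubini_tonelli_F (m2 := P)
  (fun z : R * T => xi z.2 * iter_int f k z.1 z.2 * (f z.1 z.2 * G z.2))).
- apply: emeasurable_funM; apply: emeasurable_funM => //.
    exact: (measurableT_comp mxi measurable_snd).
  exact: (measurableT_comp mG measurable_snd).
- by move=> z; rewrite !mule_ge0.
Qed.

(* The points of an iterated integral come in decreasing order, so that only the
   gap between the new point and the previous one has to be integrated at each
   step. *)
Variables (p : nat) (t D g : R) (H : R -> R).
Hypothesis t0 : (0 <= t)%R.
Hypotheses (D0 : (0 <= D)%R) (g0 : (0 <= g)%R) (H0 : forall x, (0 <= H x)%R).
Hypothesis mH : measurable_fun setT H.
Hypothesis gH : forall x, (0 <= x <= t)%R ->
  \int[mu]_u ((H (x - u))%:E * before x u) <= g%:E.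
Hypothesis base : forall s : seq R, sorted <=%R s ->
  all (fun x => 0 <= x <= t)%R s -> size s = p ->
  \int[P]_w (xi w * \prod_(x <- s) f x w) <= (D * \prod_(y <- gaps s) H y)%R%:E.

Lemma expectation_iter_int_prod_le k x s : sorted <=%R (x :: s) ->
  all (fun x => 0 <= x <= t)%R (x :: s) -> (k + size (x :: s))%N = p ->
  \int[P]_w (xi w * iter_int f k x w * \prod_(y <- x :: s) f y w) <=
  (D * g ^+ k * \prod_(y <- gaps (x :: s)) H y)%R%:E.
Proof.
elim: k x s => [|k ih] x s ss sI sp.
  under eq_integral do rewrite mule1.
  by rewrite expr0 mulr1; exact: base.
have mprod : measurable_fun setT (fun w => \prod_(y <- x :: s) f y w).
  by apply: emeasurable_prod => y; exact: measurable_fl.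
have prod0 w : 0 <= \prod_(y <- x :: s) f y w by exact: prode_nonneg.
rewrite expectation_iter_intS//.
set B := (\prod_(y <- gaps (x :: s)) H y)%R.
have B0 : (0 <= B)%R by apply: prodr_ge0.
have /andP[x0 xt] : (0 <= x <= t)%R by case/andP: sI.
have mHb : measurable_fun setT (fun u : R => (H (x - u))%:E * before x u).
  apply: emeasurable_funM; last by apply: measurable_before => //; exact: measurable_cst.
  apply/measurable_EFinP; apply: (measurableT_comp mH); exact: measurable_funB.
have DB0 : (0 <= D * g ^+ k * B)%R by rewrite !mulr_ge0// exprn_ge0.
apply: (@le_trans _ _ (\int[mu]_u ((D * g ^+ k * B)%R%:E * ((H (x - u))%:E * before x u)))).
  apply: ge0_le_integral => //.
  - move=> u _; rewrite mule_ge0 ?before_ge0//; apply: integral_ge0 => w _.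
    by rewrite !mule_ge0// iter_int_ge0.
  - apply: emeasurable_funM; last by apply: measurable_before => //; exact: measurable_cst.
    exact: measurable_expectation_iter_int.
  - exact: measurable_funeM.
  - move=> u _; rewrite muleA.
    have [/andP[u0 ux]|nux] := boolP ((0 <= u) && (u <= x))%R; last first.
      by rewrite /before (negbTE nux) !mule0.
    apply: lee_wpmul2r; first exact: before_ge0.
    have := ih u (x :: s); rewrite [gaps _]/= big_cons -/(gaps (x :: s)) -/B.
    under eq_integral do rewrite big_cons.
    rewrite -EFinM (_ : (D * g ^+ k * B * H (x - u) = D * g ^+ k * (H (x - u) * B))%R); last by ring.
    apply.
    + by rewrite /= ux.
    + by rewrite /= u0 (le_trans ux xt).
    + by rewrite -sp /= addnS.
rewrite ge0_integralZl//; last by move=> u _; rewrite mule_ge0 ?lee_fin ?before_ge0.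
rewrite exprSr.
apply: (@le_trans _ _ ((D * g ^+ k * B)%R%:E * g%:E)).
  by apply: lee_wpmul2l => //; apply: gH; rewrite x0.
rewrite -EFinM lee_fin le_eqVlt; apply/orP; left; apply/eqP; ring.
Qed.

(** The k gaps between k + 1 points contribute g each, and the largest point ranges freely over
    [0, t]. *)
Lemma expectation_iter_int_le k : p = k.+1 ->
  \int[P]_w (xi w * iter_int f p t w) <= (D * g ^+ k * t)%R%:E.
Proof.
move=> pk; rewrite pk.
under eq_integral do rewrite -[xi _ * _]mule1.
rewrite expectation_iter_intS//.
apply: (@le_trans _ _ (\int[mu]_u ((D * g ^+ k)%R%:E * before t u))).
  apply: ge0_le_integral => //.
  - move=> u _; rewrite mule_ge0 ?before_ge0//; apply: integral_ge0 => w _.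
    by rewrite !mule_ge0// iter_int_ge0.
  - apply: emeasurable_funM; last by apply: measurable_before => //; exact: measurable_cst.
    by apply: measurable_expectation_iter_int => //; exact: measurable_cst.
  - by apply: measurable_funeM; apply: measurable_before => //; exact: measurable_cst.
  - move=> u _.
    have [/andP[u0 ut]|nut] := boolP ((0 <= u) && (u <= t))%R; last first.
      by rewrite /before (negbTE nut) !mule0.
    apply: lee_wpmul2r; first exact: before_ge0.
    have := @expectation_iter_int_prod_le k u [::] isT.
    rewrite /= u0 ut addn1 pk big_nil mulr1 => /(_ isT erefl).
    by under eq_integral do rewrite big_cons big_nil.
have mbt : measurable_fun setT (before t) by apply: measurable_before => //; exact: measurable_cst.
have bt0 u : 0 <= before t u := before_ge0 t u.
rewrite ge0_integralZl//; last by rewrite lee_fin mulr_ge0// exprn_ge0.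
rewrite [leRHS]EFinM; apply: lee_wpmul2l; first by rewrite lee_fin mulr_ge0// exprn_ge0.
have := integral_before (fun=> 1) t; rewrite integral_cst//= mul1e lebesgue_measure_itv/=.
under [in X in _ = X -> _]eq_integral do rewrite mul1e.
by move=> <-; case: ifP => _; rewrite ?sube0 ?lee_fin.
Qed.

End expectation_iterated.

(** * Convergence from moment bounds *)

Section powR_interpolation.
Context (R : realType).

Lemma powR_homo (q x y : R) : 0 < q -> 0 <= x -> x <= y -> x `^ q <= y `^ q.
Proof.
move=> q0 x0 xy; apply: ge0_ler_powR => //; first exact: ltW.
by rewrite nnegrE (le_trans x0).
Qed.

Lemma powR_le_1D (q v : R) (k : nat) : 0 < q <= k%:R -> 0 <= v ->
  v `^ q <= 1 + v ^+ k.
Proof.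
move=> /andP[q0 qk] v0; have [v1|/ltW v1] := leP v 1.
  have : v `^ q <= 1 `^ q by apply: powR_homo => //; exact: ltW.
  rewrite powR1 => /le_trans; apply; by rewrite lerDl exprn_ge0.
rewrite -powR_mulrn//; apply: (@le_trans _ _ (v `^ k%:R)).
  by apply: ler_powR.
by rewrite lerDr.
Qed.

(** Below e the left side is at most delta, above M it is at most delta v^k, and in between v^r /
    v^s is at most M^r / e^s. As s may lie on either side of r, this serves both to pass from L^2 to
    L^q convergence and to bound q-th moments below by first moments. *)
Lemma powR_interpolation (r s : R) (k : nat) (delta : R) :
  0 < r < k%:R -> 0 < s -> 0 < delta ->
  exists2 K, 0 < K & forall v, 0 <= v ->
    v `^ r <= delta * (1 + v ^+ k) + K * v `^ s.
Proof.
move=> /andP[r0 rk] s0 d0.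
pose e := delta `^ r^-1; pose M := delta `^ (- (k%:R - r)^-1).
have e0 : 0 < e by exact: powR_gt0.
have M0 : 0 < M by exact: powR_gt0.
exists (M `^ r / e `^ s); first by rewrite divr_gt0// powR_gt0.
move=> v v0.
have vs0 := powR_ge0 v s; have vk0 : 0 <= v ^+ k by rewrite exprn_ge0.
have K0 : 0 <= M `^ r / e `^ s by rewrite divr_ge0// powR_ge0.
have [ve|ev] := leP v e.
  apply: (@le_trans _ _ delta).
    have : v `^ r <= e `^ r by apply: powR_homo => //; exact: ltW.
    by rewrite /e -powRrM mulVf ?gt_eqF// powRr1 ?(ltW d0).
  by rewrite mulrDr mulr1 -addrA lerDl addr_ge0// mulr_ge0// ltW.
have vp : 0 < v by exact: lt_trans ev.
have [vM|Mv] := leP v M.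
  apply: (@le_trans _ _ (M `^ r / e `^ s * v `^ s)).
    rewrite mulrAC -mulrA -[leLHS]mulr1; apply: ler_pM; rewrite ?powR_ge0//.
      by apply: powR_homo => //; exact: ltW.
    rewrite ler_pdivlMr ?powR_gt0// mul1r.
    by apply: powR_homo => //; exact: ltW.
  by rewrite lerDr mulr_ge0 ?addr_ge0// ltW.
have kr : 0 < k%:R - r by rewrite subr_gt0.
apply: (@le_trans _ _ (delta * v ^+ k)).
  have -> : v ^+ k = v `^ (k%:R - r) * v `^ r.
    by rewrite -powRD ?subrK ?powR_mulrn//; rewrite (gt_eqF vp) implybT.
  rewrite mulrA -[leLHS]mul1r ler_wpM2r ?powR_ge0//.
  have : M `^ (k%:R - r) <= v `^ (k%:R - r) by apply: powR_homo => //; exact: ltW.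
  rewrite /M -powRrM mulNr mulVf ?gt_eqF// powR_inv1 ?(ltW d0)// => h.
  by rewrite -ler_pdivrMl// mulr1.
by have := mulr_ge0 K0 vs0; rewrite mulrDr mulr1; lra.
Qed.

End powR_interpolation.

Section L2_completeness.
Context (R : realType) d (T : measurableType d) (P : probability T R).

(** A fast subsequence has absolutely summable increments almost surely, and Fatou's lemma carries
    to its limit both the mean square estimates and every bound on integer moments. *)
Lemma L2_complete (Y : nat -> T -> R) :
  (forall n, measurable_fun setT (Y n)) ->
  (forall n w, 0 <= Y n w) ->
  (forall e : R, 0 < e -> exists N, forall n m, (N <= n)%N -> (n <= m)%N ->
     (\int[P]_w ((Y m w - Y n w) ^+ 2)%:E <= e%:E)%E) ->
  exists A : T -> R, [/\ measurable_fun setT A, forall w, 0 <= A w,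
    forall e : R, 0 < e -> exists N, forall n, (N <= n)%N ->
      (\int[P]_w ((Y n w - A w) ^+ 2)%:E <= e%:E)%E &
    forall k (B : \bar R), (forall n, \int[P]_w (Y n w ^+ k)%:E <= B)%E ->
      (\int[P]_w (A w ^+ k)%:E <= B)%E].
Proof.
move=> mY Y0 cauchy.
have /choice[N0 hN0] : forall k, exists N, forall n m, (N <= n)%N -> (n <= m)%N ->
     (\int[P]_w ((Y m w - Y n w) ^+ 2)%:E <= (8^-1 ^+ k : R)%:E)%E.
  by move=> k; apply: cauchy; rewrite exprn_gt0.
(* The sum makes phi monotone and at least N0 k; the added k makes it unbounded. *)
pose phi k := (\sum_(i < k.+1) N0 i + k)%N.
have phiN k : (N0 k <= phi k)%N.
  by rewrite /phi big_ord_recr/= addnAC leq_addl.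
have phiS k : (phi k <= phi k.+1)%N.
  by rewrite {2}/phi big_ord_recr/= leq_add ?leq_addr.
have phi_ge k : (k <= phi k)%N by rewrite leq_addl.
pose D k w := Y (phi k.+1) w - Y (phi k) w.
have mD k : measurable_fun setT (D k) by exact: measurable_funB.
have mD2 k : measurable_fun setT (fun w => (D k w) ^+ 2) by exact: measurable_funX.
have D1 k : (\int[P]_w `|D k w|%:E <= (2 * 2^-1 ^+ k : R)%:E)%E.
  have h0 : 0 < 2 ^+ k :> R by rewrite exprn_gt0.
  (* From x <= 1 / h + h x^2 with h = 2^k; the expectation is at most 2^-k + 2^k 8^-k, which
     explains the rate 8^-k. *)
  apply: (@le_trans _ _ (\int[P]_w ((2^-1 ^+ k : R)%:E + (2 ^+ k : R)%:E * ((D k w) ^+ 2)%:E))%E).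
    apply: ge0_le_integral => //.
    - by apply/measurable_EFinP; exact: measurableT_comp.
    - apply: emeasurable_funD; first exact: measurable_cst.
      by apply: measurable_funeM; exact/measurable_EFinP.
    - move=> w _; rewrite -EFinM -EFinD lee_fin exprVn.
      rewrite -[D k w ^+ 2]real_normK ?num_real//.
      set h := 2 ^+ k in h0 *; set x := `|D k w|.
      rewrite (_ : h^-1 + h * x ^+ 2 = h^-1 * (1 + (h * x) ^+ 2)); last first.
        by field; rewrite gt_eqF.
      rewrite -[leLHS](mulKf (lt0r_neq0 h0)) ler_wpM2l ?invr_ge0 ?(ltW h0)//.
      set z := h * x; have := sqr_ge0 (z - 1); nra.
  have h1 w : (0 <= (2 ^+ k : R)%:E * ((D k w) ^+ 2)%:E)%E.
    by rewrite -EFinM lee_fin mulr_ge0 ?sqr_ge0// ltW.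
  have h2 w : (0 <= ((D k w) ^+ 2)%:E)%E by rewrite lee_fin sqr_ge0.
  have m2 : measurable_fun setT (fun w => ((D k w) ^+ 2)%:E) by exact/measurable_EFinP.
  rewrite ge0_integralD//; last exact: measurable_funeM.
  rewrite integral_cst//= probability_setT mule1 ge0_integralZl//.
  rewrite (_ : 2 * 2^-1 ^+ k = 2^-1 ^+ k + 2^-1 ^+ k); last by ring.
  rewrite EFinD leeD2l//.
  apply: (@le_trans _ _ ((2 ^+ k)%:E * (8^-1 ^+ k : R)%:E)%E).
    by apply: lee_wpmul2l; [rewrite lee_fin ltW|exact: hN0].
  rewrite -EFinM lee_fin -exprMn.
  by apply: lerXn2r; rewrite ?nnegrE; lra.
have mDn k : measurable_fun setT (fun w => `|D k w|%:E).
  by apply/measurable_EFinP; exact: measurableT_comp.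
have Dfin : {ae P, forall w, (\sum_(k <oo) `|D k w|%:E < +oo)%E}.
  have S0 w : (0 <= \sum_(k <oo) `|D k w|%:E)%E by exact: nneseries_ge0.
  have mS : measurable_fun setT (fun w => \sum_(k <oo) `|D k w|%:E)%E.
    by apply: ge0_emeasurable_sum.
  have iS : P.-integrable setT (fun w => \sum_(k <oo) `|D k w|%:E)%E.
    apply/integrableP; split => //.
    under eq_integral do rewrite gee0_abs//.
    rewrite integral_nneseries//.
    apply: (@le_lt_trans _ _ (\sum_(k <oo) (2 * 2^-1 ^+ k : R)%:E)%E).
      by apply: lee_nneseries => n *; [exact: integral_ge0|exact: D1].
    have := @cvg_geometric_eseries_half R 4 0.
    rewrite (_ : (fun k => _) = (fun k => (2 * 2^-1 ^+ k : R)%:E)); last first.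
      apply/funext => k; rewrite addn1 natrX exprS exprVn; congr EFin.
      by field; rewrite gt_eqF// exprn_gt0.
    by move=> /cvg_lim ->//; rewrite ltry.
  apply: filterS (integrable_ae measurableT iS) => w /(_ I).
  by rewrite fin_numElt => /andP[].
(* Defined, measurable and nonnegative at every w, and equal to the limit wherever that exists. *)
pose A w := `|fine (limn_esup (fun k => (Y (phi k) w)%:E))|.
have mA : measurable_fun setT A.
  apply: measurableT_comp => //; apply: measurableT_comp => //.
  by apply: measurable_fun_limn_esup => n; exact/measurable_EFinP.
have AE : {ae P, forall w, Y (phi k) w @[k --> \oo] --> A w}.
  apply: filterS Dfin => w Dw.
  have cY : cvgn (fun k => Y (phi k) w).
    have cD : cvgn (series (fun k => D k w)).
      apply: normed_cvg; apply: nondecreasing_is_cvgn.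
        by apply: nondecreasing_series => k *; apply: normr_ge0.
      exists (fine (\sum_(k <oo) `|D k w|%:E)%E) => _ [n _ <-].
      have S0 : (0 <= \sum_(k <oo) `|D k w|%:E)%E by exact: nneseries_ge0.
      rewrite -lee_fin fineK ?ge0_fin_numE// /= /series/= -sumEFin.
      exact: nneseries_lim_ge.
    have -> : (fun k => Y (phi k) w) = (fun k => series (fun k => D k w) k + Y (phi 0%N) w).
      apply/funext => k; rewrite /series/= telescope_sumr// subrK//.
    by apply: is_cvgD => //; exact: is_cvg_cst.
  suff -> : A w = limn (fun k => Y (phi k) w) by [].
  have cYE : (Y (phi k) w)%:E @[k --> \oo] --> (limn (fun k => Y (phi k) w))%:E.
    by apply/fine_cvgP; split; [exact: nearW|exact: cY].
  rewrite /A is_cvg_limn_esupE; last by apply/cvg_ex; eexists; exact: cYE.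
  rewrite (cvg_lim _ cYE)//= ger0_norm//.
  by apply: limr_ge => //; exact: nearW.
have fatouA (g : nat -> T -> R) (h : T -> R) (B : \bar R) :
    (forall k, measurable_fun setT (g k)) -> measurable_fun setT h ->
    (forall k w, 0 <= g k w) ->
    {ae P, forall w, g k w @[k --> \oo] --> h w} ->
    (forall m, exists2 k, (m <= k)%N & \int[P]_w (g k w)%:E <= B)%E ->
    (\int[P]_w (h w)%:E <= B)%E.
  move=> mg mh g0 gh gB.
  apply: (@le_trans _ _ (\int[P]_w limn_einf (fun k => (g k w)%:E))%E).
    rewrite le_eqVlt; apply/orP; left; apply/eqP.
    apply: ae_eq_integral => //.
    - exact/measurable_EFinP.
    - have -> : (fun w => limn_einf (fun k => (g k w)%:E)) =
          (fun w => - limn_esup (fun k => - (g k w)%:E))%E.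
        by apply/funext => w; rewrite (limn_esupN (fun k => (g k w)%:E)) oppeK.
      apply: measurableT_comp => //; apply: measurable_fun_limn_esup => k.
      by apply: measurableT_comp => //; exact/measurable_EFinP.
    - apply: filterS gh => w cw _.
      have c2 : (fun k => (g k w)%:E) @ \oo --> (h w)%:E.
        by apply/fine_cvgP; split; [exact: nearW|exact: cw].
      by rewrite is_cvg_limn_einfE ?(cvg_lim _ c2)//; apply/cvg_ex; eexists; exact: c2.
  apply: (le_trans (fatou _ _ _ _)) => //.
  - by move=> k; exact/measurable_EFinP.
  - by move=> k w _; rewrite lee_fin.
  - rewrite limn_einf_lim; apply: lime_le; first exact: is_cvg_einfs.
    apply: nearW => m; have [k mk gk] := gB m.
    by apply: le_trans gk; apply: ereal_inf_lbound; exists k.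
exists A; split; [exact: mA|by move=> w; exact: normr_ge0| |].
  move=> e e0; have [N hN] := cauchy e e0; exists N => n Nn.
  apply: (fatouA (fun k w => (Y n w - Y (phi k) w) ^+ 2)).
  - by move=> k; apply: measurable_funX; exact: measurable_funB.
  - by apply: measurable_funX; exact: measurable_funB.
  - by move=> k w; exact: sqr_ge0.
  - apply: filterS AE => w cw.
    rewrite expr2; under eq_fun do rewrite expr2.
    by apply: cvgM; apply: cvgB => //; exact: cvg_cst.
  - move=> m; exists (maxn m n); first exact: leq_maxl.
    under eq_integral do rewrite -sqrrN opprB.
    by apply: hN => //; rewrite (leq_trans _ (phi_ge _))// leq_maxr.
move=> k B hB.
apply: (fatouA (fun j w => Y (phi j) w ^+ k)).
- by move=> j; exact: measurable_funX.
- exact: measurable_funX.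
- by move=> j w; exact: exprn_ge0.
- apply: filterS AE => w cw; elim: k {hB} => [|k ih].
    by rewrite expr0; under eq_fun do rewrite expr0; exact: cvg_cst.
  by rewrite exprS; under eq_fun do rewrite exprS; exact: cvgM.
- by move=> m; exists m.
Qed.

End L2_completeness.

Section real_integrals.
Context (R : realType) d (T : measurableType d) (P : {measure set T -> \bar R}).

Lemma ge0_integral_EFinD (f g : T -> R) :
  measurable_fun setT f -> measurable_fun setT g ->
  (forall w, 0 <= f w) -> (forall w, 0 <= g w) ->
  (\int[P]_w (f w + g w)%:E = \int[P]_w (f w)%:E + \int[P]_w (g w)%:E)%E.
Proof.
move=> mf mg f0 g0; under eq_integral do rewrite EFinD.
by rewrite ge0_integralD//; do ?[by move=> *; rewrite lee_fin]; exact/measurable_EFinP.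
Qed.

Lemma ge0_integral_EFinZ (k : R) (f : T -> R) : 0 <= k ->
  measurable_fun setT f -> (forall w, 0 <= f w) ->
  (\int[P]_w (k * f w)%:E = k%:E * \int[P]_w (f w)%:E)%E.
Proof.
move=> k0 mf f0; under eq_integral do rewrite EFinM.
by rewrite ge0_integralZl//; do ?[by move=> *; rewrite lee_fin]; exact/measurable_EFinP.
Qed.

Lemma ae_ge0_le_integral_EFin (f g : T -> R) :
  measurable_fun setT f -> measurable_fun setT g ->
  (forall w, 0 <= f w) -> (forall w, 0 <= g w) ->
  {ae P, forall w, f w <= g w} ->
  (\int[P]_w (f w)%:E <= \int[P]_w (g w)%:E)%E.
Proof.
move=> mf mg f0 g0 fg; apply: ae_ge0_le_integral => //; do ?[by move=> *; rewrite lee_fin];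
  do ?[exact/measurable_EFinP].
by apply: filterS fg => w h _; rewrite lee_fin.
Qed.

End real_integrals.

Section sections_ae.
Context (R : realType) d (T : measurableType d) (P : probability T R).
Local Notation mu := (@lebesgue_measure R).

(** The null set of the hypothesis depends on s; Tonelli's theorem for |F - G| trades these
    uncountably many null sets for one null set of w. *)
Lemma ae_sections (F G : R -> T -> R) :
  measurable_fun setT (fun z : R * T => F z.1 z.2) ->
  measurable_fun setT (fun z : R * T => G z.1 z.2) ->
  (forall s, {ae P, forall w, F s w = G s w}) ->
  {ae P, forall w, {ae mu, forall s, F s w = G s w}}.
Proof.
move=> mF mG FG.
pose h (z : R * T) := (`|F z.1 z.2 - G z.1 z.2|)%:E.
have mh : measurable_fun setT h.
  apply/measurable_EFinP; apply: (measurableT_comp (@normr_measurable _ setT)).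
  exact: measurable_funB.
have h0 z : (0 <= h z)%E by rewrite lee_fin.
have E0 : (\int[P]_w \int[mu]_s h (s, w) = 0)%E.
  rewrite -(@fubini_tonelli _ _ _ _ _ mu P h mh h0).
  apply: integral0_eq => s _.
  rewrite -(@integral0 _ _ _ P setT).
  apply: ae_eq_integral => //; first exact: (measurable_fun_pair2 s mh).
  by apply: filterS (FG s) => w e _; rewrite /h/= e subrr normr0.
have mI : measurable_fun setT (fun w => \int[mu]_s h (s, w))%E.
  by have := @measurable_fun_fubini_tonelli_G _ _ _ _ _ mu h mh h0.
have I0 w : (0 <= \int[mu]_s h (s, w))%E by exact: integral_ge0.
have : (\int[P]_w `|\int[mu]_s h (s, w)| = 0)%E.
  by rewrite -E0; apply: eq_integral => w _; rewrite gee0_abs.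
move/(ae_eq_integral_abs P measurableT mI).1.
apply: filterS => w /(_ I) /= Iw.
have mhw : measurable_fun setT (fun s => h (s, w)) by exact: (measurable_fun_pair1 w mh).
have : (\int[mu]_s `|h (s, w)| = 0)%E.
  by rewrite -Iw; apply: eq_integral => s _; rewrite gee0_abs.
move/(ae_eq_integral_abs mu measurableT mhw).1.
by apply: filterS => s /(_ I)[] /eqP; rewrite normr_eq0 subr_eq0 => /eqP.
Qed.

End sections_ae.

(** * Limits of sequences with orthogonal increments, bounded in a higher moment *)

Section limit.
Context (R : realType) d (T : measurableType d) (P : probability T R).
Variables (Y : nat -> T -> R) (qs : nat) (B : R).
Hypothesis qs2 : (2 <= qs)%N.
Hypothesis mY : forall n, measurable_fun setT (Y n).
Hypothesis Y0 : forall n w, 0 <= Y n w.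
Hypothesis YB : forall n, (\int[P]_w (Y n w ^+ qs)%:E <= B%:E)%E.
Hypothesis Y_orth : forall N M, (N <= M)%N ->
  (\int[P]_w ((Y M w - Y N w) ^+ 2)%:E + \int[P]_w (Y N w ^+ 2)%:E =
   \int[P]_w (Y M w ^+ 2)%:E)%E.

Lemma sqr_moment_le (A : T -> R) : measurable_fun setT A ->
  (forall w, 0 <= A w) -> (\int[P]_w (A w ^+ qs)%:E <= B%:E)%E ->
  (\int[P]_w (A w ^+ 2)%:E <= (1 + B)%:E)%E.
Proof.
move=> mA A0 AB.
apply: (@le_trans _ _ (\int[P]_w (1 + A w ^+ qs)%:E)%E).
  apply: ae_ge0_le_integral_EFin.
  - exact: measurable_funX.
  - by apply: measurable_funD => //; exact: measurable_funX.
  - by move=> w; rewrite sqr_ge0.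
  - by move=> w; rewrite addr_ge0// exprn_ge0.
  - apply: nearW => w; rewrite -powR_mulrn//.
    by apply: powR_le_1D; rewrite // ltr0n/= ler_nat.
under eq_integral do rewrite EFinD.
rewrite ge0_integralD//.
- by rewrite integral_cst//= probability_setT mule1 EFinD leeD2l.
- by move=> w _; rewrite lee_fin exprn_ge0.
- by apply/measurable_EFinP; exact: measurable_funX.
Qed.

(** By orthogonality the squared distance is the increment of the second moments, a nondecreasing
    sequence bounded by 1 + B. *)
Lemma L2_cauchy (e : R) : 0 < e -> exists N, forall n m, (N <= n)%N -> (n <= m)%N ->
  (\int[P]_w ((Y m w - Y n w) ^+ 2)%:E <= e%:E)%E.
Proof.
move=> e0.
pose I n := (\int[P]_w (Y n w ^+ 2)%:E)%E.
have IB n : (I n <= (1 + B)%:E)%E by exact: sqr_moment_le.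
have I0 n : (0 <= I n)%E by apply: integral_ge0 => w _; rewrite lee_fin sqr_ge0.
have Ifin n : I n \is a fin_num by rewrite ge0_fin_numE// (le_lt_trans (IB n))// ltry.
pose a n := fine (I n).
have aE n : I n = (a n)%:E by rewrite /a fineK.
have D n m : (n <= m)%N -> (\int[P]_w ((Y m w - Y n w) ^+ 2)%:E = (a m - a n)%:E)%E.
  move=> nm; have := Y_orth nm; rewrite -/(I n) -/(I m) aE aE => h.
  by rewrite EFinB -h addeK.
have amono n m : (n <= m)%N -> a n <= a m.
  move=> nm; rewrite -subr_ge0 -lee_fin -D//.
  by apply: integral_ge0 => w _; rewrite lee_fin sqr_ge0.
have hs : has_sup (range a).
  split; first by exists (a 0%N); exists 0%N.
  by exists (1 + B) => _ [n _ <-]; rewrite -lee_fin -aE.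
have [_ [N _ <-] hN] := sup_adherent e0 hs.
exists N => n m Nn nm; rewrite D// lee_fin.
have h1 : a m <= sup (range a) by apply: sup_upper_bound => //; exists m.
have := amono _ _ Nn; lra.
Qed.

Lemma Lq_limit (A : T -> R) (q : R) : 0 < q < qs%:R ->
  measurable_fun setT A -> (forall w, 0 <= A w) ->
  (\int[P]_w (A w ^+ qs)%:E <= B%:E)%E ->
  (forall e : R, 0 < e -> exists N, forall n, (N <= n)%N ->
      (\int[P]_w ((Y n w - A w) ^+ 2)%:E <= e%:E)%E) ->
  forall e : R, 0 < e -> exists N, forall n, (N <= n)%N ->
      (\int[P]_w (`|Y n w - A w| `^ q)%:E <= e%:E)%E.
Proof.
move=> hq mA A0 AB hA e e0.
have B0 : 0 <= B.
  rewrite -lee_fin; apply: le_trans AB.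
  by apply: integral_ge0 => w _; rewrite lee_fin exprn_ge0.
(* The part of the interpolation bound that carries delta then has expectation at most delta (1 + B
   + B) = e / 2. *)
pose delta := e / 2 / (1 + 2 * B).
have d0 : 0 < delta by rewrite !divr_gt0//; lra.
have two0 : 0 < (2 : R) by [].
have [K K0 HK] := powR_interpolation hq two0 d0.
have eK : 0 < e / 2 / K by rewrite !divr_gt0.
have [N hN] := hA _ eK; exists N => n /hN {}hN.
have mD : measurable_fun setT (fun w => Y n w - A w) by exact: measurable_funB.
have mX2 : measurable_fun setT (fun w => K * (Y n w - A w) ^+ 2).
  by apply: measurable_funM => //; exact: measurable_funX.
have mYq : measurable_fun setT (fun w => delta * Y n w ^+ qs).
  by apply: measurable_funM => //; exact: measurable_funX.
have mAq : measurable_fun setT (fun w => delta * A w ^+ qs).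
  by apply: measurable_funM => //; exact: measurable_funX.
have mYA : measurable_fun setT (fun w => delta * Y n w ^+ qs + delta * A w ^+ qs).
  exact: measurable_funD.
have m1 : measurable_fun setT (fun w => delta + (delta * Y n w ^+ qs + delta * A w ^+ qs)).
  exact: measurable_funD.
have Yq0 w : 0 <= delta * Y n w ^+ qs by rewrite mulr_ge0 ?(ltW d0)// exprn_ge0.
have Aq0 w : 0 <= delta * A w ^+ qs by rewrite mulr_ge0 ?(ltW d0)// exprn_ge0.
have X20 w : 0 <= K * (Y n w - A w) ^+ 2 by rewrite mulr_ge0 ?(ltW K0)// sqr_ge0.
apply: (@le_trans _ _ (\int[P]_w ((delta + (delta * Y n w ^+ qs + delta * A w ^+ qs)) +
  K * (Y n w - A w) ^+ 2)%:E)%E).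
  apply: ae_ge0_le_integral_EFin.
  - apply: (measurableT_comp (measurable_powR q)).
    exact: (measurableT_comp (@normr_measurable _ setT)).
  - exact: measurable_funD.
  - by move=> w; rewrite powR_ge0.
  - by move=> w; rewrite !addr_ge0// ltW.
  - apply: nearW => w.
    have := HK _ (normr_ge0 (Y n w - A w)); move/le_trans; apply.
    rewrite powR_mulrn// real_normK ?num_real// lerD2r mulrDr mulr1 -mulrDr lerD2l.
    rewrite ler_wpM2l ?(ltW d0)//.
    (* Both variables are nonnegative, so their distance is at most the larger one. *)
    have [AY|/ltW YA] := leP (A w) (Y n w).
      rewrite ger0_norm ?subr_ge0// (@le_trans _ _ (Y n w ^+ qs))//.
        by apply: lerXn2r; rewrite ?nnegrE ?subr_ge0// lerBlDr lerDl.
      by rewrite lerDl exprn_ge0.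
    rewrite distrC ger0_norm ?subr_ge0// (@le_trans _ _ (A w ^+ qs))//.
      by apply: lerXn2r; rewrite ?nnegrE ?subr_ge0// lerBlDr lerDl.
    by rewrite lerDr exprn_ge0.
rewrite ge0_integral_EFinD//; last by move=> w; rewrite !addr_ge0// ltW.
rewrite ge0_integral_EFinD//; last 2 first.
- by move=> w; rewrite ltW.
- by move=> w; rewrite addr_ge0.
rewrite ge0_integral_EFinD//.
have mXq (V : T -> R) k : measurable_fun setT V -> measurable_fun setT (fun w => V w ^+ k).
  by move=> mV; exact: measurable_funX.
have Xq0 (V : T -> R) : (forall w, 0 <= V w) -> forall w, 0 <= V w ^+ qs.
  by move=> V0 w; rewrite exprn_ge0.
rewrite (ge0_integral_EFinZ _ (ltW d0) (mXq _ _ (mY n)) (Xq0 _ (Y0 n))).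
rewrite (ge0_integral_EFinZ _ (ltW d0) (mXq _ _ mA) (Xq0 _ A0)).
rewrite (ge0_integral_EFinZ _ (ltW K0) (mXq _ _ mD) (fun w => sqr_ge0 _)).
rewrite integral_cst//= probability_setT mule1.
apply: (@le_trans _ _ (delta%:E + (delta%:E * B%:E + delta%:E * B%:E) + K%:E * (e / 2 / K)%:E)%E).
  apply: leeD; [apply: leeD2l; apply: leeD|]; apply: lee_wpmul2l => //; rewrite lee_fin; exact: ltW.
rewrite -!EFinM -!EFinD lee_fin le_eqVlt; apply/orP; left; apply/eqP.
by rewrite /delta; field; rewrite gt_eqF//= gt_eqF//; lra.
Qed.

(* (a + x) ^+ 2 <= (1 + d) a ^+ 2 + (1 + 1 / d) x ^+ 2 for every d > 0 *)
Lemma sqr_limit_ge (A : T -> R) (m : \bar R) : measurable_fun setT A ->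
  (forall w, 0 <= A w) -> (\int[P]_w (A w ^+ qs)%:E <= B%:E)%E ->
  (forall e : R, 0 < e -> exists N, forall n, (N <= n)%N ->
      (\int[P]_w ((Y n w - A w) ^+ 2)%:E <= e%:E)%E) ->
  (forall n, (m <= \int[P]_w (Y n w ^+ 2)%:E)%E) ->
  (m <= \int[P]_w (A w ^+ 2)%:E)%E.
Proof.
move=> mA A0 AB hA hm.
have rB := sqr_moment_le mA A0 AB.
have r0 : (0 <= \int[P]_w (A w ^+ 2)%:E)%E.
  by apply: integral_ge0 => w _; rewrite lee_fin sqr_ge0.
set I := (\int[P]_w (A w ^+ 2)%:E)%E in rB r0 *.
have Ifin : I \is a fin_num by rewrite ge0_fin_numE// (le_lt_trans rB)// ltry.
pose r := fine I; have rE : I = r%:E by rewrite /r fineK.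
have {}r0 : 0 <= r by rewrite -lee_fin -rE.
rewrite rE; apply/lee_addgt0Pr => eta eta0.
pose dl := eta / 2 / (r + 1).
have dl0 : 0 < dl by rewrite !divr_gt0//; lra.
have c0 : 0 < 1 + dl^-1 by rewrite addr_gt0// invr_gt0.
have e0 : 0 < eta / 2 / (1 + dl^-1) by rewrite !divr_gt0.
have [N /(_ N (leqnn N)) hN] := hA _ e0.
have mD : measurable_fun setT (fun w => Y N w - A w) by exact: measurable_funB.
have mD2 : measurable_fun setT (fun w => (Y N w - A w) ^+ 2) by exact: measurable_funX.
have mA2 : measurable_fun setT (fun w => A w ^+ 2) by exact: measurable_funX.
have mcA : measurable_fun setT (fun w => (1 + dl) * A w ^+ 2) by exact: measurable_funM.
have mcD : measurable_fun setT (fun w => (1 + dl^-1) * (Y N w - A w) ^+ 2).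
  exact: measurable_funM.
have d10 : 0 <= 1 + dl by lra.
have cA0 w : 0 <= (1 + dl) * A w ^+ 2 by rewrite mulr_ge0// sqr_ge0.
have cD0 w : 0 <= (1 + dl^-1) * (Y N w - A w) ^+ 2 by rewrite mulr_ge0 ?sqr_ge0// ltW.
apply: (le_trans (hm N)).
apply: (@le_trans _ _
  (\int[P]_w ((1 + dl) * A w ^+ 2 + (1 + dl^-1) * (Y N w - A w) ^+ 2)%:E)%E).
  apply: ae_ge0_le_integral_EFin.
  - exact: measurable_funX.
  - exact: measurable_funD.
  - by move=> w; rewrite sqr_ge0.
  - by move=> w; rewrite addr_ge0.
  - apply: nearW => w; rewrite -subr_ge0.
    rewrite (_ : _ - _ = dl^-1 * (dl * A w - (Y N w - A w)) ^+ 2).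
      by rewrite mulr_ge0 ?sqr_ge0// invr_ge0 ltW.
    by field; rewrite gt_eqF.
rewrite ge0_integral_EFinD//.
rewrite (ge0_integral_EFinZ _ d10 mA2 (fun w => sqr_ge0 _)).
rewrite (ge0_integral_EFinZ _ (ltW c0) mD2 (fun w => sqr_ge0 _)).
rewrite -/I rE.
apply: (@le_trans _ _ ((1 + dl)%:E * r%:E + (1 + dl^-1)%:E * (eta / 2 / (1 + dl^-1))%:E)%E).
  by apply: leeD => //; apply: lee_wpmul2l => //; rewrite lee_fin ltW.
rewrite -!EFinM -!EFinD lee_fin.
rewrite (_ : (1 + dl^-1) * (eta / 2 / (1 + dl^-1)) = eta / 2); last by field; rewrite !gt_eqF//; lra.
suff : dl * r <= eta / 2 by lra.
rewrite /dl -mulrA ler_piMr//; first by lra.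
by rewrite mulrC ler_pdivrMr ?mul1r; lra.
Qed.

Lemma powR_add_le (q x y : R) : 0 < q -> 0 <= x -> 0 <= y ->
  (x + y) `^ q <= 2 `^ q * (x `^ q + y `^ q).
Proof.
move=> q0; wlog xy : x y / x <= y => [hw x0 y0|x0 y0].
  by have [/hw|/ltW /hw] := leP x y; [exact|rewrite (addrC x) (addrC (x `^ q)); exact].
apply: (@le_trans _ _ ((2 * y) `^ q)); first by apply: powR_homo; lra.
by rewrite powRM// ler_wpM2l ?powR_ge0// lerDr powR_ge0.
Qed.

(** Only comparability up to constants is wanted: [powR_add_le], valid for q < 1 too, replaces the
    triangle inequality, and for each bound a single late index n is enough. *)
Lemma Lq_limit_bounds (A : T -> R) (q lo hi : R) n0 : 0 < q ->
  measurable_fun setT A -> (forall w, 0 <= A w) -> 0 < lo -> 0 < hi ->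
  (forall e : R, 0 < e -> exists N, forall n, (N <= n)%N ->
      (\int[P]_w (`|Y n w - A w| `^ q)%:E <= e%:E)%E) ->
  (forall n, (n0 <= n)%N -> (lo%:E <= \int[P]_w (Y n w `^ q)%:E)%E) ->
  (forall n, (n0 <= n)%N -> (\int[P]_w (Y n w `^ q)%:E <= hi%:E)%E) ->
  ((lo / 2 / 2 `^ q)%:E <= \int[P]_w (A w `^ q)%:E)%E /\
  (\int[P]_w (A w `^ q)%:E <= (2 * 2 `^ q * hi)%:E)%E.
Proof.
move=> q0 mA A0 lo0 hi0 hA hlo hhi.
have t0 : 0 < (2 : R) `^ q by exact: powR_gt0.
have mp (V : T -> R) : measurable_fun setT V -> measurable_fun setT (fun w => V w `^ q).
  by move=> mV; apply: (measurableT_comp (measurable_powR q)).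
have mB (U V : T -> R) : measurable_fun setT U -> measurable_fun setT V ->
    measurable_fun setT (fun w => `|U w - V w| `^ q).
  move=> mU mV; apply: mp; apply: (measurableT_comp (@normr_measurable _ setT)).
  exact: measurable_funB.
have tri (U V : T -> R) : measurable_fun setT U -> measurable_fun setT V ->
    (forall w, 0 <= U w) -> (forall w, 0 <= V w) ->
    (\int[P]_w (U w `^ q)%:E <= (2 `^ q)%:E * (\int[P]_w (`|U w - V w| `^ q)%:E +
       \int[P]_w (V w `^ q)%:E))%E.
  move=> mU mV U0 V0.
  have m1 := mB _ _ mU mV; have m2 := mp _ mV.
  have m3 : measurable_fun setT (fun w => `|U w - V w| `^ q + V w `^ q).
    exact: measurable_funD.
  have s0 w : 0 <= `|U w - V w| `^ q + V w `^ q by rewrite addr_ge0 ?powR_ge0.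
  rewrite -(ge0_integral_EFinD _ m1 m2 (fun w => powR_ge0 _ _) (fun w => powR_ge0 _ _)).
  rewrite -(ge0_integral_EFinZ _ (ltW t0) m3 s0).
  apply: ae_ge0_le_integral_EFin.
  - exact: mp.
  - exact: measurable_funM.
  - by move=> w; rewrite powR_ge0.
  - by move=> w; rewrite mulr_ge0// ltW.
  - apply: nearW => w; apply: le_trans (powR_add_le q0 (normr_ge0 _) (V0 w)).
    by apply: powR_homo => //; have := ler_norm (U w - V w); lra.
have E0 (V : T -> R) : (0 <= \int[P]_w (V w `^ q)%:E)%E.
  by apply: integral_ge0 => w _; rewrite lee_fin powR_ge0.
split.
  have e0 : 0 < lo / 2 / 2 `^ q by rewrite !divr_gt0.
  have [N hN] := hA _ e0.
  have := tri _ _ (mY (maxn n0 N)) mA (Y0 _) A0.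
  move/(le_trans (hlo _ (leq_maxl _ _))).
  have {}hN := hN _ (leq_maxr n0 N).
  move: (E0 A); case: (\int[P]_w (A w `^ q)%:E)%E => [x| |]//; last by move=> _ _; rewrite leey.
  rewrite lee_fin => x0 h.
  have : (lo%:E <= (2 `^ q)%:E * ((lo / 2 / 2 `^ q)%:E + x%:E))%E.
    apply: (le_trans h); apply: lee_wpmul2l; first by rewrite lee_fin ltW.
    exact: leeD2r.
  rewrite -EFinD -EFinM !lee_fin mulrDr mulrCA divff ?gt_eqF// mulr1 => k.
  by rewrite ler_pdivrMr// mulrC; lra.
have [N hN] := hA _ hi0.
have := tri _ _ mA (mY (maxn n0 N)) A0 (Y0 _).
move/le_trans; apply.
have {}hN := hN _ (leq_maxr n0 N).
rewrite (_ : 2 * 2 `^ q * hi = 2 `^ q * (hi + hi)); last by ring.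
rewrite EFinM EFinD; apply: lee_wpmul2l; first by rewrite lee_fin ltW.
apply: leeD; last exact: hhi (leq_maxl _ _).
by under eq_integral do rewrite distrC.
Qed.

End limit.

(** * Moments of the finite products *)

Lemma chain_ok_ge0 (R : realType) (lambda p : R) l :
  chain_ok lambda p l -> forall x, x \in l -> 0 <= x.1.
Proof.
elim: l => [//|y l ih] /= [y0 _ _ _ /ih h] x.
by rewrite inE => /predU1P[->//|/h].
Qed.

Section product_moments.
Context (R : realType) d (T : measurableType d) (P : probability T R).
Variables (L : nat -> R -> {RV P >-> R}) (lambda p C b : R) (psi : R -> R).
Local Notation mu := (@lebesgue_measure R).
Hypotheses (lambda_gt0 : 0 < lambda) (p_gt1 : 1 < p) (C_ge0 : 0 <= C).
Hypotheses (psi0 : psi 0 = 0) (psi1 : psi 1 = 0).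
Hypothesis psi_convex : forall x y t, - p <= x <= p -> - p <= y <= p ->
  0 <= t <= 1 -> psi (t * x + (1 - t) * y) <= t * psi x + (1 - t) * psi y.
Hypothesis psi_lip : forall x y, - p <= x <= p -> - p <= y <= p ->
  `|psi x - psi y| <= C * `|x - y|.
Hypotheses (b_gt1 : 1 < b) (slope_lt : expR (slope p psi) < b).
Hypothesis measL : forall j, measurable_process (L j).
Hypothesis indL : mutually_independent P (fun j => sigma_process (L j)).
Hypothesis momL : forall j l, chain_ok lambda p l ->
  (\int[P]_w (\prod_(x <- l) (`|L j x.1 w| `^ x.2))%:E =
   (expR (chain_exponent lambda psi l))%:E)%E.

Lemma levels_integral (ls : nat -> seq (R * R)) N :
  (forall j, chain_ok lambda p (ls j)) ->
  (\int[P]_w (\prod_(j < N) \prod_(x <- ls j) (`|L j x.1 w| `^ x.2))%:E =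
   (expR (\sum_(j < N) chain_exponent lambda psi (ls j)))%:E)%E.
Proof.
move=> okl.
pose G j w := (\prod_(x <- ls j) (`|L j x.1 w| `^ x.2))%:E.
under eq_integral do rewrite -prode_EFin.
rewrite (@integral_mutually_independent _ _ _ P
  (fun j => \bigcup_(t in times R) sigma_rv (L j t)) N G).
- by rewrite expR_sum -prode_EFin; apply: eq_bigr => j _; exact: momL.
- by move=> j; exact: sigma_process_sub.
- exact: indL.
- move=> j; rewrite /G; apply/measurable_EFinP.
  have h := chain_ok_ge0 (okl j).
  apply: measurable_prod => x xl.
  apply: (measurableT_comp (measurable_powR _)).
  apply: (measurableT_comp (@normr_measurable _ setT)).
  by apply: measurable_sigma_process; exact: h.
- by move=> j w; rewrite lee_fin prodr_ge0// => x _; exact: powR_ge0.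
Qed.

Definition scaled (j : nat) (s : seq R) : seq R := [seq x * b ^+ j | x <- s].

Definition anchored (c : R) (s : seq R) := (0, c) :: unit_masses s.

(* The absolute values agree almost surely with the original values at times
   s >= 0, and make the factors nonnegative and jointly measurable on the whole
   of R * T. *)
Definition absL (j : nat) (s : R) (w : T) : R := `|L j `|s| w|.

Definition density (N : nat) (s : R) (w : T) : R :=
  \prod_(j < N) absL j (s * b ^+ j) w.

(* Inserting [weight n c] tilts the first n levels, on which the process is
   nearly constant over a time t with t * b ^+ n <= 1. *)
Definition weight (n : nat) (c : R) (w : T) : R :=
  \prod_(j < n) `|L j 0 w| `^ c.

Lemma b_gt0 : 0 < b. Proof. exact: lt_trans b_gt1. Qed.

Lemma measurable_absL j : measurable_fun setT (fun z : R * T => absL j z.1 z.2).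
Proof.
have mt : measurable (times R `*` [set: T]).
  by apply: measurableX => //; rewrite /times; exact: measurable_itv.
have mpair : measurable_fun [set: R * T] (fun z => (`|z.1|, z.2)).
  apply: measurable_fun_pair; last exact: measurable_snd.
  exact: (measurableT_comp (@normr_measurable _ setT)).
apply: (measurableT_comp (@normr_measurable _ setT)).
apply: (measurable_comp mt _ (measL j) mpair).
by move=> _ [z _ <-]; split => //=; rewrite /times/= in_itv/= andbT.
Qed.

Lemma measurable_density N : measurable_fun setT (fun z : R * T => density N z.1 z.2).
Proof.
apply: measurable_prod => j _.
have mpair : measurable_fun [set: R * T] (fun z => (z.1 * b ^+ j, z.2)).
  by apply: measurable_fun_pair => //; exact: measurable_funM.
exact: (measurableT_comp (measurable_absL j) mpair).
Qed.

Lemma density_ge0 N s w : 0 <= density N s w.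
Proof. by apply: prodr_ge0 => j _; exact: normr_ge0. Qed.

Lemma weight_ge0 n c w : 0 <= weight n c w.
Proof. by apply: prodr_ge0 => j _; exact: powR_ge0. Qed.

Lemma measurable_weight n c : measurable_fun setT (weight n c).
Proof.
apply: measurable_prod => j _; apply: (measurableT_comp (measurable_powR _)).
by apply: (measurableT_comp (@normr_measurable _ setT)); exact: measurable_funPT.
Qed.

Lemma densityE N s w : 0 <= s ->
  density N s w = \prod_(j < N) (`|L j (s * b ^+ j) w| `^ 1).
Proof.
move=> s0; apply: eq_bigr => j _; rewrite /absL powRr1//.
by rewrite (ger0_norm (_ : 0 <= s * b ^+ j))// mulr_ge0// exprn_ge0// ltW// b_gt0.
Qed.

Lemma sorted_scaled j s : sorted <=%R s -> sorted <=%R (scaled j s).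
Proof.
move=> ss; rewrite sorted_map; apply: sub_sorted ss => x y xy /=.
by rewrite ler_wpM2r// exprn_ge0// ltW// b_gt0.
Qed.

Lemma all_ge0_scaled j s : all (fun x => 0 <= x) s -> all (fun x => 0 <= x) (scaled j s).
Proof.
move=> s0; rewrite all_map; apply: sub_all s0 => x x0 /=.
by rewrite mulr_ge0// exprn_ge0// ltW// b_gt0.
Qed.

Lemma chain_ok_scaled j s : sorted <=%R s -> all (fun x => 0 <= x) s ->
  (size s)%:R <= p -> chain_ok lambda p (unit_masses (scaled j s)).
Proof.
move=> ss s0 sp; apply: chain_ok_unit => //; first exact: sorted_scaled.
- exact: all_ge0_scaled.
- by rewrite size_map.
Qed.

Lemma chain_ok_anchored j c s : sorted <=%R s -> all (fun x => 0 <= x) s ->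
  (size s)%:R <= p -> - p <= c -> c + (size s)%:R <= p ->
  chain_ok lambda p (anchored c (scaled j s)).
Proof.
move=> ss s0 sp c1 c2.
have s0' := all_ge0_scaled j s0.
have := discounted_unit_bounds lambda_gt0 p_gt1 C_ge0 s0'; rewrite size_map => /andP[d0 d1].
have p_gt1' := p_gt1.
split => //=.
- by rewrite all_map.
- by apply/andP; split; lra.
- by apply/andP; split; lra.
- exact: chain_ok_scaled.
Qed.

Lemma mixed_moment n N c s : (n <= N)%N -> sorted <=%R s ->
  all (fun x => 0 <= x) s ->
  (size s)%:R <= p -> - p <= c -> c + (size s)%:R <= p ->
  (\int[P]_w (weight n c w * \prod_(x <- s) density N x w)%:E =
   (expR (\sum_(j < N) if (j < n)%N
      then chain_exponent lambda psi (anchored c (scaled j s))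
      else chain_exponent lambda psi (unit_masses (scaled j s))))%:E)%E.
Proof.
move=> nN ss s0 sp c1 c2.
pose ls j := if (j < n)%N then anchored c (scaled j s) else unit_masses (scaled j s).
have okl j : chain_ok lambda p (ls j).
  by rewrite /ls; case: ifP => _; [exact: chain_ok_anchored|exact: chain_ok_scaled].
have := levels_integral N okl.
under [in X in _ = X -> _]eq_bigr do rewrite /ls (fun_if (chain_exponent lambda psi)).
move=> <-; apply: eq_integral => w _; congr EFin.
transitivity (\prod_(j < N) ((if (j < n)%N then `|L j 0 w| `^ c else 1) *
    \prod_(x <- unit_masses (scaled j s)) (`|L j x.1 w| `^ x.2))); last first.
  apply: eq_bigr => j _; rewrite /ls; case: ifP => _; last by rewrite mul1r.
  by rewrite /anchored big_cons.
rewrite big_split/=; congr (_ * _).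
  rewrite /weight (big_ord_widen N (fun j => `|L j 0 w| `^ c))//.
  by rewrite [LHS]big_mkcond.
transitivity (\prod_(x <- s) \prod_(j < N) (`|L j (x * b ^+ j) w| `^ 1)).
  rewrite big_seq [RHS]big_seq; apply: eq_bigr => x xs.
  by apply: densityE; exact: (allP s0).
rewrite exchange_big/=; apply: eq_bigr => j _.
by rewrite !big_map.
Qed.

Lemma expb_gt0 j : 0 < b ^+ j. Proof. by rewrite exprn_gt0// b_gt0. Qed.

Lemma expb_ge0 j : 0 <= b ^+ j. Proof. exact: ltW (expb_gt0 j). Qed.

(* The total error, over these first n levels, of replacing each factor by its
   value at time 0. *)
Definition distortion := 3 * (C * p * lambda) / (b - 1).

Lemma sum_pow_le n : \sum_(j < n) b ^+ j <= b ^+ n / (b - 1).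
Proof.
rewrite ler_pdivlMr ?subr_gt0// mulrC -subrX1.
by rewrite lerBlDr lerDl.
Qed.

(** The error at level j is of order t b^j. The sum is geometric and of the order of t b^n <= 1,
    hence bounded uniformly in n. *)
Lemma anchored_sum_near n c s t : sorted <=%R s ->
  all (fun x => 0 <= x <= t) s -> (size s)%:R <= p -> - p <= c ->
  c + (size s)%:R <= p -> 0 <= t -> t * b ^+ n <= 1 ->
  `|\sum_(j < n) chain_exponent lambda psi (anchored c (scaled j s)) -
    n%:R * psi (c + (size s)%:R)| <= distortion.
Proof.
move=> ss sI sp c1 c2 t0 tb; have b0 := b_gt0.
have -> : n%:R * psi (c + (size s)%:R) = \sum_(j < n) psi (c + (size s)%:R).
  by rewrite sumr_const card_ord mulr_natl.
rewrite -sumrB; apply: (le_trans (ler_norm_sum _ _ _)).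
apply: (@le_trans _ _ (\sum_(j < n) 3 * (C * p * lambda) * t * b ^+ j)).
  apply: ler_sum => j _.
  have := @chain_exponent_near _ lambda p C psi lambda_gt0 p_gt1 C_ge0 psi0 psi1
    psi_lip c (scaled j s) (t * b ^+ j).
  rewrite size_map => h; apply: (le_trans (h _ _ _ _ _ _)) => //.
  - exact: sorted_scaled.
  - rewrite all_map; apply: sub_all sI => x /andP[x0 xt] /=.
    by rewrite mulr_ge0 ?expb_ge0// ler_wpM2r// expb_ge0.
  - by rewrite mulr_ge0// expb_ge0.
  - by rewrite !mulrA.
rewrite -mulr_sumr /distortion; set K := 3 * _.
have K0 : 0 <= K by rewrite !mulr_ge0// ltW// (lt_trans _ p_gt1).
rewrite -(mulrA K) ler_wpM2l//.
apply: (@le_trans _ _ (t * (b ^+ n / (b - 1)))).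
  by rewrite ler_wpM2l// sum_pow_le.
by rewrite mulrA ler_piMl// invr_ge0 subr_ge0 ltW.
Qed.

Lemma gaps_scaled j (s : seq R) : gaps (scaled j s) = [seq g * b ^+ j | g <- gaps s].
Proof.
case: s => [//|x s] /=; elim: s x => [//|y s ih] x /=.
by rewrite mulrBl ih.
Qed.

Lemma gaps_bounds (s : seq R) (t : R) : sorted <=%R s -> all (fun x => 0 <= x <= t) s ->
  all (fun g => 0 <= g <= t) (gaps s).
Proof.
case: s => [//|x s] /=; elim: s x => [//|y s ih] x /=.
move=> /andP[xy ss] /andP[/andP[x0 xt] /andP[/andP[y0 yt] sI]].
rewrite subr_ge0 xy /= ih ?y0 ?yt// andbT lerBlDr.
by rewrite (le_trans yt)// lerDl.
Qed.

(** Seen from level n, the points multiplied by b^n lie in [0, 1] and the remaining levels start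
    again from 0. *)
Lemma tail_le n M s t : sorted <=%R s -> all (fun x => 0 <= x <= t) s ->
  (size s)%:R <= p -> t * b ^+ n <= 1 ->
  expR (\sum_(i < M.+1) chain_exponent lambda psi (unit_masses (scaled (n + i) s)))
  <= \prod_(g <- gaps s) level_step lambda p C psi b M (g * b ^+ n).
Proof.
move=> ss sI sp tb; have b0 := b_gt0.
have gI := gaps_bounds ss sI.
apply: (@le_trans _ _ (expR (\sum_(g <- gaps s) \sum_(i < M.+1)
    hbound p C psi (expR (- lambda * (b ^+ i * (g * b ^+ n))))))).
  rewrite ler_expR exchange_big/=; apply: ler_sum => i _.
  have s0 : all (fun x => 0 <= x) s by apply: sub_all sI => x /andP[].
  have := @chain_exponent_unit_le _ lambda p C psi lambda_gt0 p_gt1 C_ge0 psi0 psi1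
    psi_convex psi_lip (scaled (n + i) s).
  rewrite size_map gaps_scaled big_map => /(_ (sorted_scaled _ ss) sp)/le_trans; apply.
  rewrite le_eqVlt; apply/orP; left; apply/eqP; apply: eq_bigr => g _.
  by rewrite exprD; congr (hbound _ _ _ (expR _)); ring.
rewrite expR_sum big_seq [leRHS]big_seq; apply: ler_prod => g gs.
rewrite expR_ge0/=; apply: level_step_ge => //.
have /andP[g0 gt] := allP gI g gs.
by rewrite mulr_ge0 ?expb_ge0//= (le_trans _ tb)// ler_wpM2r// expb_ge0.
Qed.

Lemma mixed_moment_le n M c s t : sorted <=%R s ->
  all (fun x => 0 <= x <= t) s -> (size s)%:R <= p -> - p <= c ->
  c + (size s)%:R <= p -> 0 <= t -> t * b ^+ n <= 1 ->
  (\int[P]_w (weight n c w * \prod_(x <- s) density (n + M.+1) x w)%:E <=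
   (expR (n%:R * psi (c + (size s)%:R) + distortion) *
    \prod_(g <- gaps s) level_step lambda p C psi b M (g * b ^+ n))%:E)%E.
Proof.
move=> ss sI sp c1 c2 t0 tb.
rewrite mixed_moment// ?leq_addr//; last by apply: sub_all sI => x /andP[].
rewrite lee_fin big_split_ord/= expRD; apply: ler_pM; rewrite ?expR_ge0//.
  rewrite ler_expR (eq_bigr (fun j : 'I_n =>
    chain_exponent lambda psi (anchored c (scaled j s)))); last first.
    by move=> j _; rewrite ltn_ord.
  have := anchored_sum_near ss sI sp c1 c2 t0 tb.
  by rewrite ler_norml => /andP[_]; rewrite lerBlDl.
apply: le_trans (tail_le M ss sI sp tb).
rewrite ler_expR; apply: ler_sum => i _.
by rewrite ltnNge leq_addr.
Qed.

(** The sum over k of the coefficients of [level_step] times b^-k, a geometric series of ratio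
    e^slope / b. Here the condition on b makes the integral over a gap bounded uniformly in the
    number of levels. *)
Definition level_mass :=
  expR (slope p psi + level_const lambda p C psi b) *
  (b / expR (slope p psi) / (b / expR (slope p psi) - 1)).

Lemma level_mass_ge0 : 0 <= level_mass.
Proof.
have e1 : 1 < b / expR (slope p psi) by rewrite ltr_pdivlMr ?mul1r ?expR_gt0.
rewrite /level_mass mulr_ge0 ?expR_ge0// divr_ge0//; lra.
Qed.

Lemma level_step_ge0 M x : 0 <= level_step lambda p C psi b M x.
Proof. by apply: sumr_ge0 => k _; rewrite mulr_ge0// expR_ge0. Qed.

Lemma measurable_level_step M n :
  measurable_fun setT (fun x : R => level_step lambda p C psi b M (x * b ^+ n)).
Proof.
apply: measurable_sum => k; apply: measurable_funM => //.
apply: (@measurableT_comp _ _ _ _ _ _ (fun b : bool => b%:R : R)) => //.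
apply: measurable_fun_ler => //; apply: measurable_funM => //.
exact: measurable_funM.
Qed.

Lemma integral_level_step_le M n x : 0 <= x ->
  (\int[mu]_u ((level_step lambda p C psi b M ((x - u) * b ^+ n))%:E * before x u)
   <= (level_mass * b ^- n)%:E)%E.
Proof.
move=> x0; have b0 := b_gt0.
pose e k := expR (slope p psi * k.+1%:R + level_const lambda p C psi b).
pose B k (u : R) := ((b ^+ k * ((x - u) * b ^+ n) <= 1)%R%:R : R)%:E.
have mB k : measurable_fun setT (fun u => (B k u * before x u)%E).
  apply: emeasurable_funM; last by apply: measurable_before => //; exact: measurable_cst.
  apply/measurable_EFinP.
  apply: (@measurableT_comp _ _ _ _ _ _ (fun b : bool => b%:R : R)) => //.
  apply: measurable_fun_ler => //; apply: measurable_funM => //.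
  by apply: measurable_funM => //; exact: measurable_funB.
have B0 k u : (0 <= B k u * before x u)%E.
  by rewrite mule_ge0 ?before_ge0// lee_fin.
have intB k : (\int[mu]_u (B k u * before x u) <= (b ^- n * b ^- k)%:E)%E.
  apply: (@le_trans _ _ (\int[mu]_(u in `[(x - b ^- n * b ^- k)%R, x]) cst 1 u)%E).
    rewrite [leRHS]integral_mkcond; apply: ge0_le_integral => //.
    - exact: mB.
    - by apply/(measurable_restrictT _ (measurable_itv _)); exact: measurable_cst.
    - move=> u _; rewrite /B /before -EFinM patchE mem_setE in_itv/=.
      have [h|] := boolP (b ^+ k * ((x - u) * b ^+ n) <= 1)%R; last first.
        by rewrite mul0r; case: ifP.
      have [/andP[u0 ux]|] := boolP ((0 <= u) && (u <= x))%R; last first.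
        by rewrite mulr0; case: ifP.
      rewrite mulr1 ux andbT lerBlDr -lerBlDl.
      suff -> : x - u <= b ^- n * b ^- k by [].
      rewrite -invfM -[leRHS]mul1r ler_pdivlMr ?mulr_gt0 ?expb_gt0//.
      by rewrite (_ : (x - u) * _ = b ^+ k * ((x - u) * b ^+ n)); last by ring.
  rewrite integral_cst//= mul1e lebesgue_measure_itv/= lte_fin.
  have bb : 0 <= b ^- n * b ^- k by rewrite mulr_ge0// invr_ge0 expb_ge0.
  by case: ifP => _; rewrite -?EFinB lee_fin//; lra.
have -> : (\int[mu]_u ((level_step lambda p C psi b M ((x - u) * b ^+ n))%:E * before x u) =
  \sum_(k < M.+1) (e k)%:E * \int[mu]_u (B k u * before x u))%E.
  transitivity (\int[mu]_u (\sum_(k < M.+1) (e k)%:E * (B k u * before x u)))%E.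
    apply: eq_integral => u _; rewrite /level_step -sumEFin ge0_sume_distrl; last first.
      by move=> k _; rewrite lee_fin mulr_ge0// expR_ge0.
    by apply: eq_bigr => k _; rewrite EFinM muleA.
  rewrite ge0_integral_sum//.
  - apply: eq_bigr => k _; rewrite ge0_integralZl//; first exact: mB.
    by rewrite lee_fin expR_ge0.
  - by move=> k; apply: measurable_funeM; exact: mB.
  - by move=> k u _; rewrite mule_ge0// lee_fin expR_ge0.
apply: (@le_trans _ _ (\sum_(k < M.+1) (e k * (b ^- n * b ^- k))%:E)%E).
  by apply: lee_sum => k _; rewrite EFinM lee_wpmul2l// lee_fin expR_ge0.
rewrite sumEFin lee_fin.
pose es := expR (slope p psi).
have es0 : 0 < es by exact: expR_gt0.
have eb : 1 < b / es by rewrite ltr_pdivlMr// mul1r.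
have -> : \sum_(k < M.+1) e k * (b ^- n * b ^- k) =
    expR (slope p psi + level_const lambda p C psi b) * b ^- n *
    \sum_(k < M.+1) (b / es)^-1 ^+ k.
  rewrite mulr_sumr; apply: eq_bigr => k _.
  rewrite /e -natr1 mulrDr mulr1 -addrA expRD invfM invrK exprMn exprVn /es.
  by rewrite expRM_natr; ring.
rewrite /level_mass -/es mulrAC; apply: ler_wpM2r; first by rewrite invr_ge0 expb_ge0.
by apply: ler_wpM2l; [exact: expR_ge0|exact: geometric_sum_le].
Qed.

Definition edensity (N : nat) (s : R) (w : T) : \bar R := (density N s w)%:E.

Definition mass (N : nat) (t : R) (w : T) : \bar R := iter_int (edensity N) 1 t w.

Lemma measurable_edensity N : measurable_fun setT (fun z : R * T => edensity N z.1 z.2).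
Proof. by apply/measurable_EFinP; exact: measurable_density. Qed.

Lemma edensity_ge0 N s w : (0 <= edensity N s w)%E.
Proof. by rewrite lee_fin density_ge0. Qed.

Lemma mass_ge0 N t w : (0 <= mass N t w)%E.
Proof. by apply: iter_int_ge0 => s v; exact: edensity_ge0. Qed.

Lemma measurable_eweight n c : measurable_fun setT (fun w => (weight n c w)%:E).
Proof. by apply/measurable_EFinP; exact: measurable_weight. Qed.

Lemma measurable_mass N t : measurable_fun setT (mass N t).
Proof.
have h := measurable_iter_int (measurable_edensity N) (edensity_ge0 N) 1.
by apply: (measurable_comp_pair h (x := fun=> t) (y := id)).
Qed.

Lemma emeasurable_exp (g : T -> \bar R) k : measurable_fun setT g ->
  measurable_fun setT (fun w => (g w ^+ k)%E).
Proof.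
move=> mg; elim: k => [|k ih]; first exact: measurable_cst.
by under eq_fun do rewrite expeS; exact: emeasurable_funM.
Qed.

(** The power is at most qs! times the integral over the simplex, whose k gaps cost [level_mass]
    b^-n each; c <= 0 keeps c + p within the range of psi. *)
Lemma weighted_power_le n M c t k (qs : nat) : p = qs%:R -> qs = k.+1 ->
  0 <= t -> t * b ^+ n <= 1 -> - p <= c <= 0 ->
  (\int[P]_w ((weight n c w)%:E * mass (n + M.+1) t w ^+ qs) <=
   (qs`!%:R * (expR (n%:R * psi (c + p) + distortion) *
    (level_mass * b ^- n) ^+ k * t))%:E)%E.
Proof.
move=> pq qk t0 tb /andP[c1 c2]; set N := (n + M.+1)%N.
have me := measurable_edensity N; have e0 := edensity_ge0 N.
have mI j : measurable_fun setT (iter_int (edensity N) j t).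
  by apply: (measurable_comp_pair (measurable_iter_int me e0 j) (x := fun=> t) (y := id)).
have mw := measurable_eweight n c.
have w0 w : (0 <= (weight n c w)%:E)%E by rewrite lee_fin weight_ge0.
have I0 j w : (0 <= iter_int (edensity N) j t w)%E by exact: iter_int_ge0.
apply: (@le_trans _ _ (\int[P]_w (qs`!%:R%:E * ((weight n c w)%:E * iter_int (edensity N) qs t w)))%E).
  apply: ge0_le_integral => //.
  - by move=> w _; rewrite mule_ge0// expe_ge0// mass_ge0.
  - by apply: emeasurable_funM => //; apply: emeasurable_exp; exact: measurable_mass.
  - by apply: measurable_funeM; exact: emeasurable_funM.
  - move=> w _; rewrite muleCA; apply: lee_wpmul2l => //.
    exact: iter_int_exp.
rewrite ge0_integralZl//; last 2 first.
- exact: emeasurable_funM.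
- by move=> w _; rewrite mule_ge0.
rewrite [leRHS]EFinM; apply: lee_wpmul2l => //.
apply: (@expectation_iter_int_le _ _ _ P (edensity N) _ me e0 mw w0 qs t
  (expR (n%:R * psi (c + p) + distortion)) (level_mass * b ^- n)
  (fun x => level_step lambda p C psi b M (x * b ^+ n))) => //.
- by rewrite mulr_ge0 ?level_mass_ge0// invr_ge0 expb_ge0.
- by move=> x; exact: level_step_ge0.
- exact: measurable_level_step.
- by move=> x /andP[x0 xt]; exact: integral_level_step_le.
- move=> s ss sI sq.
  have cp : c + p <= p by rewrite gerDr.
  have := @mixed_moment_le n M c s t ss sI.
  rewrite sq -pq => /(_ (lexx p) c1 cp t0 tb).
  rewrite [X in _ -> (X <= _)%E](eq_integral
    (fun w => (weight n c w * \prod_(x <- s) density N x w)%:E))//.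
  by move=> w _; rewrite EFinM /edensity prode_EFin.
Qed.

Lemma chain_exponent_single x : chain_exponent lambda psi (unit_masses [:: x]) = 0.
Proof. by rewrite /= /discounted big_nil !addr0 psi1 psi0 subrr. Qed.

(** With a single point the levels from n on have mean 1, since psi 1 = 0; only the tilted levels
    remain, each contributing about psi (c + 1). *)
Lemma weighted_mean n N c t : (n <= N)%N -> 0 <= t -> t * b ^+ n <= 1 ->
  - p <= c -> c + 1 <= p ->
  ((expR (n%:R * psi (c + 1) - distortion) * t)%:E <=
    \int[P]_w ((weight n c w)%:E * mass N t w))%E /\
  (\int[P]_w ((weight n c w)%:E * mass N t w) <=
    (expR (n%:R * psi (c + 1) + distortion) * t)%:E)%E.
Proof.
move=> nN t0 tb c1 c2.
have me := measurable_edensity N; have e0 := edensity_ge0 N.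
have w0 w : (0 <= (weight n c w)%:E)%E by rewrite lee_fin weight_ge0.
have := expectation_iter_intS P me e0 (measurable_eweight n c) w0 0 t
  (measurable_cst (1%E : \bar R)) (fun=> lee01).
under eq_integral do rewrite mule1.
rewrite -/(mass N t _) => ->.
pose sgm u := \sum_(j < N) (if (j < n)%N
  then chain_exponent lambda psi (anchored c (scaled j [:: u]))
  else chain_exponent lambda psi (unit_masses (scaled j [:: u]))).
have p1 : (size [:: 0 : R])%:R <= p by rewrite /= ltW.
have uE u : 0 <= u <= t -> (\int[P]_w ((weight n c w)%:E * (edensity N u w * 1)) =
    (expR (sgm u))%:E)%E.
  move=> /andP[u0 ut].
  have := @mixed_moment n N c [:: u] nN isT; rewrite /= u0 => /(_ isT p1 c1 c2) <-.
  by apply: eq_integral => w _; rewrite mule1 big_seq1.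
have sgmE u : 0 <= u <= t -> `|sgm u - n%:R * psi (c + 1)| <= distortion.
  move=> /andP[u0 ut].
  have := @anchored_sum_near n c [:: u] t isT; rewrite /= u0 ut.
  move=> /(_ isT p1 c1 c2 t0 tb); congr (`|_ - _| <= _).
  rewrite /sgm -(subnKC nN) big_split_ord/= [X in _ = _ + X]big1 ?addr0.
    by apply: eq_bigr => j _; rewrite ltn_ord.
  by move=> j _; rewrite ltnNge leq_addr; exact: chain_exponent_single.
have mI : measurable_fun setT (fun u =>
    \int[P]_w ((weight n c w)%:E * (edensity N u w * 1)))%E.
  have := measurable_expectation_iter_int P me e0 (measurable_eweight n c) w0 0
    (measurable_cst (1%E : \bar R)) (fun=> lee01).
  by under eq_fun do under eq_integral do rewrite mule1.
have mb : measurable_fun setT (before t) by apply: measurable_before => //; exact: measurable_cst.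
have I0 u : (0 <= \int[P]_w ((weight n c w)%:E * (edensity N u w * 1)) * before t u)%E.
  by rewrite mule_ge0 ?before_ge0//; apply: integral_ge0 => w _; rewrite !mule_ge0.
have bt : (\int[mu]_u before t u = t%:E)%E.
  have := integral_before (fun=> 1%E) t.
  rewrite integral_cst//= mul1e lebesgue_measure_itv/=.
  under [in X in _ = X -> _]eq_integral do rewrite mul1e.
  move=> <-; rewrite lte_fin; case: ltP => [|t0']; rewrite ?sube0//.
  by congr EFin; apply/eqP; rewrite eq_le t0.
have cE (x : R) : 0 <= x -> (x * t)%:E = (\int[mu]_u (x%:E * before t u))%E.
  by move=> x0; rewrite ge0_integralZl ?bt ?EFinM// => u _; exact: before_ge0.
have -> : (\int[mu]_u (\int[P]_w ((weight n c w)%:E * iter_int (edensity N) 0 u w *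
      (edensity N u w * cst 1 w)) * before t u) =
    \int[mu]_u (\int[P]_w ((weight n c w)%:E * (edensity N u w * 1)) * before t u))%E.
  apply: eq_integral => u _; congr (_ * _)%E; apply: eq_integral => w _.
  by rewrite [iter_int _ 0 _ _]/= !mule1.
split; rewrite cE ?expR_ge0//; apply: ge0_le_integral => //.
- by move=> u _; rewrite mule_ge0 ?before_ge0// lee_fin expR_ge0.
- exact: measurable_funeM.
- exact: emeasurable_funM.
- move=> u _; have [h|/negbTE nh] := boolP ((0 <= u) && (u <= t)); last first.
    by rewrite /before nh !mule0.
  rewrite uE// lee_wpmul2r ?before_ge0// lee_fin ler_expR.
  by have := sgmE u h; rewrite ler_norml => /andP[+ _]; rewrite lerBrDl.
- exact: emeasurable_funM.
- exact: measurable_funeM.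
- move=> u _; have [h|/negbTE nh] := boolP ((0 <= u) && (u <= t)); last first.
    by rewrite /before nh !mule0.
  rewrite uE// lee_wpmul2r ?before_ge0// lee_fin ler_expR.
  by have := sgmE u h; rewrite ler_norml => /andP[_]; rewrite lerBlDl.
Qed.

Lemma weight_moment n c : - p <= c <= p ->
  (\int[P]_w (weight n c w)%:E = (expR (n%:R * psi c))%:E)%E.
Proof.
move=> /andP[c1 c2].
have := @mixed_moment n n c [::] (leqnn n) isT isT.
rewrite addr0 => /(_ (ltW (lt_trans ltr01 p_gt1)) c1 c2).
under eq_integral do rewrite big_nil mulr1.
move=> ->; congr (expR _)%:E.
rewrite (eq_bigr (fun=> psi c)); first by rewrite sumr_const card_ord mulr_natl.
by move=> j _; rewrite ltn_ord /= /discounted big_nil !addr0 psi0 subr0.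
Qed.

Definition sorted_pair (s u : R) : seq R := if s <= u then [:: s; u] else [:: u; s].

Definition pair_exponent (N : nat) (s u : R) : R :=
  \sum_(j < N) chain_exponent lambda psi (unit_masses (scaled j (sorted_pair s u))).

Lemma sorted_sorted_pair s u : sorted <=%R (sorted_pair s u).
Proof. by rewrite /sorted_pair; case: (leP s u) => [|/ltW] h /=; rewrite h. Qed.

Lemma big_sorted_pair (F : R -> R) s u :
  \prod_(x <- sorted_pair s u) F x = F s * F u.
Proof.
by rewrite /sorted_pair; case: ifP => _; rewrite !big_cons big_nil mulr1// mulrC.
Qed.

(** With r = e^(- lambda (y - x)) the exponent is psi (1 + r) - psi r, where psi is nonnegative at 1
    + r and nonpositive at r. This makes M(1, 1; u - w) - 1 nonnegative. *)
Lemma chain_exponent_pair_ge0 (x y : R) : 2 <= p -> x <= y ->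
  0 <= chain_exponent lambda psi (unit_masses [:: x; y]).
Proof.
move=> p2 xy; have xy0 : 0 <= y - x by rewrite subr_ge0.
have [r0 r1 _] := decay_bounds lambda_gt0 xy0.
rewrite /= /discounted big_seq1 big_nil !addr0 mul1r psi1 psi0 subr0 addr0.
set r := expR _ in r0 r1 *.
rewrite subr_ge0; apply: (@le_trans _ _ 0).
  by apply: (psi_le0 lambda_gt0 p_gt1 C_ge0 psi0 psi1 psi_convex); rewrite ltW.
apply: (psi_ge0 lambda_gt0 p_gt1 C_ge0 psi0 psi1 psi_convex).
by apply/andP; split; lra.
Qed.

(** Levels from N on see the point u alone and have mean 1, so the value does not depend on M; this
    is the source of the martingale property. *)
Lemma integral_density_pair N M s u : (N <= M)%N -> 0 <= s -> 0 <= u -> 2 <= p ->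
  (\int[P]_w (edensity N s w * edensity M u w) = (expR (pair_exponent N s u))%:E)%E.
Proof.
move=> NM s0 u0 p2.
pose ls j := unit_masses (scaled j (if (j < N)%N then sorted_pair s u else [:: u])).
have okl j : chain_ok lambda p (ls j).
  apply: chain_ok_scaled.
  - by case: ifP => // _; exact: sorted_sorted_pair.
  - by case: ifP => _; rewrite ?/sorted_pair; [case: ifP => _|]; rewrite /= ?s0 ?u0.
  - case: ifP => _; rewrite ?/sorted_pair; [by case: ifP => _|].
    by rewrite /= ltW.
have := levels_integral M okl.
have -> : \sum_(j < M) chain_exponent lambda psi (ls j) = pair_exponent N s u.
  rewrite -(subnKC NM) big_split_ord/= [X in _ + X]big1 ?addr0.
    by apply: eq_bigr => j _; rewrite /ls ltn_ord.
  by move=> j _; rewrite /ls ltnNge leq_addr; exact: chain_exponent_single.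
move=> <-; apply: eq_integral => w _; rewrite -EFinM; congr EFin.
rewrite !densityE// (big_ord_widen M (fun j => `|L j (s * b ^+ j) w| `^ 1))//.
rewrite big_mkcond -big_split/=; apply: eq_bigr => j _.
rewrite !big_map; case: ifP => _; last by rewrite big_seq1 mul1r.
by rewrite big_sorted_pair.
Qed.

Lemma integral_mass_mass N M t : (N <= M)%N -> 2 <= p -> 0 <= t ->
  (\int[P]_w (mass N t w * mass M t w) =
   \int[mu]_u ((\int[mu]_s ((expR (pair_exponent N s u))%:E * before t s)) * before t u))%E.
Proof.
move=> NM p2 t0.
have e0 k := edensity_ge0 k; have me k := measurable_edensity k.
have := expectation_iter_intS P (me M) (e0 M) (measurable_cst (1%E : \bar R)) (fun=> lee01) 0 t
  (measurable_mass N t) (mass_ge0 N t).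
move=> h; transitivity (\int[P]_w (cst 1 w * iter_int (edensity M) 1 t w * mass N t w))%E.
  by apply: eq_integral => w _; rewrite mul1e muleC.
rewrite h {h}; apply: eq_integral => u _.
have [/andP[u0 ut]|/negbTE nu] := boolP ((0 <= u) && (u <= t)); last first.
  by rewrite /before nu !mule0.
congr (_ * _)%E.
have mMu : measurable_fun setT (edensity M u) by exact: measurable_fl.
have := expectation_iter_intS P (me N) (e0 N) mMu (e0 M u) 0 t
  (measurable_cst (1%E : \bar R)) (fun=> lee01).
move=> h; transitivity (\int[P]_w (edensity M u w * iter_int (edensity N) 1 t w * cst 1 w))%E.
  by apply: eq_integral => w _; rewrite [iter_int _ 0 _ _]/= !mul1e mule1.
rewrite h {h}; apply: eq_integral => s _.
have [/andP[s0 st]|/negbTE ns] := boolP ((0 <= s) && (s <= t)); last first.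
  by rewrite /before ns !mule0.
congr (_ * _)%E; rewrite -(integral_density_pair NM s0 u0 p2).
by apply: eq_integral => w _; rewrite [iter_int _ 0 _ _]/= !mule1 muleC.
Qed.

Lemma integral_before_cst t : 0 <= t -> (\int[mu]_u before t u = t%:E)%E.
Proof.
move=> t0; have := integral_before (fun=> 1%E) t.
rewrite integral_cst//= mul1e lebesgue_measure_itv/=.
under [in X in _ = X -> _]eq_integral do rewrite mul1e.
move=> <-; rewrite lte_fin; case: ltP => [|t0']; rewrite ?sube0//.
by congr EFin; apply/eqP; rewrite eq_le t0.
Qed.

Lemma integral_mass N t : 0 <= t -> (\int[P]_w mass N t w = t%:E)%E.
Proof.
move=> t0.
have me := measurable_edensity N; have e0 := edensity_ge0 N.
have := expectation_iter_intS P me e0 (measurable_cst (1%E : \bar R)) (fun=> lee01) 0 t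
  (measurable_cst (1%E : \bar R)) (fun=> lee01).
move=> h; transitivity (\int[P]_w (cst 1 w * iter_int (edensity N) 1 t w * cst 1 w))%E.
  by apply: eq_integral => w _; rewrite mul1e mule1.
rewrite h {h} -(integral_before_cst t0); apply: eq_integral => u _.
have [/andP[u0 ut]|/negbTE nu] := boolP ((0 <= u) && (u <= t)); last first.
  by rewrite /before nu !mule0.
rewrite -[RHS]mul1e; congr (_ * _)%E.
have p1 := ltW p_gt1; have p0 : - p <= 0 by rewrite oppr_le0 (le_trans ler01).
have := @mixed_moment 0 N 0 [:: u] (leq0n N) isT.
rewrite /= u0 add0r => /(_ isT p1 p0 p1).
rewrite big1 ?expR0; last by move=> j _; exact: chain_exponent_single.
move=> E1; apply: etrans E1; apply: eq_integral => w _.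
by rewrite !mule1 !mul1e /weight big_ord0 mul1r big_seq1.
Qed.

(** For t >= 0, [mass] has mean t and is almost surely finite, so little is lost. There are N
    factors: A_n corresponds to N = n + 1. *)
Definition rmass (N : nat) (t : R) (w : T) : R := fine (mass N t w).

Lemma rmass_ge0 N t w : 0 <= rmass N t w.
Proof. by rewrite fine_ge0// mass_ge0. Qed.

Lemma measurable_rmass N t : measurable_fun setT (rmass N t).
Proof. by apply: measurableT_comp => //; exact: measurable_mass. Qed.

Lemma rmassE N t : 0 <= t -> {ae P, forall w, (rmass N t w)%:E = mass N t w}.
Proof.
move=> t0.
have iM : P.-integrable setT (mass N t).
  apply/integrableP; split; first exact: measurable_mass.
  under eq_integral do rewrite gee0_abs ?mass_ge0//.
  by rewrite integral_mass// ltry.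
by apply: filterS (integrable_ae measurableT iM) => w /(_ I) ?; rewrite fineK.
Qed.

Lemma integral_weight_rmass n c N t k : 0 <= t ->
  (\int[P]_w (weight n c w * rmass N t w ^+ k)%:E =
   \int[P]_w ((weight n c w)%:E * mass N t w ^+ k))%E.
Proof.
move=> t0; apply: ae_eq_integral => //.
- apply/measurable_EFinP; apply: measurable_funM; first exact: measurable_weight.
  by apply: measurable_funX; exact: measurable_rmass.
- apply: emeasurable_funM; first exact: measurable_eweight.
  by apply: emeasurable_exp; exact: measurable_mass.
- by apply: filterS (rmassE N t0) => w e _; rewrite -e EFinM EFin_expe.
Qed.

Lemma weight_powR n c w : weight n c w = weight n 1 w `^ c.
Proof.
elim: n => [|n ih]; first by rewrite /weight !big_ord0 powR1.
rewrite /weight !big_ord_recr/= -/(weight n c w) -/(weight n 1 w) ih.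
by rewrite powRM ?weight_ge0 ?powR_ge0// powRr1.
Qed.

Hypothesis posL : forall j s, 0 <= s -> {ae P, forall w, 0 < L j s w}.

Lemma weight_gt0 n c : {ae P, forall w, 0 < weight n c w}.
Proof.
have h : {ae P, forall w, 0 < weight n 1 w}.
  elim: n => [|n ih]; first by apply: nearW => w; rewrite /weight big_ord0.
  apply: filterS2 ih (posL n (lexx 0)) => w w0 l0.
  by rewrite /weight big_ord_recr/= mulr_gt0// powR_gt0// normr_gt0 gt_eqF.
by apply: filterS h => w w0; rewrite weight_powR powR_gt0.
Qed.

Variable qs : nat.
Hypotheses (pE : p = qs%:R).

Definition power_const := qs`!%:R * (expR distortion * (level_mass * b) ^+ qs.-1).

Lemma weighted_power_scaled n M c t : 0 < t -> t * b ^+ n <= 1 ->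
  1 < t * b ^+ n.+1 -> - p <= c <= 0 ->
  (\int[P]_w (weight n c w * (rmass (n + M.+1) t w / t) ^+ qs)%:E <=
   (power_const * expR (n%:R * psi (c + p)))%:E)%E.
Proof.
move=> t0 tb1 tb2 hc.
have qs0 : (0 < qs)%N by move: p_gt1; rewrite pE (_ : 1 = 1%:R)// ltr_nat => /ltnW.
have qsk : qs = qs.-1.+1 by rewrite prednK.
have ti0 : 0 <= t^-1 ^+ qs by rewrite exprn_ge0// invr_ge0 ltW.
have -> : (\int[P]_w (weight n c w * (rmass (n + M.+1) t w / t) ^+ qs)%:E =
    (t^-1 ^+ qs)%:E * \int[P]_w (weight n c w * rmass (n + M.+1) t w ^+ qs)%:E)%E.
  rewrite -ge0_integralZl//.
  - by apply: eq_integral => w _; rewrite -EFinM exprMn; congr EFin; ring.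
  - apply/measurable_EFinP; apply: measurable_funM; first exact: measurable_weight.
    by apply: measurable_funX; exact: measurable_rmass.
  - by move=> w _; rewrite lee_fin mulr_ge0 ?weight_ge0// exprn_ge0// rmass_ge0.
rewrite (integral_weight_rmass _ _ _ _ (ltW t0)).
apply: (@le_trans _ _ ((t^-1 ^+ qs)%:E * (qs`!%:R * (expR (n%:R * psi (c + p) + distortion) *
    (level_mass * b ^- n) ^+ qs.-1 * t))%:E)%E).
  by apply: lee_wpmul2l => //; apply: weighted_power_le => //; exact: ltW.
rewrite -EFinM lee_fin /power_const.
have lm := level_mass_ge0.
(* The powers of t leave (b^-n / t)^(qs - 1), and b^-n / t <= b because 1 < t b^(n + 1). *)
have h : t^-1 ^+ qs * (level_mass * b ^- n) ^+ qs.-1 * t <= (level_mass * b) ^+ qs.-1.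
  have -> : t^-1 ^+ qs * (level_mass * b ^- n) ^+ qs.-1 * t =
      (level_mass * (b ^- n / t)) ^+ qs.-1.
    rewrite {1}qsk exprSr !exprMn; field; rewrite gt_eqF//.
  have bt0 : 0 <= b ^- n / t by rewrite divr_ge0 ?invr_ge0 ?expb_ge0// ltW.
  apply: lerXn2r; rewrite ?nnegrE; [exact: mulr_ge0|by apply: mulr_ge0 => //; exact: ltW b_gt0|].
  apply: ler_wpM2l => //; rewrite ler_pdivrMr// -[leLHS]mul1r ler_pdivrMr ?expb_gt0//.
  by rewrite (_ : b * t * b ^+ n = t * b ^+ n.+1) ?(ltW tb2)// exprS; ring.
rewrite expRD.
set E1 := expR (n%:R * _); set E2 := expR distortion.
have e1 : 0 <= E1 by exact: expR_ge0.
have e2 : 0 <= E2 by exact: expR_ge0.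
have -> : t^-1 ^+ qs * (qs`!%:R * (E1 * E2 * (level_mass * b ^- n) ^+ qs.-1 * t)) =
  (qs`!%:R * E2 * E1) * (t^-1 ^+ qs * (level_mass * b ^- n) ^+ qs.-1 * t) by ring.
have -> : qs`!%:R * (E2 * (level_mass * b) ^+ qs.-1) * E1 =
  (qs`!%:R * E2 * E1) * (level_mass * b) ^+ qs.-1 by ring.
by apply: ler_wpM2l => //; rewrite !mulr_ge0.
Qed.

(* With W = [weight n 1] and v = [rmass] / t, the ratio v / W is of order 1 under
   the tilted measure W ^ q dP: its first moment there is bounded below by
   [weighted_mean] and its p-th moment above by [weighted_power_scaled].
   Interpolating, its q-th moment is bounded on both sides. *)
Lemma rmass_powR_bounds (q : R) : 0 < q < p ->
  exists K1 K2 : R, [/\ 0 < K1, 0 < K2 & forall t n M, 0 < t ->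
    t * b ^+ n <= 1 -> 1 < t * b ^+ n.+1 ->
    ((K1 * expR (n%:R * psi q))%:E <=
       \int[P]_w ((rmass (n + M.+1) t w / t) `^ q)%:E)%E /\
    (\int[P]_w ((rmass (n + M.+1) t w / t) `^ q)%:E <=
       (K2 * expR (n%:R * psi q))%:E)%E].
Proof.
move=> /andP[q0 qp].
have pc0 : 0 <= power_const.
  by rewrite /power_const !mulr_ge0 ?expR_ge0// exprn_ge0// mulr_ge0 ?level_mass_ge0// ltW// b_gt0.
pose c0 := expR (- distortion); have c00 : 0 < c0 by exact: expR_gt0.
(* Then delta (1 + [power_const]) = c0 / 2: half of the lower bound c0 on the first moment
   survives. *)
pose delta := c0 / (2 * (1 + power_const)).
have d0 : 0 < delta by rewrite divr_gt0// mulr_gt0//; lra.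
have h1 : 0 < (1 : R) < qs%:R by rewrite -pE p_gt1 ltr01.
have [K K0 HK] := powR_interpolation h1 q0 d0.
exists (c0 / (2 * K)), (1 + power_const); split.
- by rewrite divr_gt0// mulr_gt0.
- lra.
move=> t n M t0 tb1 tb2; set N := (n + M.+1)%N.
pose v w := rmass N t w / t.
have v0 w : 0 <= v w by rewrite divr_ge0 ?rmass_ge0// ltW.
have mv : measurable_fun setT v by apply: measurable_funM => //; exact: measurable_rmass.
have mvq : measurable_fun setT (fun w => v w `^ q) by exact: (measurableT_comp (measurable_powR _)).
pose W := weight n.
have mW c : measurable_fun setT (W c) by exact: measurable_weight.
have W0 c w : 0 <= W c w by exact: weight_ge0.
set I1 := expR (n%:R * psi q); have I10 : 0 < I1 by exact: expR_gt0.
have E1 : (\int[P]_w (W q w)%:E = I1%:E)%E.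
  by apply: weight_moment; apply/andP; split; lra.
have E2 : (\int[P]_w (W (q - p) w * v w ^+ qs)%:E <= (power_const * I1)%:E)%E.
  have -> : I1 = expR (n%:R * psi ((q - p) + p)) by rewrite subrK.
  by apply: weighted_power_scaled => //; apply/andP; split; lra.
have E3 : ((c0 * I1)%:E <= \int[P]_w (W (q - 1) w * v w)%:E)%E.
  have hq1 : - p <= q - 1 by have := p_gt1; lra.
  have hq2 : q - 1 + 1 <= p by lra.
  have [h _] := weighted_mean (leq_addr M.+1 n) (ltW t0) tb1 hq1 hq2.
  have -> : (\int[P]_w (W (q - 1) w * v w)%:E = t^-1%:E *
      \int[P]_w (W (q - 1) w * rmass N t w ^+ 1)%:E)%E.
    rewrite -ge0_integral_EFinZ ?invr_ge0 ?(ltW t0)//.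
    - by apply: eq_integral => w _; rewrite /v; congr EFin; ring.
    - by apply: measurable_funM => //; apply: measurable_funX; exact: measurable_rmass.
    - by move=> w; rewrite mulr_ge0// exprn_ge0// rmass_ge0.
  rewrite (integral_weight_rmass _ _ _ _ (ltW t0)).
  rewrite subrK in h.
  apply: (@le_trans _ _ (t^-1%:E * (expR (n%:R * psi q - distortion) * t)%:E)%E).
    rewrite -EFinM lee_fin mulrCA mulVf ?gt_eqF// mulr1 expRD mulrC /c0 /I1.
    by rewrite expRN.
  by apply: lee_wpmul2l => //; rewrite lee_fin invr_ge0 ltW.
have m2 : measurable_fun setT (fun w => W (q - p) w * v w ^+ qs).
  by apply: measurable_funM => //; exact: measurable_funX.
have g2 w : 0 <= W (q - p) w * v w ^+ qs by rewrite mulr_ge0// exprn_ge0.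
have vq0 w : 0 <= v w `^ q by exact: powR_ge0.
(* The tilted moments of v / W: W^q (v / W) = W^(q - 1) v and W^q (v / W)^p = W^(q - p) v^p, while
   W^q (v / W)^q = v^q carries no weight. *)
have key w : 0 < W 1 w ->
    [/\ W (q - 1) w * v w = W q w * (v w / W 1 w) `^ 1,
        W (q - p) w * v w ^+ qs = W q w * (v w / W 1 w) ^+ qs &
        v w `^ q = W q w * (v w / W 1 w) `^ q].
  move=> W10.
  have V0 : 0 <= (W 1 w)^-1 by rewrite invr_ge0.
  have WB c : W (q - c) w = W q w * (W 1 w)^-1 `^ c.
    rewrite /W (weight_powR n (q - c)) (weight_powR n q) -powR_inv1//.
    by rewrite -powRrM mulN1r -powRD// (gt_eqF W10) implybT.
  have vW0 : 0 <= v w / W 1 w by rewrite divr_ge0.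
  split.
  - by rewrite WB !powRr1//; ring.
  - by rewrite WB pE powR_mulrn// [(v w / _) ^+ _]exprMn; ring.
  - rewrite powRM// mulrCA [W q w](weight_powR n q) -powRM//.
    by rewrite divff ?gt_eqF// powR1 mulr1.
have mA1 : measurable_fun setT (fun w => delta * W q w) by exact: measurable_funM.
have mA2 : measurable_fun setT (fun w => delta * (W (q - p) w * v w ^+ qs)).
  exact: measurable_funM.
have mA3 : measurable_fun setT (fun w => K * v w `^ q) by exact: measurable_funM.
have mA : measurable_fun setT
    (fun w => delta * W q w + delta * (W (q - p) w * v w ^+ qs)).
  exact: measurable_funD.
have A1 w : 0 <= delta * W q w by rewrite mulr_ge0// ltW.
have A2 w : 0 <= delta * (W (q - p) w * v w ^+ qs) by rewrite mulr_ge0// ltW.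
have A3 w : 0 <= K * v w `^ q by rewrite mulr_ge0// ltW.
have A12 w : 0 <= delta * W q w + delta * (W (q - p) w * v w ^+ qs).
  by rewrite addr_ge0.
have EL : (\int[P]_w (W (q - 1) w * v w)%:E <=
  \int[P]_w ((delta * W q w + delta * (W (q - p) w * v w ^+ qs)) + K * v w `^ q)%:E)%E.
  apply: ae_ge0_le_integral_EFin.
  - exact: measurable_funM.
  - exact: measurable_funD.
  - by move=> w; rewrite mulr_ge0.
  - by move=> w; rewrite addr_ge0.
  - apply: filterS (weight_gt0 n 1) => w /key[-> -> ->].
    have vW0 : 0 <= v w / W 1 w by rewrite divr_ge0.
    have := ler_wpM2l (W0 q w) (HK _ vW0); move=> /le_trans; apply.
    by rewrite le_eqVlt; apply/orP; left; apply/eqP; ring.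
have EU : (\int[P]_w (v w `^ q)%:E <= \int[P]_w (W q w + W (q - p) w * v w ^+ qs)%:E)%E.
  apply: ae_ge0_le_integral_EFin => //.
  - exact: measurable_funD.
  - by move=> w; rewrite addr_ge0.
  - apply: filterS (weight_gt0 n 1) => w /key[_ -> ->].
    have vW0 : 0 <= v w / W 1 w by rewrite divr_ge0.
    rewrite -[X in _ <= X + _]mulr1 -mulrDr ler_wpM2l//.
    by apply: powR_le_1D => //; rewrite q0 -pE ltW.
split; last first.
  apply: (le_trans EU); rewrite ge0_integral_EFinD// E1 mulrDl mul1r EFinD.
  exact: leeD2l.
have := le_trans E3 EL.
rewrite ge0_integral_EFinD// ge0_integral_EFinD//.
rewrite !ge0_integral_EFinZ ?(ltW d0) ?(ltW K0)// E1.
set X := (\int[P]_w (v w `^ q)%:E)%E => h.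
have X0 : (0 <= X)%E by apply: integral_ge0 => w _; rewrite lee_fin.
have {}h : ((c0 * I1)%:E <= (delta * I1)%:E + (delta * (power_const * I1))%:E + K%:E * X)%E.
  apply: (le_trans h); apply: leeD2r; rewrite EFinM; apply: leeD2l.
  by rewrite [leRHS]EFinM; apply: lee_wpmul2l => //; rewrite lee_fin ltW.
move: X0 h; case: X => [x| |]//=; last by move=> _ _; rewrite leey.
rewrite !lee_fin => x0 h.
have dE : delta * I1 + delta * (power_const * I1) = c0 * I1 / 2.
  by rewrite /delta; field; apply/lt0r_neq0; lra.
rewrite (_ : c0 / (2 * K) * I1 = (c0 * I1 / 2) / K); last by field; rewrite gt_eqF.
rewrite ler_pdivrMr//; lra.
Qed.

Definition power_bound := qs`!%:R * (expR distortion * level_mass ^+ qs.-1).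

Lemma rmass_power_le N t : 0 <= t <= 1 ->
  (\int[P]_w (rmass N.+1 t w ^+ qs)%:E <= power_bound%:E)%E.
Proof.
move=> /andP[t0 t1].
have qs0 : (0 < qs)%N by move: p_gt1; rewrite pE (_ : 1 = 1%:R)// ltr_nat => /ltnW.
have qsk : qs = qs.-1.+1 by rewrite prednK.
have p0 : - p <= (0 : R) <= 0 by rewrite lexx andbT oppr_le0 ltW// (lt_trans _ p_gt1).
have tb : t * b ^+ 0 <= 1 by rewrite expr0 mulr1.
have := weighted_power_le N pE qsk t0 tb p0.
rewrite add0n -integral_weight_rmass// mul0r add0r expr0 invr1 mulr1.
under eq_integral do rewrite /weight big_ord0 mul1r.
move=> /le_trans; apply; rewrite lee_fin /power_bound ler_wpM2l// ler_piMr//.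
by rewrite mulr_ge0 ?expR_ge0// exprn_ge0// level_mass_ge0.
Qed.

Hypothesis qs2 : (2 <= qs)%N.

Lemma p_ge2 : 2 <= p. Proof. by rewrite pE ler_nat. Qed.

Lemma integral_rmass_mul N M t : (N <= M)%N -> 0 <= t ->
  (\int[P]_w (rmass N t w * rmass M t w)%:E =
   \int[mu]_u ((\int[mu]_s ((expR (pair_exponent N s u))%:E * before t s)) * before t u))%E.
Proof.
move=> NM t0; rewrite -(integral_mass_mass NM p_ge2 t0).
apply: ae_eq_integral => //.
- by apply/measurable_EFinP; apply: measurable_funM; exact: measurable_rmass.
- by apply: emeasurable_funM; exact: measurable_mass.
- by apply: filterS2 (rmassE N t0) (rmassE M t0) => w <- <- _; rewrite EFinM.
Qed.

Lemma rmass_sqr_le N t : 0 <= t <= 1 ->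
  (\int[P]_w (rmass N.+1 t w ^+ 2)%:E <= (1 + power_bound)%:E)%E.
Proof.
move=> t01; apply: (sqr_moment_le qs2); [exact: measurable_rmass|exact: rmass_ge0|].
exact: rmass_power_le.
Qed.

(* The masses form a martingale: each further level is independent of the
   previous ones and has mean 1. *)
Lemma integral_rmass_sub_sqr N M t : (N <= M)%N -> 0 <= t <= 1 ->
  (\int[P]_w ((rmass M.+1 t w - rmass N.+1 t w) ^+ 2)%:E +
   \int[P]_w (rmass N.+1 t w ^+ 2)%:E = \int[P]_w (rmass M.+1 t w ^+ 2)%:E)%E.
Proof.
move=> NM t01; have /andP[t0 t1] := t01.
have mr k : measurable_fun setT (rmass k t) by exact: measurable_rmass.
have r0 k w : 0 <= rmass k t w by exact: rmass_ge0.
have NN : (\int[P]_w (rmass N.+1 t w * rmass M.+1 t w)%:E =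
    \int[P]_w (rmass N.+1 t w ^+ 2)%:E)%E.
  rewrite integral_rmass_mul// -(integral_rmass_mul (leqnn N.+1) t0).
  by apply: eq_integral => w _; rewrite expr2.
have fN := rmass_sqr_le N t01.
have mNM : measurable_fun setT (fun w => rmass N.+1 t w * rmass M.+1 t w).
  exact: measurable_funM.
have NM0 w : 0 <= rmass N.+1 t w * rmass M.+1 t w by rewrite mulr_ge0.
have mX k : measurable_fun setT (fun w => rmass k t w ^+ 2) by exact: measurable_funX.
have mB : measurable_fun setT (fun w => (rmass M.+1 t w - rmass N.+1 t w) ^+ 2).
  by apply: measurable_funX; exact: measurable_funB.
have m2 : measurable_fun setT
    (fun w => rmass N.+1 t w * rmass M.+1 t w + rmass N.+1 t w * rmass M.+1 t w).
  exact: measurable_funD.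
(* The square is expanded without subtracting integrals, as (x - y)^2 + 2 x y = x^2 + y^2; the
   finite second moment is cancelled afterwards. *)
have E : (\int[P]_w ((rmass M.+1 t w - rmass N.+1 t w) ^+ 2)%:E +
      (\int[P]_w (rmass N.+1 t w ^+ 2)%:E + \int[P]_w (rmass N.+1 t w ^+ 2)%:E) =
    \int[P]_w (rmass M.+1 t w ^+ 2)%:E + \int[P]_w (rmass N.+1 t w ^+ 2)%:E)%E.
  rewrite -{1 2}NN.
  rewrite -(ge0_integral_EFinD _ mNM mNM NM0 NM0).
  rewrite -(ge0_integral_EFinD _ mB m2) => [|w|w]; rewrite ?sqr_ge0 ?addr_ge0//.
  rewrite -(ge0_integral_EFinD _ (mX _) (mX _)) => [|w|w]; rewrite ?sqr_ge0//.
  by apply: eq_integral => w _; congr EFin; ring.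
have iN_fin : (\int[P]_w (rmass N.+1 t w ^+ 2)%:E)%E \is a fin_num.
  rewrite ge0_fin_numE ?(le_lt_trans fN) ?ltry//.
  by apply: integral_ge0 => w _; rewrite lee_fin sqr_ge0.
by move: E; rewrite addeA => /(congr1 (fun x => (x - \int[P]_w (rmass N.+1 t w ^+ 2)%:E)%E)); rewrite !addeK.
Qed.

End product_moments.

(** * Agreement of the product integrals with their nonnegative versions *)

Section product_integrals.
Context (R : realType) d (T : measurableType d) (P : probability T R).
Variables (L : nat -> R -> {RV P >-> R}) (b : R).
Local Notation mu := (@lebesgue_measure R).
Hypothesis b_gt1 : 1 < b.
Hypothesis measL : forall j, measurable_process (L j).
Hypothesis posL : forall j s, 0 <= s -> {ae P, forall w, 0 < L j s w}.

Let F (N : nat) (s : R) (w : T) : R := \prod_(j < N) L j (`|s| * b ^+ j) w.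

Let measurable_F N : measurable_fun setT (fun z : R * T => F N z.1 z.2).
Proof.
have b0 : 0 < b by exact: lt_trans b_gt1.
apply: measurable_prod => j _.
have mt : measurable (times R `*` [set: T]).
  by apply: measurableX => //; rewrite /times; exact: measurable_itv.
pose sc (x : R) := `|x| * b ^+ j.
have mpair : measurable_fun [set: R * T] (fun z => (sc z.1, z.2)).
  apply: measurable_fun_pair; last exact: measurable_snd.
  apply: (measurableT_comp (f := sc)); last exact: measurable_fst.
  by apply: measurable_funM => //; exact: (@normr_measurable _ setT).
apply: (measurable_comp mt _ (measL j) mpair).
by move=> _ [z _ <-]; split => //=; rewrite /times/= in_itv/= andbT mulr_ge0// exprn_ge0// ltW.
Qed.

Let product_integralE N t w : product_integral L b N t w =
  fine (\int[mu]_(s in `[0%R, t]) (F N.+1 s w)%:E).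
Proof.
rewrite /product_integral /Rintegral; congr fine; apply: eq_integral => s.
by rewrite inE/= in_itv/= => /andP[s0 _]; rewrite /F ger0_norm.
Qed.

Lemma measurable_product_integral N t : measurable_fun setT (product_integral L b N t).
Proof.
pose f (z : R * T) := (F N.+1 z.1 z.2)%:E.
have mf : measurable_fun setT f by apply/measurable_EFinP; exact: measurable_F.
have mb : measurable_fun setT (fun z : R * T => before t z.1).
  by apply: measurable_before; [exact: measurable_cst|exact: measurable_fst].
have main (g : R * T -> \bar R) : measurable_fun setT g -> (forall z, 0 <= g z)%E ->
    measurable_fun setT (fun w => \int[mu]_(s in `[0%R, t]) g (s, w))%E.
  move=> mg g0; pose h z := (g z * before t z.1)%E.
  have mh : measurable_fun setT h by exact: emeasurable_funM.
  have h0 z : (0 <= h z)%E by rewrite mule_ge0// before_ge0.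
  rewrite (_ : (fun w => _) = (fun w => \int[mu]_s h (s, w))%E).
    by have := @measurable_fun_fubini_tonelli_G _ _ _ _ _ mu h mh h0.
  by apply/funext => w; rewrite integral_before.
(* The factors may be negative on a null set, so positive and negative parts are integrated
   separately. *)
have -> : product_integral L b N t = (fun w => fine
    (\int[mu]_(s in `[0%R, t]) f^\+ (s, w) - \int[mu]_(s in `[0%R, t]) f^\- (s, w))%E).
  apply/funext => w; rewrite product_integralE [in LHS]integralE.
  by congr (fine (_ - _)%E); apply: eq_integral => s _; rewrite ?funeposE ?funenegE.
apply: measurableT_comp => //; apply: emeasurable_funB; apply: main => //.
- exact: measurable_funepos.
- exact: measurable_funeneg.
Qed.

(** Positivity holds at each time off a null set depending on that time; [ae_sections] gives
    agreement of the integrands for almost every time, off one null set. *)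
Lemma product_integral_rmass N t :
  {ae P, forall w, product_integral L b N t w = rmass L b N.+1 t w}.
Proof.
have b0 : 0 < b by exact: lt_trans b_gt1.
have mF := measurable_F N.+1.
have mG := measurable_density b measL N.+1.
have FG s : {ae P, forall w, F N.+1 s w = density L b N.+1 s w}.
  have : {ae P, forall w, forall j, 0 < L j (`|s| * b ^+ j) w}.
    apply: ae_foralln => j.
    by apply: posL; rewrite mulr_ge0// exprn_ge0// ltW.
  apply: filterS => w hw; apply: eq_bigr => j _.
  by rewrite /absL normrM (ger0_norm (exprn_ge0 _ (ltW b0))) (gtr0_norm (hw j)).
apply: filterS (ae_sections mF mG FG) => w hw.
rewrite product_integralE /rmass.
have -> : mass L b N.+1 t w = (\int[mu]_(s in `[0%R, t]) edensity L b N.+1 s w)%E.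
  by rewrite integral_before; apply: eq_integral => s _; rewrite mule1.
congr fine; apply: ae_eq_integral => //.
- apply/measurable_EFinP; apply: measurable_funTS.
  exact: (measurable_fun_pair1 w mF).
- apply/measurable_EFinP; apply: measurable_funTS.
  exact: (measurable_fun_pair1 w mG).
- by apply: (@filterS _ _ (ae_filter_ringOfSetsType mu) _ _ _ hw) => s e _; rewrite /edensity -e.
Qed.

End product_integrals.

Lemma cvg_nonneg0 (R : realType) (f : nat -> \bar R) :
  (forall n, (0 <= f n)%E) ->
  (forall e : R, 0 < e -> exists N, forall n, (N <= n)%N -> (f n <= e%:E)%E) ->
  f n @[n --> \oo] --> 0%E.
Proof.
move=> f0 hf.
have hfin e n : (f n <= e%:E)%E -> f n \is a fin_num.
  by move=> h; rewrite ge0_fin_numE// (le_lt_trans h)// ltry.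
apply/fine_cvgP; split.
  by have [N hN] := hf 1 ltr01; exists N => // n /hN /hfin.
apply/cvgr0Pnorm_le => e e0; have [N hN] := hf e e0; exists N => // n /hN h.
by rewrite /= ger0_norm ?fine_ge0// -lee_fin fineK// (hfin e).
Qed.

Section square_integrable.
Context (R : realType) d (T : measurableType d) (P : probability T R).

Lemma Lfun2_sqr (f : T -> R) : measurable_fun setT f ->
  (\int[P]_w (f w ^+ 2)%:E < +oo)%E -> f \in Lfun P 2%:E.
Proof.
move=> mf hf; rewrite inE; apply/andP; split; rewrite inE//=.
rewrite /finite_norm unlock; apply: poweR_lty; apply: le_lt_trans hf.
rewrite le_eqVlt; apply/orP; left; apply/eqP; apply: eq_integral => w _ /=.
by rewrite powR_mulrn// real_normK// num_real.
Qed.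

End square_integrable.

Section double_integral.
Context (R : realType).
Local Notation mu := (@lebesgue_measure R).
Local Open Scope ereal_scope.

(** The area t * t is added on the left, so that no extended integrals are subtracted. *)
Lemma double_integral_sub1 (G : R * R -> \bar R) (t : R) : (0 <= t)%R ->
  measurable_fun setT G ->
  (forall s u, (0 <= s <= t)%R -> (0 <= u <= t)%R -> 1 <= G (s, u) < +oo) ->
  \int[mu]_(u in `[0%R, t]) \int[mu]_(s in `[0%R, t]) (G (s, u) - 1) + (t * t)%:E =
  \int[mu]_u ((\int[mu]_s (G (s, u) * before t s)) * before t u).
Proof.
move=> t0 mG G1.
have be s : ((0 <= s <= t)%R /\ before t s = 1) \/ ((0 <= s <= t)%R = false /\ before t s = 0).
  by rewrite /before; case: (_ && _); [left|right].
have b0 s : 0 <= before t s := before_ge0 t s.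
have mb : measurable_fun setT (before t) by apply: measurable_before => //; exact: measurable_cst.
(* G is at least 1 only on the square; the absolute value is nonnegative everywhere, as Tonelli's
   theorem requires. *)
pose H z := `|G z - 1|.
have mH : measurable_fun setT H.
  by apply: measurableT_comp => //; apply: emeasurable_funB => //; exact: measurable_cst.
have H0 z : 0 <= H z by exact: abse_ge0.
have HG s u : (0 <= s <= t)%R -> (0 <= u <= t)%R -> H (s, u) = G (s, u) - 1 /\ G (s, u) = H (s, u) + 1.
  move=> hs hu; have := G1 _ _ hs hu; rewrite /H; case: (G (s, u)) => [g| |]//=.
  rewrite lee_fin => /andP[g1 _]; rewrite -EFinB /= ger0_norm ?subr_ge0//.
  by split => //; rewrite -EFinD subrK.
pose I u := \int[mu]_s (H (s, u) * before t s).
have I0 u : 0 <= I u by apply: integral_ge0 => s _; rewrite mule_ge0.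
pose K z := (H z * before t z.1).
have mK : measurable_fun setT K.
  apply: emeasurable_funM => //.
  by apply: measurable_before; [exact: measurable_cst|exact: measurable_fst].
have K0 z : 0 <= K z by rewrite mule_ge0.
have mI : measurable_fun setT I.
  by have := @measurable_fun_fubini_tonelli_G _ _ _ _ _ mu K mK K0.
have -> : \int[mu]_(u in `[0%R, t]) \int[mu]_(s in `[0%R, t]) (G (s, u) - 1) =
    \int[mu]_u (I u * before t u).
  rewrite integral_before; apply: eq_integral => u _.
  have [[hu ->]|[_ ->]] := be u; last by rewrite !mule0.
  rewrite !mule1 integral_before; apply: eq_integral => s _.
  have [[hs ->]|[_ ->]] := be s; last by rewrite !mule0.
  by rewrite !mule1 (HG _ _ hs hu).1.
transitivity (\int[mu]_u (I u * before t u + t%:E * before t u)).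
  rewrite ge0_integralD//.
  - rewrite ge0_integralZl//; first by rewrite integral_before_cst.
  - by move=> u _; rewrite mule_ge0.
  - exact: emeasurable_funM.
  - by move=> u _; rewrite mule_ge0// lee_fin.
  - by apply: emeasurable_funM => //; exact: measurable_cst.
apply: eq_integral => u _.
have [[hu ->]|[_ ->]] := be u; last by rewrite !mule0 adde0.
rewrite !mule1 -(integral_before_cst t0) -ge0_integralD//.
- apply: eq_integral => s _.
  have [[hs ->]|[_ ->]] := be s; last by rewrite !mule0 adde0.
  by rewrite !mule1 (HG _ _ hs hu).2.
- by move=> s _; rewrite mule_ge0.
- by apply: emeasurable_funM => //; exact: (measurable_fun_pair1 u mH).
Qed.

End double_integral.

(** Take n to be the integer part of - ln t / ln b; the last clause will turn e^(n psi(q)) into a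
    power of t. *)
Lemma scale_index (R : realType) (b t : R) : 1 < b -> 0 < t <= 1 ->
  exists n : nat, [/\ t * b ^+ n <= 1, 1 < t * b ^+ n.+1 &
    n%:R <= - ln t / ln b <= n%:R + 1].
Proof.
move=> b1 /andP[t0 t1].
have b0 : 0 < b by exact: lt_trans b1.
have lb : 0 < ln b by exact: ln_gt0.
have lt0 : ln t <= 0 by rewrite ln_le0// ltW.
have x0 : 0 <= - ln t / ln b by rewrite divr_ge0 ?oppr_ge0// ltW.
have /andP[h1 h2] := truncn_itv x0.
have E k : t * b ^+ k = expR (ln t + k%:R * ln b).
  by rewrite expRD expRM_natl !lnK// posrE.
exists (Num.truncn (- ln t / ln b)); split.
- by rewrite E -[leRHS]expR0 ler_expR -lerBrDl sub0r -ler_pdivlMr.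
- by rewrite E -[ltLHS]expR0 ltr_expR -ltrBlDl sub0r -ltr_pdivrMr.
- by rewrite h1/= natr1 ltW.
Qed.

(** * The limit process *)

Section multifractal_limit.
Context (R : realType) d (T : measurableType d) (P : probability T R).
Variables (L : nat -> R -> {RV P >-> R}) (lambda p C b : R) (psi : R -> R).
Local Notation mu := (@lebesgue_measure R).
Hypotheses (lambda_gt0 : 0 < lambda) (p_gt1 : 1 < p) (C_ge0 : 0 <= C).
Hypotheses (psi0 : psi 0 = 0) (psi1 : psi 1 = 0).
Hypothesis psi_convex : forall x y t, - p <= x <= p -> - p <= y <= p ->
  0 <= t <= 1 -> psi (t * x + (1 - t) * y) <= t * psi x + (1 - t) * psi y.
Hypothesis psi_lip : forall x y, - p <= x <= p -> - p <= y <= p ->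
  `|psi x - psi y| <= C * `|x - y|.
Hypotheses (b_gt1 : 1 < b) (slope_lt : expR (slope p psi) < b).
Hypothesis measL : forall j, measurable_process (L j).
Hypothesis indL : mutually_independent P (fun j => sigma_process (L j)).
Hypothesis momL : forall j l, chain_ok lambda p l ->
  (\int[P]_w (\prod_(x <- l) (`|L j x.1 w| `^ x.2))%:E =
   (expR (chain_exponent lambda psi l))%:E)%E.
Hypothesis posL : forall j s, 0 <= s -> {ae P, forall w, 0 < L j s w}.
Variable qs : nat.
Hypotheses (pE : p = qs%:R) (qs2 : (2 <= qs)%N).

Let B := power_bound lambda p C b psi qs.
Let Y n t := rmass L b n.+1 t.
Let mY n t : measurable_fun setT (Y n t).
Proof. exact: measurable_rmass. Qed.
Let Y0 n t w : 0 <= Y n t w.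
Proof. exact: rmass_ge0. Qed.
Let YB t : 0 <= t <= 1 -> forall n, (\int[P]_w (Y n t w ^+ qs)%:E <= B%:E)%E.
Proof. by move=> t01 n; apply: rmass_power_le. Qed.
Let Y_orth t : 0 <= t <= 1 -> forall N M, (N <= M)%N ->
  (\int[P]_w ((Y M t w - Y N t w) ^+ 2)%:E + \int[P]_w (Y N t w ^+ 2)%:E =
   \int[P]_w (Y M t w ^+ 2)%:E)%E.
Proof.
move=> t01 N M NM.
exact: (integral_rmass_sub_sqr lambda_gt0 p_gt1 C_ge0 psi0 psi1 psi_convex psi_lip
  b_gt1 slope_lt measL indL momL pE qs2 NM t01).
Qed.

(** The last clause is used with k = qs, for the bound in L^qs, and with k = 1, for E A <= t. *)
Definition mean_square_limit (t : R) (A : T -> R) := [/\ measurable_fun setT A,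
  forall w, 0 <= A w,
  forall e : R, 0 < e -> exists N, forall n, (N <= n)%N ->
    (\int[P]_w ((rmass L b n.+1 t w - A w) ^+ 2)%:E <= e%:E)%E &
  forall k (D : \bar R), (forall n, \int[P]_w (rmass L b n.+1 t w ^+ k)%:E <= D)%E ->
    (\int[P]_w (A w ^+ k)%:E <= D)%E].

Lemma mean_square_limit_exists t : 0 <= t <= 1 ->
  exists A : {RV P >-> R}, mean_square_limit t A.
Proof.
move=> t01.
have [A hA] := L2_complete (mY ^~ t) (Y0 ^~ t) (L2_cauchy qs2 (mY ^~ t) (Y0 ^~ t) (YB t01) (Y_orth t01)).
have [mA _ _ _] := hA.
by exists (mfun_Sub (mem_set mA)).
Qed.

Lemma mean_square_limit_power t A : 0 <= t <= 1 -> mean_square_limit t A ->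
  (\int[P]_w (A w ^+ qs)%:E <= B%:E)%E.
Proof. by move=> t01 [_ _ _]; apply; exact: YB. Qed.

Lemma mean_square_limit_Lq t A (q : R) : 0 <= t <= 1 -> 0 < q < qs%:R ->
  mean_square_limit t A -> forall e : R, 0 < e -> exists N, forall n, (N <= n)%N ->
  (\int[P]_w (`|rmass L b n.+1 t w - A w| `^ q)%:E <= e%:E)%E.
Proof.
move=> t01 hq hA; have AB := mean_square_limit_power t01 hA; have [mA A0 cA _] := hA.
exact: (Lq_limit (mY ^~ t) (Y0 ^~ t) (YB t01) hq mA A0 AB cA).
Qed.

Lemma product_integral_cvg t A (q : R) : 0 <= t <= 1 -> 0 < q < qs%:R ->
  mean_square_limit t A ->
  ('E_P[fun w => (`|product_integral L b n t w - A w| `^ q)%R])%E @[n --> \oo] --> 0%E.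
Proof.
move=> t01 hq hA; have [mA _ _ _] := hA.
have E n : 'E_P[fun w => (`|product_integral L b n t w - A w| `^ q)%R]%E =
    (\int[P]_w (`|rmass L b n.+1 t w - A w| `^ q)%:E)%E.
  rewrite unlock; apply: ae_eq_integral => //.
  - apply/measurable_EFinP; apply: (measurableT_comp (measurable_powR q)).
    apply: (measurableT_comp (@normr_measurable _ setT)); apply: measurable_funB => //.
    exact: measurable_product_integral.
  - apply/measurable_EFinP; apply: (measurableT_comp (measurable_powR q)).
    apply: (measurableT_comp (@normr_measurable _ setT)); apply: measurable_funB => //.
    exact: mY.
  - by apply: filterS (product_integral_rmass b_gt1 measL posL n t) => w -> _.
apply: cvg_nonneg0.
- by move=> n; apply: expectation_ge0 => w; exact: powR_ge0.
- move=> e e0; have [N hN] := mean_square_limit_Lq t01 hq hA e0.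
  by exists N => n /hN; rewrite E.
Qed.

Lemma mean_square_limit0 A (q : R) : 0 < q < qs%:R -> mean_square_limit 0 A ->
  (\int[P]_w (A w `^ q)%:E = 0)%E.
Proof.
move=> hq hA.
have r0 n w : rmass L b n.+1 0 w = 0.
  rewrite /rmass /mass (_ : iter_int _ _ _ _ =
    (\int[mu]_(s in `[0%R, 0%R]) edensity L b n.+1 s w)%E).
    by rewrite set_itv1 integral_set1.
  by rewrite integral_before; apply: eq_integral => s _; rewrite mule1.
have t01 : 0 <= (0 : R) <= 1 by rewrite lexx ler01.
apply/eqP; rewrite eq_le; apply/andP; split; last first.
  by apply: integral_ge0 => w _; rewrite lee_fin powR_ge0.
apply/lee_addgt0Pr => e e0; rewrite add0e.
have [N /(_ N (leqnn N))] := mean_square_limit_Lq t01 hq hA e0.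
have [_ A0 _ _] := hA.
by under eq_integral do rewrite r0 sub0r normrN ger0_norm//.
Qed.

(** The scaling exponent is positive, so that its power of t vanishes at t = 0, as A does. For q <=
    1 psi is nonpositive; beyond 1 it lies below the chord, whose slope is less than ln b. *)
Lemma psi_lt (q : R) : 0 < q < p -> psi q < q * ln b.
Proof.
have p1 := p_gt1; have lb : 0 < ln b by exact: ln_gt0.
have b0 : 0 < b by exact: lt_trans b_gt1.
move=> /andP[q0 qp]; have [q1|/ltW q1] := leP q 1.
  have h : psi q <= 0.
    by apply: (psi_le0 lambda_gt0 p_gt1 C_ge0 psi0 psi1 psi_convex) => //; lra.
  by apply: (le_lt_trans h); rewrite mulr_gt0.
have h : psi q <= slope p psi * (q - 1).
  by apply: (psi_le_slope lambda_gt0 p_gt1 C_ge0 psi1 psi_convex) => //; lra.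
have s : slope p psi < ln b by rewrite -ltr_expR lnK.
apply: (le_lt_trans h).
have h2 : slope p psi * (q - 1) <= ln b * (q - 1) by rewrite ler_wpM2r ?subr_ge0// ltW.
by apply: (le_lt_trans h2); rewrite mulrBr mulr1 [q * _]mulrC; lra.
Qed.

Lemma limit_powR_bounds (q : R) : 0 < q < p ->
  exists Clow Cup : R, [/\ 0 < Clow, Clow <= Cup & forall t A, 0 <= t <= 1 ->
    mean_square_limit t A ->
    ((Clow * t `^ (q - psi q / ln b))%:E <= \int[P]_w (A w `^ q)%:E)%E /\
    (\int[P]_w (A w `^ q)%:E <= (Cup * t `^ (q - psi q / ln b))%:E)%E].
Proof.
move=> hq; have /andP[q0 qp] := hq.
have lb : 0 < ln b by exact: ln_gt0.
have hq' : 0 < q < qs%:R by rewrite -pE.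
have [K1 [K2 [K10 K20 hK]]] := rmass_powR_bounds lambda_gt0 p_gt1 C_ge0 psi0 psi1
  psi_convex psi_lip b_gt1 slope_lt measL indL momL posL pE hq.
(* As n differs from - ln t / ln b by at most 1, e^(n psi q) and t^(- psi q / ln b) differ by a
   factor between m and M. *)
pose m := expR (- `|psi q|); pose M := expR `|psi q|.
have m0 : 0 < m by exact: expR_gt0.
have M0 : 0 < M by exact: expR_gt0.
have t0 : 0 < (2 : R) `^ q by exact: powR_gt0.
pose c := K1 * m / 2 / 2 `^ q.
have c0 : 0 < c by rewrite !divr_gt0// mulr_gt0.
(* The maximum provides Clow <= Cup without comparing K1 and K2. *)
exists c, (Num.max c (2 * 2 `^ q * (K2 * M))); split => //.
  by rewrite le_max lexx.
move=> t A t01 hA; have /andP[] := t01.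
rewrite le_eqVlt => /predU1P[t00|tgt0] tle1.
  have s0 : q - psi q / ln b != 0.
    by rewrite gt_eqF// subr_gt0 ltr_pdivrMr// psi_lt.
  by subst t; rewrite (mean_square_limit0 hq' hA) powR0// !mulr0 lexx.
have [n [n1 n2 /andP[n3 n4]]] := scale_index b_gt1 (introT andP (conj tgt0 tle1)).
have tE : t `^ (q - psi q / ln b) = t `^ q * expR (- ln t / ln b * psi q).
  rewrite /powR (gt_eqF tgt0) -expRD; congr expR; field.
  by rewrite gt_eqF.
have near_n : `|(n%:R - - ln t / ln b) * psi q| <= `|psi q|.
  by rewrite normrM ler_piMl// ler_norml; apply/andP; split; lra.
have nE : expR (n%:R * psi q) =
    expR ((n%:R - - ln t / ln b) * psi q) * expR (- ln t / ln b * psi q).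
  by rewrite -expRD; congr expR; ring.
move: near_n; rewrite ler_norml => /andP[]; rewrite -ler_expR => nl; rewrite -ler_expR => nu.
have tq0 : 0 < t `^ q by exact: powR_gt0.
have e0 := expR_gt0 (- ln t / ln b * psi q).
have te0 := ltW (mulr_gt0 tq0 e0).
have [mA A0 _ _] := hA.
have rE k : (\int[P]_w (rmass L b k t w `^ q)%:E =
    (t `^ q)%:E * \int[P]_w ((rmass L b k t w / t) `^ q)%:E)%E.
  rewrite -ge0_integral_EFinZ ?(ltW tq0)//.
  - apply: eq_integral => w _; congr EFin.
    by rewrite -powRM ?divr_ge0 ?rmass_ge0 ?ltW// mulrC divfK// gt_eqF.
  - apply: (measurableT_comp (measurable_powR q)); apply: measurable_funM => //.
    exact: measurable_rmass.
  - by move=> w; exact: powR_ge0.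
have lo0 : 0 < K1 * m * t `^ (q - psi q / ln b) by rewrite !mulr_gt0// powR_gt0.
have hi0 : 0 < K2 * M * t `^ (q - psi q / ln b) by rewrite !mulr_gt0// powR_gt0.
have hlo k : (n <= k)%N -> ((K1 * m * t `^ (q - psi q / ln b))%:E <=
    \int[P]_w (Y k t w `^ q)%:E)%E.
  move=> nk; have [h _] := hK t n (k - n)%N tgt0 n1 n2.
  rewrite /Y rE -(subnKC nk) -addnS.
  apply: (@le_trans _ _ ((t `^ q)%:E * (K1 * expR (n%:R * psi q))%:E)%E); last first.
    by apply: lee_wpmul2l => //; rewrite lee_fin ltW.
  rewrite -EFinM lee_fin tE nE.
  rewrite [leRHS](_ : _ = K1 * expR ((n%:R - - ln t / ln b) * psi q) *
    (t `^ q * expR (- ln t / ln b * psi q))); last by ring.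
  by rewrite (ler_wpM2r te0)// ler_pM2l.
have hhi k : (n <= k)%N -> (\int[P]_w (Y k t w `^ q)%:E <=
    (K2 * M * t `^ (q - psi q / ln b))%:E)%E.
  move=> nk; have [_ h] := hK t n (k - n)%N tgt0 n1 n2.
  rewrite /Y rE -(subnKC nk) -addnS.
  apply: (@le_trans _ _ ((t `^ q)%:E * (K2 * expR (n%:R * psi q))%:E)%E).
    by apply: lee_wpmul2l => //; rewrite lee_fin ltW.
  rewrite -EFinM lee_fin tE nE.
  rewrite [leLHS](_ : _ = K2 * expR ((n%:R - - ln t / ln b) * psi q) *
    (t `^ q * expR (- ln t / ln b * psi q))); last by ring.
  by rewrite (ler_wpM2r te0)// ler_pM2l.
have [h1 h2] := Lq_limit_bounds (mY ^~ t) (Y0 ^~ t) q0 mA A0 lo0 hi0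
  (mean_square_limit_Lq t01 hq' hA) hlo hhi.
have ts0 : 0 < t `^ (q - psi q / ln b) by exact: powR_gt0.
split.
  apply: le_trans h1; rewrite lee_fin /c le_eqVlt; apply/orP; left; apply/eqP.
  by field; rewrite gt_eqF.
apply: (le_trans h2); rewrite lee_fin mulrA ler_pM2r// le_max mulrA.
by apply/orP; right.
Qed.

Lemma mean_square_limit_sqr_ge t A : 0 <= t <= 1 -> mean_square_limit t A ->
  (\int[P]_w (rmass L b 1 t w ^+ 2)%:E <= \int[P]_w (A w ^+ 2)%:E)%E.
Proof.
move=> t01 hA; have AB := mean_square_limit_power t01 hA; have [mA A0 cA _] := hA.
apply: (sqr_limit_ge qs2 (mY ^~ t) mA A0 AB cA) => n.
rewrite -(Y_orth t01 (leq0n n)) leeDr//.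
by apply: integral_ge0 => w _; rewrite lee_fin sqr_ge0.
Qed.

Lemma variance_ge t (A : {RV P >-> R}) : 0 <= t <= 1 -> mean_square_limit t A ->
  (\int[mu]_(u in `[0%R, t]) \int[mu]_(s in `[0%R, t])
     ((expR (pair_exponent lambda b psi 1 s u))%:E - 1) <= 'V_P[A])%E.
Proof.
move=> t01 hA; have /andP[t0 t1] := t01.
have AB := mean_square_limit_power t01 hA.
have A2 := sqr_moment_le qs2 (let: And4 mA _ _ _ := hA in mA)
  (let: And4 _ A0 _ _ := hA in A0) AB.
have lo := mean_square_limit_sqr_ge t01 hA.
have [mA A0 _ hpow] := hA.
have p2 : 2 <= p by rewrite pE ler_nat.
(* As an integral of densities this kernel is jointly measurable by Tonelli's theorem; at
   nonnegative times it is the closed form. *)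
pose G (z : R * R) := (\int[P]_w (edensity L b 1 z.1 w * edensity L b 1 z.2 w))%E.
have GE s u : 0 <= s -> 0 <= u -> G (s, u) = (expR (pair_exponent lambda b psi 1 s u))%:E.
  move=> s0 u0.
  exact: (integral_density_pair lambda_gt0 p_gt1 psi0 psi1 b_gt1 indL momL (leqnn 1) s0 u0 p2).
have mG : measurable_fun setT G.
  pose h (z : (R * R) * T) := (edensity L b 1 z.1.1 z.2 * edensity L b 1 z.1.2 z.2)%E.
  suff : measurable_fun setT (fubini_F P h) by [].
  apply: measurable_fun_fubini_tonelli_F.
  - have me := measurable_edensity b measL 1.
    apply: emeasurable_funM; apply: (measurable_comp_pair me); try exact: measurable_snd;
      by apply: (measurableT_comp _ measurable_fst).
  - by move=> z; rewrite mule_ge0// edensity_ge0.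
have G1 s u : 0 <= s <= t -> 0 <= u <= t -> (1 <= G (s, u) < +oo)%E.
  move=> /andP[s0 _] /andP[u0 _]; rewrite GE// ltry andbT lee_fin -[leLHS]expR0 ler_expR.
  rewrite /pair_exponent big_ord1 /sorted_pair; case: (leP s u) => [|/ltW] su;
    apply: (chain_exponent_pair_ge0 lambda_gt0 p_gt1 C_ge0 psi0 psi1 psi_convex) => //;
    by rewrite expr0 !mulr1.
have Lsqr := double_integral_sub1 t0 mG G1.
set J := (\int[mu]_(u in `[0%R, t]) _)%E.
have {Lsqr} JE : (J + (t * t)%:E = \int[P]_w (rmass L b 1 t w ^+ 2)%:E)%E.
  transitivity (\int[P]_w (rmass L b 1 t w * rmass L b 1 t w)%:E)%E; last first.
    by apply: eq_integral => w _; rewrite expr2.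
  rewrite (integral_rmass_mul lambda_gt0 p_gt1 C_ge0 psi0 psi1 b_gt1 measL indL momL pE qs2
    (leqnn 1) t0).
  transitivity (\int[mu]_u ((\int[mu]_s (G (s, u) * before t s)) * before t u))%E.
    rewrite -Lsqr; congr (_ + _)%E; apply: eq_integral => u; rewrite inE/= in_itv/= => /andP[u0 _].
    by apply: eq_integral => s; rewrite inE/= in_itv/= => /andP[s0 _]; rewrite GE.
  rewrite -!integral_before; apply: eq_integral => u; rewrite inE/= in_itv/= => /andP[u0 _].
  rewrite -!integral_before; apply: eq_integral => s; rewrite inE/= in_itv/= => /andP[s0 _].
  by rewrite GE.
(* Fatou's lemma gives only this inequality, which is the direction that bounds the variance
   below. *)
have EA : ('E_P[A] <= t%:E)%E.
  rewrite unlock; have := hpow 1%N t%:E; apply => n.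
  have -> : (\int[P]_w (rmass L b n.+1 t w ^+ 1)%:E = \int[P]_w mass L b n.+1 t w)%E.
    apply: ae_eq_integral => //.
    - by apply/measurable_EFinP; exact: mY.
    - exact: measurable_mass.
    - apply: filterS (rmassE lambda_gt0 p_gt1 C_ge0 psi0 psi1 b_gt1 measL indL momL n.+1 t0).
      by move=> w /= <- _; rewrite expr1.
  by rewrite (integral_mass lambda_gt0 p_gt1 C_ge0 psi0 psi1 b_gt1 measL indL momL).
have EA0 : (0 <= 'E_P[A])%E by apply: expectation_ge0.
have LA : (A : T -> R) \in Lfun P 2%:E.
  by apply: Lfun2_sqr => //; rewrite (le_lt_trans A2)// ltry.
rewrite varianceE// [X in (_ <= X - _)%E](_ : _ = \int[P]_w (A w ^+ 2)%:E)%E; last first.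
  by rewrite unlock; apply: eq_integral.
move: EA EA0; case: ('E_P[A])%E => [a| |]//; rewrite !lee_fin => at_ a0.
rewrite leeBrDr; last by rewrite expe2.
apply: le_trans lo; rewrite -JE; apply: leeD2l.
by rewrite expe2 -EFinM lee_fin ler_pM.
Qed.

End multifractal_limit.

(** * Transfer to the copies and to the variance gamma law *)

Section copies.
Context (R : realType) d0 (T0 : measurableType d0) (P0 : probability T0 R).
Context d (T : measurableType d) (P : probability T R).
Variables (X : R -> {RV P0 >-> R}) (c : R) (L : R -> {RV P >-> R}).
Hypothesis fddL : same_fdd P P0 L (fun t w => expR (X t w - c)).

Lemma integral_copy (l : seq (R * R)) : (forall x, x \in l -> 0 <= x.1) ->
  (\int[P]_w (\prod_(x <- l) (`|L x.1 w| `^ x.2))%:E =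
   \int[P0]_w (expR (\sum_(x <- l) x.2 * (X x.1 w - c)))%:E)%E.
Proof.
move=> l0; pose y i := nth (0, 0) l i.
pose t (i : 'I_(size l)) := (y i).1.
pose g (i : 'I_(size l)) (x : R) := (`|x| `^ (y i).2)%:E.
have mX s : measurable_fun setT (fun w => expR (X s w - c)).
  by apply: measurableT_comp => //; exact: measurable_funB.
have := @fdd_integral _ _ _ P _ _ P0 _ _ _ t g fddL.
have h1 i : times R (t i) by rewrite /times/= in_itv/= andbT l0// mem_nth.
have h2 i : measurable_fun setT (g i).
  apply/measurable_EFinP; apply: (measurableT_comp (measurable_powR _)).
  exact: (@normr_measurable _ setT).
have h3 i x : (0 <= g i x)%E by rewrite lee_fin powR_ge0.
move=> /(_ h1 (fun i => @measurable_funPT _ _ _ _ (L (t i))) (fun i => mX (t i)) h2 h3).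
under eq_integral do rewrite prode_EFin.
under [in RHS]eq_integral do rewrite prode_EFin.
move=> E; apply: (etrans _ (etrans E _)); apply: eq_integral => w _; congr EFin.
  by rewrite (big_nth (0, 0)) big_mkord.
rewrite expR_sum (big_nth (0, 0)) big_mkord; apply: eq_bigr => i _.
by rewrite ger0_norm ?expR_ge0// -expRM mulrC.
Qed.

(** One-dimensional laws agree, and an exponential never falls into ]-oo, 0]. *)
Lemma copy_gt0 s : 0 <= s -> {ae P, forall w, 0 < L s w}.
Proof.
have cap (S : Type) (F : set S) : \bigcap_(i in [set: 'I_1]) F = F.
  by apply/seteqP; split => [w /(_ ord0 I)|w Fw i _].
move=> s0; exists (L s @^-1` `]-oo, 0]); split.
- by rewrite -[X in measurable X]setTI; exact: (@measurable_funPT _ _ _ _ (L s)).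
- have := @fddL 1%N (fun=> s) (fun=> `]-oo, 0]%classic) _ (fun=> measurable_itv _).
  rewrite !cap => ->; last by move=> _; rewrite /times/= in_itv/= s0.
  rewrite (_ : _ @^-1` _ = set0) ?measure0//; apply/seteqP; split => w //=.
  by rewrite in_itv/= leNgt expR_gt0.
- by move=> w /= /negP; rewrite -leNgt in_itv.
Qed.

End copies.

Section vg_moments.
Context (R : realType) d (T : measurableType d) (P : probability T R).

Lemma VG_integral_expR (kappa alpha beta mu gamma : R) (X : {RV P >-> R}) z :
  0 < gamma -> gamma ^+ 2 = alpha ^+ 2 - beta ^+ 2 ->
  VG_law kappa alpha beta mu X -> `|beta + z| < alpha ->
  (\int[P]_w (expR (z * (X w - (mu + 2 * kappa * vg_log alpha beta gamma 1))))%:E =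
   (expR (vg_exponent kappa alpha beta gamma z))%:E)%E.
Proof.
move=> g0 g2 hX hz; have := hX z hz.
rewrite -g2 sqrtr_sqr gtr0_norm// -/(vg_log alpha beta gamma z).
rewrite /mmt_gen_fun unlock.
set c := mu + _.
have mX : measurable_fun setT (fun w => expR (z * X w)).
  by apply: measurableT_comp => //; exact: measurable_funM.
have E : (\int[P]_w (expR (z * (X w - c)))%:E =
    (expR (- z * c))%:E * \int[P]_w (expR (z * X w))%:E)%E.
  rewrite -ge0_integral_EFinZ ?expR_ge0//.
  by apply: eq_integral => w _; rewrite -expRD; congr (expR _)%:E; ring.
rewrite E.
have -> : (\int[P]_w ((expR \o z \o* X) w)%:E = \int[P]_w (expR (z * X w))%:E)%E.
  by apply: eq_integral => w _; rewrite /= mulrC.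
(* [lne] takes real values only at positive reals, so the law determines the moment and shows it
   finite. *)
case: (\int[P]_w (expR (z * X w))%:E)%E => [r| |]//=.
case: leP => // r0 [lr]; rewrite -[r]lnK ?posrE// lr -EFinM -expRD; congr (expR _)%:E.
by rewrite /vg_exponent /c; ring.
Qed.

End vg_moments.

Lemma VG_scalingE (R : realType) (kappa alpha beta gamma b q : R) :
  0 < gamma -> `|beta + q| < alpha ->
  VG_scaling kappa alpha beta gamma b q = q - vg_exponent kappa alpha beta gamma q / ln b.
Proof.
move=> g0 hq.
have s0 : 0 < Num.sqrt (alpha ^+ 2 - (beta + q) ^+ 2).
  rewrite sqrtr_gt0 subr_gt0 -[(beta + q) ^+ 2]real_normK ?num_real//.
  by rewrite ltr_pXn2r// nnegrE// ltW// (le_lt_trans _ hq).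
have E : vg_log alpha beta gamma q = ln gamma - ln (Num.sqrt (alpha ^+ 2 - (beta + q) ^+ 2)).
  by rewrite /vg_log ln_div.
by rewrite /VG_scaling /vg_exponent E /vg_log; ring.
Qed.

Theorem theorem11 (R : realType)
  (d0 : measure_display) (T0 : measurableType d0) (P0 : probability T0 R)
  (d : measure_display) (T : measurableType d) (P : probability T R)
  (kappa alpha beta mu gamma lambda : R) (qstar : nat)
  (hkappa : 0 < kappa) (hbeta : 0 < `|beta|) (halpha : `|beta| < alpha)
  (hgamma : 0 < gamma) (hgamma2 : gamma ^+ 2 = alpha ^+ 2 - beta ^+ 2)
  (hlambda : 0 < lambda)
  (hqstar : (2 <= qstar)%N) (hqstar_lt : qstar%:R < `|alpha| - `|beta|)
  (X : R -> {RV P0 >-> R}) (hX : VG_OU kappa alpha beta mu lambda X) :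
  let c_X := mu + 2 * kappa *
               ln (gamma / Num.sqrt (alpha ^+ 2 - (beta + 1) ^+ 2)) in
  let Lam := fun (t : R) (w : T0) => expR (X t w - c_X) in
  forall (hmeas : measurable_process Lam) (hsep : separable_process P0 Lam)
    (L : nat -> R -> {RV P >-> R}) (hL : independent_copies P0 Lam L)
    (b : R)
    (hb : expR (2 * kappa *
            ((qstar%:R - 1)^-1 *
               ln (gamma / Num.sqrt (alpha ^+ 2 - (beta + qstar%:R) ^+ 2))
             + qstar%:R / (1 - qstar%:R) *
               ln (gamma / Num.sqrt (alpha ^+ 2 - (beta + 1) ^+ 2)))) < b),
  exists A : R -> {RV P >-> R},
    [/\ forall q : R, 0 < q < qstar%:R ->
          cvg_Lq P q (product_integral L b) A,
        forall q : R, 0 < q < qstar%:R ->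
          (A 1 : T -> R) \in Lfun P q%:E ->
          moment_scaling P q (VG_scaling kappa alpha beta gamma b q) A &
        forall t : R, 0 <= t <= 1 ->
          (\int[lebesgue_measure]_(u in `[0%R, t])
             \int[lebesgue_measure]_(w in `[0%R, t])
               (bivariate_mgf P0 X c_X 1 1 u w - 1) <= 'V_P[A t])%E].
Proof.
move=> c_X Lam _ _ L [fddL measL _ indL] b hb.
have [hVG hOU] := hX.
pose p : R := qstar%:R; pose psi := vg_exponent kappa alpha beta gamma.
have p2 : 2 <= p by rewrite /p ler_nat.
have p1 : 1 < p by lra.
have p_lt : p + `|beta| < alpha.
  have alpha0 : 0 < alpha by exact: le_lt_trans halpha.
  by move: hqstar_lt; rewrite (gtr0_norm alpha0) -/p; lra.
have inside z : - p <= z <= p -> `|beta + z| < alpha.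
  move=> hz; apply: le_lt_trans p_lt; apply: (le_trans (ler_normD _ _)).
  by rewrite addrC lerD2r ler_norml.
have psi0 : psi 0 = 0 by exact: vg_exponent0.
have psi1 : psi 1 = 0 by exact: vg_exponent1.
have psi_convex := @vg_exponent_convex _ _ alpha beta _ _ hkappa hgamma p_lt.
have [C C0 psi_lip] := @vg_exponent_lipschitz _ _ alpha beta _ _ hkappa hgamma p_lt.
have hpsi z : - p <= z <= p ->
    (\int[P0]_w (expR (z * (X 0 w - c_X)))%:E = (expR (psi z))%:E)%E.
  by move=> hz; apply: VG_integral_expR => //; exact: inside.
(* The exponent in the condition on b is psi(p) / (p - 1), written out. *)
have slope_lt : expR (slope p psi) < b.
  apply: le_lt_trans hb; rewrite ler_expR le_eqVlt; apply/orP; left; apply/eqP.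
  by rewrite /slope /psi /vg_exponent /vg_log -/p; field; apply/andP; split; lra.
have b1 : 1 < b.
  apply: le_lt_trans slope_lt; rewrite -[leLHS]expR0 ler_expR.
  exact: (slope_ge0 hlambda p1 C0 psi0 psi1 psi_convex).
have momL j l : chain_ok lambda p l ->
    (\int[P]_w (\prod_(x <- l) (`|L j x.1 w| `^ x.2))%:E =
     (expR (chain_exponent lambda psi l))%:E)%E.
  move=> okl; rewrite (integral_copy (fddL j) (chain_ok_ge0 okl)).
  exact: (integral_expR_chain hlambda hOU hpsi okl).
have posL j s (s0 : 0 <= s) : {ae P, forall w, 0 < L j s w} := copy_gt0 (fddL j) s0.
have /choice[A hA] : forall t, exists A : {RV P >-> R}, 0 <= t <= 1 ->
    mean_square_limit L b t A.
  (* Outside [0, 1] any random variable will do. Inside, the mean square limit does not depend on q,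
     so one process A serves all q. *)
  move=> t; have [t01|_] := boolP (0 <= t <= 1); last by exists (L 0%N 0).
  have [A hA] := mean_square_limit_exists hlambda p1 C0 psi0 psi1 psi_convex psi_lip b1
    slope_lt measL indL momL erefl hqstar t01.
  by exists A.
exists A; split.
- move=> q hq t t01.
  exact: (product_integral_cvg hlambda p1 C0 psi0 psi1 psi_convex psi_lip b1
    slope_lt measL indL momL posL erefl t01 hq (hA t t01)).
- move=> q hq _; have [Clow [Cup [c1 c2 h]]] := limit_powR_bounds hlambda p1 C0 psi0 psi1
    psi_convex psi_lip b1 slope_lt measL indL momL posL erefl hq.
  exists Clow, Cup; split => // t t01.
  have hq' : `|beta + q| < alpha.
    by apply: inside; move: hq => /andP[q0 qp]; rewrite (ltW qp) andbT; lra.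
  rewrite VG_scalingE// unlock.
  exact: h (hA t t01).
- move=> t t01.
  have := variance_ge hlambda p1 C0 psi0 psi1 psi_convex psi_lip b1
    slope_lt measL indL momL erefl hqstar t01 (hA t t01).
  apply: le_trans; rewrite le_eqVlt; apply/orP; left; apply/eqP.
  apply: eq_integral => u; rewrite inE/= in_itv/= => /andP[u0 _].
  apply: eq_integral => w; rewrite inE/= in_itv/= => /andP[w0 _].
  suff -> : bivariate_mgf P0 X c_X 1 1 u w = (expR (pair_exponent lambda b psi 1 w u))%:E by [].
  (* At level 0 times are multiplied by b^0 = 1; sorting the pair matches the order of times that a
     chain demands. *)
  pose l := unit_masses (scaled b 0 (sorted_pair w u)).
  have okl : chain_ok lambda p l.
    apply: (chain_ok_scaled hlambda p1 b1).
    - exact: sorted_sorted_pair.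
    - by rewrite /sorted_pair; case: ifP => _; rewrite /= w0 u0.
    - by rewrite /sorted_pair; case: ifP => _.
  rewrite /pair_exponent big_ord1 -(integral_expR_chain hlambda hOU hpsi okl).
  rewrite /bivariate_mgf unlock -ge0_integral_EFinZ ?expR_ge0//.
  + apply: eq_integral => v _; congr EFin; rewrite -expRD; congr expR.
    by rewrite /l /sorted_pair; case: ifP => _; rewrite /= !big_cons big_nil /= expr0 !mulr1; ring.
  + by apply: measurableT_comp => //; apply: measurable_funD; exact: measurable_funM.
Qed.
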